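(* Let $n\ge2$ and let $B_1,\ldots,B_k$ be linearly independent $n\times n$ matrices over $\mathbb{R}$ such that $\operatorname{Tr}(B_iB_i^T)=n$ for each $i$. Let $b_{ij}=\operatorname{Tr}(B_iB_j^T)$. Let $M$ be a random $n\times n$ orthogonal matrix, distributed according to Haar measure on the orthogonal group $\mathcal{O}_n$, and let $$X=(\operatorname{Tr}(B_1M),\operatorname{Tr}(B_2M),\ldots,\operatorname{Tr}(B_kM))\in\mathbb{R}^k .$$ Let $Y=(Y_1,\ldots,Y_k)$ be a centered (jointly) Gaussian random vector with covariance matrix $C:=\frac1n\left(b_{ij}\right)_{i,j=1}^k$ (so that each component $Y_i$ is standard Gaussian). Then $$d_W(X,Y)\le\frac{k\sqrt{2\|C\|_{op}}}{n-1}.$$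
   Context: The Wasserstein distance between random vectors $X,Y$ in $\mathbb{R}^k$ is $d_W(X,Y)=\sup\left|\mathbb{E}g(X)-\mathbb{E}g(Y)\right|$, the supremum being over functions $g:\mathbb{R}^k\to\mathbb{R}$ with Lipschitz constant (with respect to the Euclidean norm) at most $1$. $\|C\|_{op}=\sup_{|v|=1,|w|=1}|\langle Cv,w\rangle|$ is the operator norm. *)

(* Defs.v *)
From HB Require Import structures.
From mathcomp Require Import all_boot all_order all_algebra.
From mathcomp Require Import all_classical all_reals all_analysis.
Set Implicit Arguments.
Unset Strict Implicit.
Unset Printing Implicit Defensive.
Import Order.TTheory GRing.Theory Num.Theory.
Import numFieldNormedType.Exports.
Local Open Scope classical_set_scope.
Local Open Scope ring_scope.

Notation borel T := (g_sigma_algebraType (@open T)).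

(* R^k is 'cV[R]_k. The library norm on matrices is the sup norm, so the
   Euclidean norm has to be introduced separately; both induce the same
   topology, hence the same Borel sets. *)
Definition dotp (R : realType) (k : nat) (u v : 'cV[R]_k) : R :=
  \sum_i u i 0 * v i 0.

Definition enorm (R : realType) (k : nat) (u : 'cV[R]_k) : R :=
  Num.sqrt (dotp u u).

Definition opnorm (R : realType) (k : nat) (C : 'M[R]_k) : R :=
  sup [set dotp (C *m v) w | v in [set v : 'cV[R]_k | enorm v = 1]
                           & w in [set w : 'cV[R]_k | enorm w = 1]].

Definition lipschitz1 (R : realType) (k : nat) (g : 'cV[R]_k -> R) : Prop :=
  forall x y, `|g x - g y| <= enorm (x - y).

(* X and Y may live on different probability spaces; only their laws matter. *)
Definition wasserstein (R : realType) (k : nat)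
    (d : measure_display) (T : measurableType d) (P : probability T R)
    (X : T -> 'cV[R]_k)
    (d' : measure_display) (T' : measurableType d') (P' : probability T' R)
    (Y : T' -> 'cV[R]_k) : \bar R :=
  ereal_sup [set (`|'E_P[g \o X] - 'E_P'[g \o Y]|)%E
            | g in [set g | lipschitz1 g]].

Definition orthogonal_group (R : realType) (n : nat) : set 'M[R]_n :=
  [set Q | Q *m Q^T = 1%:M].

(* Left-invariant probability measures carried by O_n; as O_n is compact there
   is exactly one, and it is also right-invariant. *)
Definition is_haar_orthogonal (R : realType) (n : nat)
    (mu : probability (borel 'M[R]_n) R) : Prop :=
  mu (@orthogonal_group R n) = 1%E /\
  forall (Q : 'M[R]_n) (A : set (borel 'M[R]_n)),
    orthogonal_group Q -> measurable A -> mu [set Q *m U | U in A] = mu A.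

(* The degenerate normal law is a point mass; it is singled out because
   [normal_prob m 0] is a junk value (the uniform law on [0, 1]). *)
Definition is_normal (R : realType) (d : measure_display)
    (T : measurableType d) (P : probability T R) (Z : T -> R) : Prop :=
  exists m s : R, forall A : set R, measurable A ->
    P (Z @^-1` A) = if s == 0 then \d_m A else normal_prob m s A.

Definition jointly_gaussian (R : realType) (k : nat) (d : measure_display)
    (T : measurableType d) (P : probability T R) (Y : T -> 'cV[R]_k) : Prop :=
  forall a : 'cV[R]_k, is_normal P (fun t => dotp a (Y t)).

Definition is_centered_gaussian (R : realType) (k : nat) (d : measure_display)
    (T : measurableType d) (P : probability T R) (C : 'M[R]_k)
    (Y : T -> 'cV[R]_k) : Prop :=
  [/\ jointly_gaussian P Y,
      forall i, ('E_P[fun t => (Y t i 0)%R] = 0)%E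
    & forall i j,
        covariance P (fun t => Y t i 0) (fun t => Y t j 0) = (C i j)%:E].

(* Main.v *)
(* By a Cholesky factorization C = L L^T, whose factor has operator norm
   sqrt |C|_op, one reduces to orthonormal B_i (Tr (B_i B_j^T) = n delta_ij), C = 1,
   and a Lipschitz function g. Convolving g (composed with a periodization) with a
   product of de la Vallee-Poussin kernels on a grid replaces g by a trigonometric
   polynomial f with almost the same Lipschitz constant l.

   Let W be the vector of traces and Z a standard Gaussian vector independent of W.
   The function phi(t) = E f(cos t W + sin t Z) joins E f(W) at t = 0 to E f(Z) at
   t = pi/2. Rotating M by a small angle in a coordinate plane does not change
   expectations; differentiating in the angle and summing over the planes gives
     (n - 1) E (F sin (s F + b)) = s E ((Tr (A A^T) - Tr (M A M A)) cos (s F + b)),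
   F = Tr (M A). For each wave of f it shows that phi'(t) is cos t / (n - 1) times
   the pairing of the Hessian of f with the matrix (delta_ij - Tr (M B_i M B_j)).
   Integrating by parts in Z bounds this pairing by l times the Hilbert-Schmidt norm
   of that matrix, whose second moment is at most 2 k^2 by the fourth moments of
   Haar measure. Hence |phi'(t)| <= cos t * l k sqrt 2 / (n - 1), and integrating
   over [0, pi/2] gives the bound. *)
Require Import Defs.
From HB Require Import structures.
From mathcomp Require Import all_boot all_order all_algebra fingroup perm.
From mathcomp Require Import all_classical all_reals all_analysis.
From mathcomp Require Import measurable_realfun ring lra.
Set Implicit Arguments.
Unset Strict Implicit.
Unset Printing Implicit Defensive.
Import Order.TTheory GRing.Theory Num.Theory.
Import numFieldNormedType.Exports.
Local Open Scope classical_set_scope.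
Local Open Scope ring_scope.

(** The test function is merely Lipschitz while the interpolation produces a Hessian, so [f] may
    enter the final bound only through its gradient. Waves achieve this without calculus on general
    functions: the Gaussian mean of a wave is explicit, its Haar mean is a function of one scale
    parameter, and [W], [Z] need no common probability space, because averaging over [Z] with [M]
    fixed gives a closed formula. Each derivative of a mean comes from a second-order remainder
    bound, which survives integration; no theorem on differentiation under the integral is used. The
    Gaussian law is known only through the laws of its linear forms, so even Gaussian integration by
    parts is derived from characteristic functions. The approximation has to keep the Lipschitz
    constant almost exactly. Hence a positive kernel of mass one on a finite grid: a translation by
    a grid vector can be moved from the kernel to the function, where it costs nothing, and the
    derivative bounds that fill the gaps between grid points do not depend on the mesh. A second
    moment is turned into a first moment by AM-GM with the best parameter [k sqrt 2]. *)

(** * Taylor bounds for sine and cosine, and derivatives from quadratic remainders *)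

Section elementary.
Variable R : realType.
Implicit Types x u : R.

Lemma is_derive_continuousT (f df : R -> R) :
  (forall y : R, is_derive y 1 f (df y)) -> continuous f.
Proof.
move=> fdf x; apply/differentiable_continuous; apply/derivable1_diffP.
by have [] := fdf x.
Qed.

Lemma MVT_near (f df : R -> R) x u :
  (forall y : R, is_derive y 1 f (df y)) ->
  exists2 c, `|c - x| <= `|u| & f (x + u) - f x = df c * u.
Proof.
move=> fdf; have fc := is_derive_continuousT fdf.
have fcw a b : {within `[a, b], continuous f} by exact: continuous_subspaceT.
have [u0|u0] := leP 0 u.
  have [||c + ->] := @MVT_segment R f df x (x + u); rewrite ?lerDl//.
  rewrite in_itv/= => /andP[xc cxu]; exists c; last by rewrite addrAC subrr add0r.
  by rewrite !ger0_norm ?subr_ge0// lerBlDl.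
have [||c + E] := @MVT_segment R f df (x + u) x; rewrite ?gerDl ?ltW//.
rewrite in_itv/= => /andP[xc cxu]; exists c.
  by rewrite (ltr0_norm u0) ler0_norm ?subr_le0// lerN2 lerBrDl.
by rewrite -opprB E opprD addrA subrr sub0r mulrN opprK.
Qed.

Lemma sin_lip x u : `|sin (x + u) - sin x| <= `|u|.
Proof.
have [c _ ->] := MVT_near x u (@is_derive_sin R).
by rewrite normrM ler_piMl// ler_norml cos_geN1 cos_le1.
Qed.

Lemma cos_lip x u : `|cos (x + u) - cos x| <= `|u|.
Proof.
have [c _ ->] := MVT_near x u (@is_derive_cos R).
by rewrite normrM normrN ler_piMl// ler_norml sin_geN1 sin_le1.
Qed.

Lemma sin_taylor1 x u : `|sin (x + u) - sin x - u * cos x| <= u ^+ 2.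
Proof.
have [c cx ->] := MVT_near x u (@is_derive_sin R).
rewrite mulrC -mulrBr normrM -real_normK ?num_real// expr2 ler_wpM2l//.
have := cos_lip x (c - x); rewrite subrKC => /le_trans; exact.
Qed.

Lemma cos_taylor1 x u : `|cos (x + u) - cos x + u * sin x| <= u ^+ 2.
Proof.
have [c cx ->] := MVT_near x u (@is_derive_cos R).
rewrite mulNr mulrC addrC -mulrBr normrM -real_normK ?num_real// expr2 ler_wpM2l//.
have := sin_lip x (c - x); rewrite subrKC distrC => /le_trans; exact.
Qed.

Lemma normr_sin_le1 x : `|sin x| <= 1.
Proof. by rewrite ler_norml sin_geN1 sin_le1. Qed.

Lemma normr_cos_le1 x : `|cos x| <= 1.
Proof. by rewrite ler_norml cos_geN1 cos_le1. Qed.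

(** Divide by [h] and let it tend to 0. Identities between expectations are obtained in this way
    from invariances expanded to first order. *)
Lemma eq0_quadratic_bound (d K : R) :
  (forall h, `|h| <= 1 -> `|h * d| <= K * h ^+ 2) -> d = 0.
Proof.
move=> H; apply/eqP; rewrite -normr_le0; apply/ler_addgt0Pr => e e0; rewrite add0r.
have K0 : 0 <= K by have := H 1; rewrite normr1 expr1n mulr1 => /(_ (lexx _)); apply: le_trans.
pose h := Num.min 1 (e / (K + 1)).
have K1 : 0 < K + 1 by rewrite ltr_wpDl.
have h0 : 0 < h by rewrite lt_min ltr01 divr_gt0.
have := H h; rewrite gtr0_norm// ge_min lexx => /(_ isT).
rewrite normrM gtr0_norm// expr2 mulrCA ler_pM2l// => /le_trans; apply.
rewrite (@le_trans _ _ ((K + 1) * h))//.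
  by rewrite ler_pM2r// lerDl.
by rewrite -ler_pdivlMl// mulrC ge_min lexx orbT.
Qed.

(** A quadratic remainder bound passes through an integral by monotonicity, so this criterion does
    the work of differentiation under the integral sign. *)
Lemma is_derive_quadratic_bound (f : R -> R) (s d K : R) :
  (forall h, `|h| <= 1 -> `|f (s + h) - f s - h * d| <= K * h ^+ 2) ->
  is_derive s 1 f d.
Proof.
move=> H.
have K0 : 0 <= K by have := H 1; rewrite normr1 expr1n mulr1 => /(_ (lexx _)); apply: le_trans.
have K1 : 0 < K + 1 by rewrite ltr_wpDl.
suff D : h^-1 *: (f (h *: (1 : R^o) + s) - f s) @[h --> 0^'] --> d.
  by apply: DeriveDef; [apply/cvg_ex; exists d|apply/cvg_lim].
apply/cvgrPdist_le => e e0; near=> h.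
have h0 : h != 0 by near: h; exact: nbhs_dnbhs_neq.
have h1 : `|h| <= Num.min 1 (e / (K + 1)).
  near: h; apply: dnbhs0_le.
  by rewrite lt_min ltr01 divr_gt0.
move: h1; rewrite le_min => /andP[/H {}H he].
rewrite [h *: 1]mulr1 [h + s]addrC [h^-1 *: _]mulrC.
rewrite distrC -(ler_pM2r (x := `|h|)) ?normr_gt0//.
rewrite -normrM mulrBl divfK// [d * h]mulrC; apply: (le_trans H).
rewrite -real_normK ?num_real// expr2 mulrA ler_wpM2r//.
rewrite (@le_trans _ _ ((K + 1) * `|h|))//.
  by rewrite ler_wpM2r// lerDl.
by rewrite -ler_pdivlMl// mulrC.
Unshelve. all: by end_near. Qed.

End elementary.

(** * Expectations over a set of full measure *)

(* Integrals are taken over a set of full measure, so that a function bounded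
   on the support of the law need not be bounded everywhere. *)
Section expectation_on.
Context d (T : measurableType d) (R : realType).
Variables (P : probability T R) (D : set T).
Hypotheses (mD : measurable D) (PD : P D = 1%E).
Implicit Types f g : T -> R.

Definition int_on f := P.-integrable D (EFin \o f).
Definition E_on f := \int[P]_(x in D) f x.

Lemma int_onD f g : int_on f -> int_on g -> int_on (fun x => f x + g x).
Proof. by move=> If Ig; apply: eq_integrable (integrableD _ If Ig). Qed.

Lemma int_onZ k f : int_on f -> int_on (fun x => k * f x).
Proof. by move=> If; apply: eq_integrable (integrableZl _ k If). Qed.

Lemma int_on_cst k : int_on (fun=> k).
Proof. exact: finite_measure_integrable_cst. Qed.

Lemma int_onN f : int_on f -> int_on (fun x => - f x).
Proof. by move=> /(int_onZ (-1)); under eq_fun do rewrite mulN1r. Qed.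

Lemma int_onB f g : int_on f -> int_on g -> int_on (fun x => f x - g x).
Proof. by move=> If /int_onN Ig; exact: int_onD. Qed.

Lemma int_on_sum I (r : seq I) (f : I -> T -> R) :
  (forall i, int_on (f i)) -> int_on (fun x => \sum_(i <- r) f i x).
Proof.
move=> If; elim: r => [|a r ih].
  by under eq_fun do rewrite big_nil; exact: int_on_cst.
by under eq_fun do rewrite big_cons; exact: int_onD.
Qed.

Lemma le_int_on f g : measurable_fun setT f ->
  (forall x, D x -> `|f x| <= g x) -> int_on g -> int_on f.
Proof.
move=> mf fg; apply: le_integrable => //.
  by apply/measurable_EFinP; exact: measurable_funTS.
move=> x Dx; rewrite /= lee_fin (le_trans (fg _ Dx))//; exact: ler_norm.
Qed.

Lemma E_onE f : int_on f -> (\int[P]_(x in D) (f x)%:E)%E = (E_on f)%:E.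
Proof. by move=> If; rewrite /E_on /Rintegral fineK//; exact: integrable_fin_num. Qed.

Lemma E_onD f g : int_on f -> int_on g ->
  E_on (fun x => f x + g x) = E_on f + E_on g.
Proof. exact: RintegralD. Qed.

Lemma E_onZ k f : int_on f -> E_on (fun x => k * f x) = k * E_on f.
Proof. exact: RintegralZl. Qed.

Lemma E_on_cst k : E_on (fun=> k) = k.
Proof. by rewrite /E_on Rintegral_cst// (_ : fine _ = 1) ?mulr1//; exact: (congr1 fine PD). Qed.

Lemma E_onN f : int_on f -> E_on (fun x => - f x) = - E_on f.
Proof. by move=> If; rewrite -mulN1r -E_onZ//; under eq_fun do rewrite -mulN1r. Qed.

Lemma E_onB f g : int_on f -> int_on g ->
  E_on (fun x => f x - g x) = E_on f - E_on g.
Proof. exact: RintegralB. Qed.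

Lemma E_on_sum I (r : seq I) (f : I -> T -> R) : (forall i, int_on (f i)) ->
  E_on (fun x => \sum_(i <- r) f i x) = \sum_(i <- r) E_on (f i).
Proof.
move=> If; elim: r => [|a r ih].
  by rewrite big_nil; under eq_fun do rewrite big_nil; exact: E_on_cst.
rewrite big_cons -ih -E_onD//; last exact: int_on_sum.
by under eq_fun do rewrite big_cons.
Qed.

Lemma eq_E_on f g : (forall x, D x -> f x = g x) -> E_on f = E_on g.
Proof. by move=> fg; apply: eq_Rintegral => x; rewrite inE => /fg. Qed.

Lemma le_E_on f g : int_on f -> int_on g ->
  (forall x, D x -> f x <= g x) -> E_on f <= E_on g.
Proof. exact: le_Rintegral. Qed.

Lemma normr_E_on_le f g : int_on f -> int_on g ->
  (forall x, D x -> `|f x| <= g x) -> `|E_on f| <= E_on g.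
Proof.
move=> If Ig fg; rewrite ler_norml -E_onN//.
by apply/andP; split; apply: le_E_on => //;
  [exact: int_onN|move=> x /fg|move=> x /fg]; rewrite ler_norml => /andP[].
Qed.

End expectation_on.

(** * Measurability and image laws *)

Section borel.
Variable R : realType.

Lemma continuous_borel_measurable (S : ptopologicalType) (f : S -> R) :
  continuous f -> measurable_fun setT (f : borel S -> R).
Proof.
move=> cf; apply: (measurability _ (RGenOpens.measurableE R)) => _ [_ [a [b ->] <-]].
rewrite setTI; apply: sub_sigma_algebra.
by apply: open_comp => //; exact: interval_open.
Qed.

End borel.

Lemma ge0_integral_law d1 d2 (T1 : measurableType d1) (T2 : measurableType d2)
    (R : realType) (mu : {measure set T1 -> \bar R})
    (nu : {measure set T2 -> \bar R}) (Z : T1 -> T2) (g : T2 -> \bar R) :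
  measurable_fun setT Z ->
  (forall A, measurable A -> mu (Z @^-1` A) = nu A) ->
  measurable_fun setT g -> (forall x, 0 <= g x)%E ->
  (\int[mu]_t g (Z t) = \int[nu]_x g x)%E.
Proof.
move=> mZ ZE mg g0.
pose mZ_mixin := isMeasurableFun.Build _ _ _ _ _ mZ.
pose mZ_pack : {mfun T1 >-> T2} := HB.pack Z mZ_mixin.
have H := ge0_integral_pushforward mZ mu measurableT mg (fun x _ => g0 x).
rewrite preimage_setT in H; rewrite -[LHS]H.
by rewrite (@eq_measure_integral _ T2 R setT (pushforward mu mZ_pack) nu)// => A mA _; have := ZE A mA.
Qed.

(** * Exponential tilting of the normal law *)

Section normal_shift.
Variable R : realType.
Notation leb := (@lebesgue_measure R).

(** The Radon-Nikodym derivative of [normal_prob] and [normal_pdf] have the same integral over every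
    measurable set, so they agree almost everywhere. *)
Lemma ge0_integral_normal_prob (m s : R) (f : R -> \bar R) :
  measurable_fun setT f -> (forall x, 0 <= f x)%E ->
  (\int[normal_prob m s]_x f x = \int[leb]_x (f x * (normal_pdf m s x)%:E))%E.
Proof.
move=> mf f0; have dom := normal_prob_dominates m s.
rewrite -(Radon_Nikodym_SigmaFinite.change_of_variables dom)//.
have IRN := Radon_Nikodym_SigmaFinite.f_integrable dom.
apply: ae_eq_integral => //.
- by apply: emeasurable_funM => //; exact: (measurable_int leb).
- apply: emeasurable_funM => //; apply/measurable_EFinP.
  exact: measurable_normal_pdf.
- apply: ae_eqe_mul2l; apply: integral_ae_eq => //.
  + by apply/measurable_EFinP; exact: measurable_normal_pdf.
  + by move=> E _ mE; rewrite -(Radon_Nikodym_SigmaFinite.f_integral dom).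
Qed.

Lemma lebesgue_integral_shift (G : R -> R) (c : R) :
  continuous G -> (forall x, 0 <= G x) ->
  (\int[leb]_x (G x)%:E = \int[leb]_x (G (x - c))%:E)%E.
Proof.
move=> cG G0; pose F x : R := x - c.
have dF (x : R) : is_derive x (1 : R) F 1.
  by apply: is_derive_eq; rewrite subr0.
have F'E : F^`()%classic = cst 1 by apply/funext => x; rewrite derive1E derive_val.
rewrite (@increasing_ge0_integration_by_substitutionT R F)//.
- by apply: eq_integral => x _; rewrite F'E /= mulr1.
- by move=> x y xy; rewrite /F ltrD2r.
- by rewrite F'E; exact: cst_continuous.
- by rewrite F'E; exact: is_cvg_cst.
- by rewrite F'E; exact: is_cvg_cst.
- exact: cvg_addrr_Ny.
- exact: cvg_addrr.
Qed.

(** Completing the square: an exponential weight only moves the centre of the density, up to a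
    constant factor. *)
Lemma normal_pdf_shift (m s u x : R) : s != 0 ->
  expR (u * x) * normal_pdf m s x =
  expR (u * m + u ^+ 2 * s ^+ 2 / 2) * normal_pdf m s (x - u * s ^+ 2).
Proof.
move=> s0; rewrite !normal_pdfE// mulrCA [RHS]mulrCA; congr (_ * _).
rewrite /normal_fun -!expRD; congr expR; field.
by rewrite s0.
Qed.

Lemma normal_prob_shift (m s u : R) (f : R -> R) : s != 0 ->
  continuous f -> (forall x, 0 <= f x) ->
  (\int[normal_prob m s]_x (f x * expR (u * x))%:E =
   (expR (u * m + u ^+ 2 * s ^+ 2 / 2))%:E *
     \int[normal_prob m s]_x (f (x + u * s ^+ 2))%:E)%E.
Proof.
move=> s0 cf f0.
have cexp : continuous (fun x : R => expR (u * x)).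
  move=> x; apply: (@continuous_comp _ _ _ ( *%R u) expR); last exact: continuous_expR.
  exact: mulrl_continuous.
have cfs : continuous (fun x => f (x + u * s ^+ 2)).
  move=> x; apply: (@continuous_comp _ _ _ (+%R^~ _) f); last exact: cf.
  by apply: cvgD; [exact: cvg_id|exact: cvg_cst].
have m1 : measurable_fun setT (EFin \o (fun x : R => f x * expR (u * x))).
  apply/measurable_EFinP; apply: continuous_measurable_fun => x.
  by apply: cvgM; [exact: cf|exact: cexp].
have m2 : measurable_fun setT (EFin \o (fun x => f (x + u * s ^+ 2))).
  by apply/measurable_EFinP; exact: continuous_measurable_fun.
rewrite (ge0_integral_normal_prob m s m1); last first.
  by move=> x; rewrite lee_fin mulr_ge0// expR_ge0.
rewrite (ge0_integral_normal_prob m s m2); last by move=> x; rewrite lee_fin.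
under [in RHS]eq_integral do rewrite -EFinM.
rewrite [in RHS](lebesgue_integral_shift (u * s ^+ 2)); first last.
- by move=> x; rewrite mulr_ge0// normal_pdf_ge0.
- by move=> x; apply: cvgM; [exact: cfs|exact: continuous_normal_pdf].
rewrite -ge0_integralZl//; last 2 first.
- apply/measurable_EFinP/measurable_funM.
    apply: (measurableT_comp (f := f)); first exact: continuous_measurable_fun.
    by apply: measurable_funD => //; apply: measurable_funD.
  apply: measurableT_comp; first exact: measurable_normal_pdf.
  exact: measurable_funD.
- by move=> x _; rewrite lee_fin mulr_ge0// normal_pdf_ge0.
apply: eq_integral => x _; rewrite /= subrK -!EFinM; congr EFin.
have /= H := normal_pdf_shift m u (x : R) s0.
by rewrite -[LHS]mulrA [_ * normal_pdf m s x]H [LHS]mulrCA.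
Qed.

Context d (T : measurableType d) (P : probability T R).

(* The law of [Z] enters only through this identity. *)
Lemma is_normal_shift (Z : T -> R) : measurable_fun setT Z -> is_normal P Z ->
  exists m s : R, forall u (f : R -> R), continuous f -> (forall x, 0 <= f x) ->
  (\int[P]_t (f (Z t) * expR (u * Z t))%:E =
   (expR (u * m + u ^+ 2 * s ^+ 2 / 2))%:E *
     \int[P]_t (f (Z t + u * s ^+ 2))%:E)%E.
Proof.
move=> mZ [m [s ZE]]; exists m, s => u f cf f0.
have mexp : measurable_fun setT (fun x : R => expR (u * x)).
  by apply: measurableT_comp => //; exact: measurable_funM.
have mf : measurable_fun setT f by exact: continuous_measurable_fun.
have m1 : measurable_fun setT (EFin \o (fun x : R => f x * expR (u * x))).
  by apply/measurable_EFinP/measurable_funM.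
have m2 : measurable_fun setT (EFin \o (fun x => f (x + u * s ^+ 2))).
  apply/measurable_EFinP; apply: (measurableT_comp (f := f)) => //.
  exact: measurable_funD.
have fe0 x : (0 <= (f x * expR (u * x))%:E)%E by rewrite lee_fin mulr_ge0// expR_ge0.
have fs0 x : (0 <= (f (x + u * s ^+ 2))%:E)%E by rewrite lee_fin.
(* In the degenerate case the law is a point mass at [m], the shift [u * s ^+ 2] vanishes, and both
   sides are [f m * expR (u * m)]. The identity thus treats both kinds of normal law alike. *)
have [s0|s0] := eqVneq s 0.
  have E A : measurable A -> P (Z @^-1` A) = \d_m A.
    by move=> mA; rewrite ZE// s0 eqxx.
  rewrite (ge0_integral_law mZ E m1 fe0) (ge0_integral_law mZ E m2 fs0).
  rewrite !integral_dirac//= diracT !mul1e -EFinM; congr EFin.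
  by rewrite s0 expr0n/= !mulr0 mul0r !addr0 mulrC.
have E A : measurable A -> P (Z @^-1` A) = normal_prob m s A.
  by move=> mA; rewrite ZE// (negbTE s0).
rewrite (ge0_integral_law (nu := normal_prob m s) mZ E m1 fe0).
rewrite (ge0_integral_law (nu := normal_prob m s) mZ E m2 fs0).
exact: normal_prob_shift.
Qed.

End normal_shift.

(** * Stein's identity for a normal variable *)

Section exponential_bounds.
Variable R : realType.
Implicit Types x v : R.

Lemma expR_taylor1 v : `|expR v - 1 - v| <= v ^+ 2 * expR `|v|.
Proof.
have B (c y : R) : `|c| <= `|y| -> `|expR c * y| <= expR `|y| * `|y|.
  move=> cy; rewrite normrM ler_wpM2r// ger0_norm ?expR_ge0// ler_expR.
  exact: le_trans (ler_norm _) _.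
have [c] := MVT_near 0 v (@is_derive_expR R).
rewrite add0r subr0 expR0 => cv ->; rewrite -[X in _ - X]mul1r -mulrBl normrM.
have [c'] := MVT_near 0 c (@is_derive_expR R).
rewrite add0r subr0 expR0 => cc' ->.
rewrite -real_normK ?num_real// expr2 -mulrA mulrC ler_wpM2l//.
rewrite (le_trans (B _ _ cc'))// mulrC ler_pM ?expR_ge0//.
by rewrite ler_expR.
Qed.

Lemma sqr_le_expR x : x ^+ 2 <= 4 * expR `|x|.
Proof.
have -> : `|x| = `|x| / 2 + `|x| / 2 by rewrite -splitr.
rewrite expRD; have H := expR_ge1Dx (`|x| / 2); have := normr_ge0 x.
rewrite -real_normK ?num_real//; nra.
Qed.

Lemma normr_le_expR x : `|x| <= expR `|x|.
Proof. by rewrite (le_trans _ (expR_ge1Dx _))// lerDr. Qed.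

Lemma expR_abs_ge1 x : 1 <= expR `|x|.
Proof. by rewrite -[leLHS]expR0 ler_expR. Qed.

End exponential_bounds.

Section normal_stein.
Context d (T : measurableType d) (R : realType) (P : probability T R).
Variables (Z : T -> R) (m s : R).
Hypothesis mZ : measurable_fun setT Z.
Hypothesis shiftZ : forall u (f : R -> R), continuous f -> (forall x, 0 <= f x) ->
  (\int[P]_t (f (Z t) * expR (u * Z t))%:E =
   (expR (u * m + u ^+ 2 * s ^+ 2 / 2))%:E *
     \int[P]_t (f (Z t + u * s ^+ 2))%:E)%E.
Let I f := int_on P setT f.
Let E f := E_on P setT f.

Let PT : P setT = 1%E. Proof. exact: probability_setT. Qed.

(** With [f = 1] the tilting identity is the moment generating function, so it already contains all
    exponential moments. *)
Lemma int_expR_normal c : I (fun t => expR (c * Z t)).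
Proof.
apply/integrableP; split.
  apply/measurable_EFinP; apply: measurableT_comp => //.
  exact: measurable_funM.
have := @shiftZ c (fun=> 1) (@cst_continuous _ _ _) (fun=> ler01).
under eq_integral do rewrite mul1r.
rewrite integral_cst//= probability_setT !mule1.
under [X in (X < _)%E]eq_integral do rewrite /= ger0_norm ?expR_ge0//.
by move=> ->; rewrite ltry.
Qed.

Lemma int_expR_abs_normal (k : nat) : I (fun t => expR (k%:R * `|Z t|)).
Proof.
apply: (@le_int_on _ _ _ P setT measurableT _
  (fun t => expR (k%:R * Z t) + expR (- k%:R * Z t))).
- apply: measurableT_comp => //; apply: measurable_funM => //.
  exact: measurableT_comp.
- move=> t _; rewrite ger0_norm ?expR_ge0//; case: (leP 0 (Z t)) => z0.
    by rewrite (ger0_norm z0) lerDl expR_ge0.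
  by rewrite (ltr0_norm z0) mulrN mulNr lerDr expR_ge0.
- by apply: int_onD => //; exact: int_expR_normal.
Qed.

Lemma int_normal (f : R -> R) (K : R) (k : nat) : measurable_fun setT f ->
  (forall x, `|f x| <= K * expR (k%:R * `|x|)) -> I (fun t => f (Z t)).
Proof.
move=> mf fK.
apply: (@le_int_on _ _ _ P setT measurableT _ (fun t => K * expR (k%:R * `|Z t|))).
- exact: measurableT_comp.
- by move=> t _; exact: fK.
- by apply: int_onZ => //; exact: int_expR_abs_normal.
Qed.

(** This is the derivative at [u = 0] of the tilting identity: the left side contributes [f (Z) Z],
    the Gaussian factor contributes [m], and the shift contributes [s ^+ 2 * f']. The function is
    nonnegative because the tilting identity compares integrals of nonnegative functions. *)
Lemma normal_stein (f f' : R -> R) (K : R) :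
  continuous f -> (forall x, 0 <= f x) -> measurable_fun setT f' ->
  (forall x, f x <= K * expR `|x|) ->
  (forall x, `|f' x| <= K * expR `|x|) ->
  (forall x h, `|f (x + h) - f x - h * f' x| <= K * h ^+ 2) ->
  E (fun t => f (Z t) * Z t) =
    m * E (fun t => f (Z t)) + s ^+ 2 * E (fun t => f' (Z t)).
Proof.
move=> cf f0 mf' fK f'K fT.
have mf : measurable_fun setT f by exact: continuous_measurable_fun.
have K0 : 0 <= K by have := le_trans (f0 0) (fK 0); rewrite normr0 expR0 mulr1.
have If : I (fun t => f (Z t)).
  by apply: (@int_normal f K 1) => // x; rewrite mul1r ger0_norm.
have If' : I (fun t => f' (Z t)).
  by apply: (@int_normal f' K 1) => // x; rewrite mul1r.
have IfZ : I (fun t => f (Z t) * Z t).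
  apply: (@int_normal (fun x => f x * x) K 2) => [|x].
    exact: measurable_funM.
  rewrite (_ : 2 * `|x| = `|x| + `|x|) ?expRD; last by rewrite mulr_natl mulr2n.
  by rewrite normrM (ger0_norm (f0 x)) mulrA ler_pM// normr_le_expR.
have Ie3 : I (fun t => expR (3%:R * `|Z t|)) by exact: int_expR_abs_normal.
pose e3 := E (fun t => expR (3%:R * `|Z t|)).
pose a := E (fun t => f (Z t)); pose b := s ^+ 2 * E (fun t => f' (Z t)).
pose c := E (fun t => f (Z t) * Z t).
pose c0 := `|m| + s ^+ 2 / 2.
pose K2 := c0 ^+ 2 * expR c0 + s ^+ 2 / 2.
have s20 : 0 <= s ^+ 2 by rewrite sqr_ge0.
have c00 : 0 <= c0 by rewrite addr_ge0// divr_ge0.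
apply/eqP; rewrite -subr_eq0 -/a -/b -/c; apply/eqP.
(* The four terms bound four remainders, in this order: that of [expR (u * Z)] on the left, those of
   the factor [expR w] to second and to first order, and that of [f] at the shifted point. *)
apply: (@eq0_quadratic_bound R _ (4 * K * e3 + K2 * `|a| + (`|m| + K2) * `|b| +
   expR c0 * (K * (s ^+ 2) ^+ 2))) => u u1.
have Iexp : I (fun t => f (Z t) * expR (u * Z t)).
  apply: (@int_normal (fun x => f x * expR (u * x)) K 2) => [|x].
    by apply: measurable_funM => //; apply: measurableT_comp => //; exact: measurable_funM.
  rewrite (_ : 2 * `|x| = `|x| + `|x|) ?expRD; last by rewrite mulr_natl mulr2n.
  rewrite normrM (ger0_norm (f0 x)) mulrA ler_pM// ger0_norm ?expR_ge0// ler_expR.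
  by rewrite (le_trans (ler_norm _))// normrM ler_piMl.
have Ishift : I (fun t => f (Z t + u * s ^+ 2)).
  apply: (@int_normal (fun x => f (x + u * s ^+ 2)) (K + `|u * s ^+ 2| * K + K * (u * s ^+ 2) ^+ 2) 1).
    by apply: (measurableT_comp (f := f)) => //; exact: measurable_funD.
  move=> x; rewrite mul1r; set h := u * _.
  have := fT x h; have := f'K x; have := fK x; have := f0 x; have := expR_abs_ge1 x.
  set y := expR _ => y1 fx0 fx f'x fh.
  have -> : f (x + h) = (f (x + h) - f x - h * f' x) + (f x + h * f' x) by ring.
  rewrite (le_trans (ler_normD _ _))// !mulrDl [leRHS]addrC lerD//.
    rewrite (le_trans fh)// -[leLHS]mulr1 ler_pM// mulr_ge0//.
    exact: sqr_ge0.
  rewrite (le_trans (ler_normD _ _))// lerD//; first by rewrite ger0_norm.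
  by rewrite normrM -mulrA ler_wpM2l.
pose w := u * m + u ^+ 2 * s ^+ 2 / 2.
pose A := E (fun t => f (Z t) * expR (u * Z t)).
pose B := E (fun t => f (Z t + u * s ^+ 2)).
have AB : A = expR w * B.
  by have := shiftZ u cf f0; rewrite (E_onE measurableT Iexp) (E_onE measurableT Ishift) => -[].
have w1 : `|w| <= `|u| * c0.
  rewrite (le_trans (ler_normD _ _))// normrM mulrDr lerD//.
  have s22 : 0 <= s ^+ 2 / 2 by rewrite divr_ge0.
  rewrite -mulrA normrM (ger0_norm s22) ger0_norm ?sqr_ge0// ler_wpM2r//.
  rewrite -real_normK ?num_real// expr2.
  by rewrite ler_piMl.
have w2 : `|w| <= c0 by rewrite (le_trans w1)// ler_piMl.
have ew : `|expR w - 1 - u * m| <= K2 * u ^+ 2.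
  have -> : expR w - 1 - u * m = (expR w - 1 - w) + (w - u * m) by ring.
  rewrite (le_trans (ler_normD _ _))// /K2 mulrDl lerD//.
    rewrite (le_trans (expR_taylor1 w))// [leRHS]mulrAC ler_pM ?sqr_ge0 ?expR_ge0//.
      rewrite -exprMn -real_normK ?num_real// -[leRHS]real_normK ?num_real//.
      by rewrite lerXn2r ?nnegrE// normrM (ger0_norm c00) mulrC.
    by rewrite ler_expR.
  rewrite /w addrAC subrr add0r -mulrA mulrC ger0_norm// mulr_ge0 ?divr_ge0//.
  exact: sqr_ge0.
have K20 : 0 <= K2.
  by rewrite addr_ge0 ?divr_ge0// mulr_ge0 ?sqr_ge0// expR_ge0.
have ew1 : `|expR w - 1| <= `|u| * (`|m| + K2).
  rewrite -[_ - 1](subrK (u * m)) (le_trans (ler_normD _ _))// addrC mulrDr lerD//.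
    by rewrite normrM.
  rewrite (le_trans ew)// mulrC ler_wpM2r// -real_normK ?num_real// expr2.
  by rewrite ler_piMl.
have HA : `|A - (a + u * c)| <= 4 * K * e3 * u ^+ 2.
  have I1 : I (fun t => f (Z t) + u * (f (Z t) * Z t)).
    by apply: int_onD => //; exact: int_onZ.
  rewrite /a /c -(E_onZ measurableT)// -(E_onD measurableT)//; last exact: int_onZ.
  rewrite -(E_onB measurableT)// mulrAC -(E_onZ measurableT)//.
  apply: (normr_E_on_le measurableT); first exact: int_onB.
    exact: int_onZ.
  move=> t _; set z := Z t.
  have -> : f z * expR (u * z) - (f z + u * (f z * z)) = f z * (expR (u * z) - 1 - u * z) by ring.
  rewrite normrM (ger0_norm (f0 z)).
  have -> : 4 * K * u ^+ 2 * expR (3 * `|z|) =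
    (K * expR `|z|) * (u ^+ 2 * (4 * expR `|z|) * expR `|z|).
    rewrite (_ : 3 * `|z| = `|z| + `|z| + `|z|) ?expRD; last by ring.
    by ring.
  rewrite ler_pM// (le_trans (expR_taylor1 _))//.
  rewrite ler_pM ?sqr_ge0 ?expR_ge0//.
    by rewrite exprMn ler_wpM2l ?sqr_ge0// sqr_le_expR.
  by rewrite ler_expR normrM ler_piMl.
have HB : `|B - (a + u * b)| <= K * (s ^+ 2) ^+ 2 * u ^+ 2.
  have I1 : I (fun t => f (Z t) + (u * s ^+ 2) * f' (Z t)).
    by apply: int_onD => //; exact: int_onZ.
  rewrite /a /b mulrA -(E_onZ measurableT)// -(E_onD measurableT)//; last exact: int_onZ.
  rewrite -(E_onB measurableT)// -[leRHS](E_on_cst measurableT PT).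
  apply: (normr_E_on_le measurableT); first exact: int_onB.
    exact: int_on_cst.
  move=> t _; rewrite opprD addrA (le_trans (fT _ _))//.
  by rewrite exprMn [u ^+ 2 * _]mulrC mulrA.
have -> : u * (c - (m * a + b)) =
    - (A - (a + u * c)) + ((expR w - 1 - u * m) * a + (expR w - 1) * (u * b)
    + expR w * (B - (a + u * b))).
  by rewrite AB; ring.
have tri (p q r t p' q' r' t' : R) : `|p| <= p' -> `|q| <= q' -> `|r| <= r' ->
    `|t| <= t' -> `|- p + (q + r + t)| <= p' + q' + r' + t'.
  move=> Hp Hq Hr Ht; rewrite (le_trans (ler_normD _ _))// normrN -!addrA lerD//.
  rewrite addrA (le_trans (ler_normD _ _))// addrA lerD//.
  by rewrite (le_trans (ler_normD _ _))// lerD.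
rewrite 3!(mulrDl _ _ (u ^+ 2)); apply: tri => //.
- by rewrite normrM [leRHS]mulrAC ler_wpM2r.
- rewrite normrM normrM mulrA [leRHS]mulrAC ler_wpM2r//.
  rewrite -[u ^+ 2]real_normK ?num_real// expr2 mulrA ler_wpM2r//.
  by rewrite mulrC.
- rewrite normrM -mulrA ler_pM ?expR_ge0// ger0_norm ?expR_ge0// ler_expR.
  by rewrite (le_trans (ler_norm _)).
Qed.

End normal_stein.

(** * Characteristic function of a centered normal variable *)

Section normal_characteristic.
Context d (T : measurableType d) (R : realType) (P : probability T R).
Variable Z : T -> R.
Hypotheses (mZ : measurable_fun setT Z) (nZ : is_normal P Z).
Let I f := int_on P setT f.
Let E f := E_on P setT f.
Let PT : P setT = 1%E. Proof. exact: probability_setT. Qed.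

Lemma int_is_normal (f : R -> R) (K : R) (k : nat) : measurable_fun setT f ->
  (forall x, `|f x| <= K * expR (k%:R * `|x|)) -> I (fun t => f (Z t)).
Proof.
have [m [s shiftZ]] := is_normal_shift mZ nZ.
exact: (int_normal mZ shiftZ).
Qed.

Lemma int_is_normal_id : I Z.
Proof.
apply: (@int_is_normal id 1 1) => // x.
by rewrite !mul1r normr_le_expR.
Qed.

Lemma int_is_normal_sqr : I (fun t => Z t ^+ 2).
Proof.
apply: (@int_is_normal (fun x => x ^+ 2) 4 1) => [|x]; first exact: measurable_funX.
by rewrite mul1r ger0_norm ?sqr_ge0// sqr_le_expR.
Qed.

Lemma int_bounded (f : R -> R) (K : R) : continuous f -> (forall x, `|f x| <= K) ->
  I (fun t => f (Z t)).
Proof.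
move=> cf fK.
apply: (@le_int_on _ _ _ P setT measurableT _ (fun=> K)).
- by apply: (measurableT_comp (f := f)) => //; exact: continuous_measurable_fun.
- by move=> t _; exact: fK.
- exact: int_on_cst.
Qed.

Let contM (g : R -> R) (t : R) : continuous g -> continuous (fun x => g (t * x)).
Proof.
move=> cg x; apply: (@continuous_comp _ _ _ ( *%R t) g); last exact: cg.
exact: mulrl_continuous.
Qed.

Let cont1D (g : R -> R) : continuous g -> continuous (fun x => 1 + g x).
Proof. by move=> cg x; apply: cvgD; [exact: cvg_cst|exact: cg]. Qed.

Lemma int_cos_normal (t : R) : I (fun x => cos (t * Z x)).
Proof.
by apply: (@int_bounded (fun x => cos (t * x)) 1) => [|x];
  [exact/contM/continuous_cos|exact: normr_cos_le1].
Qed.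

Lemma int_sin_normal (t : R) : I (fun x => sin (t * Z x)).
Proof.
by apply: (@int_bounded (fun x => sin (t * x)) 1) => [|x];
  [exact/contM/continuous_sin|exact: normr_sin_le1].
Qed.

Hypothesis EZ0 : E Z = 0.

(* Stein's identity [E Z f(Z) = v E f'(Z)] turns into linear differential
   equations for the real and imaginary parts of the characteristic function. *)
Lemma normal_stein_trig : exists2 v : R, E (fun x => Z x ^+ 2) = v &
  forall t, E (fun x => Z x * sin (t * Z x)) = t * v * E (fun x => cos (t * Z x)) /\
            E (fun x => Z x * cos (t * Z x)) = - (t * v * E (fun x => sin (t * Z x))).
Proof.
have [m [s shiftZ]] := is_normal_shift mZ nZ.
have stein := normal_stein mZ shiftZ.
have IZ := int_is_normal_id; have IZ2 := int_is_normal_sqr.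
have m0 : m = 0.
  have E1 : E (fun x => 1 * Z x) = 0 by rewrite -EZ0; apply: eq_E_on => x _; rewrite mul1r.
  rewrite -E1 /E (stein (fun=> 1) (fun=> 0) 1).
  - by rewrite !(E_on_cst measurableT PT) mulr0 addr0 mulr1.
  - exact: cst_continuous.
  - by [].
  - exact: measurable_cst.
  - by move=> x; rewrite mul1r expR_abs_ge1.
  - by move=> x; rewrite normr0 mul1r expR_ge0.
  - by move=> x h; rewrite subrr mulr0 subr0 normr0 mul1r sqr_ge0.
(* Stein's identity is available for nonnegative functions, which excludes [f x = x]. It is applied
   to [(x + c) ^+ 2] with [c = 1] and [c = -1]; the difference of the two instances isolates the
   second moment. *)
have Esq : E (fun x => Z x ^+ 2) = s ^+ 2.
  have S c : `|c| <= 1 -> E (fun x => Z x * (Z x ^+ 2 + c ^+ 2)) + 2 * c * E (fun x => Z x ^+ 2)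
      = s ^+ 2 * (2 * c).
    move=> c1.
    have I3 : I (fun x => Z x * (Z x ^+ 2 + c ^+ 2)).
      apply: (@int_is_normal (fun x => x * (x ^+ 2 + c ^+ 2)) 5 2) => [|x].
        by apply: measurable_funM => //; apply: measurable_funD => //; exact: measurable_funX.
      rewrite (_ : 2%:R * `|x| = `|x| + `|x|) ?expRD; last by rewrite mulr_natl mulr2n.
      rewrite normrM [leRHS]mulrCA ler_pM// ?normr_le_expR//.
      rewrite ger0_norm ?addr_ge0 ?sqr_ge0//.
      have := sqr_le_expR x; have := expR_abs_ge1 x.
      have : c ^+ 2 <= 1 by rewrite -real_normK ?num_real// exprn_ile1.
      by lra.
    have Ec : E (fun x => Z x + c) = c.
      by rewrite /E (E_onD measurableT)// ?(E_on_cst measurableT PT) -/(E Z) ?EZ0 ?add0r//; exact: int_on_cst.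
    rewrite -[in RHS]Ec -[in RHS](E_onZ measurableT); last by apply: int_onD => //; exact: int_on_cst.
    transitivity (E (fun x => (Z x + c) ^+ 2 * Z x)).
      rewrite -(E_onZ measurableT)// -(E_onD measurableT)//; last exact: int_onZ.
      by apply: eq_E_on => x _; ring.
    rewrite /E (@stein (fun x => (x + c) ^+ 2) (fun x => 2 * (x + c)) 10).
    - by rewrite m0 mul0r add0r.
    - move=> x; apply: (@continuous_comp _ _ _ (+%R^~ c) (fun x => x ^+ 2)); last exact: exprn_continuous.
      by apply: cvgD; [exact: cvg_id|exact: cvg_cst].
    - by move=> x; exact: sqr_ge0.
    - by apply: measurable_funM => //; exact: measurable_funD.
    - move=> x; have := sqr_le_expR x; have := expR_abs_ge1 x.
      have : c ^+ 2 <= 1 by rewrite -real_normK ?num_real// exprn_ile1.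
      by move: (sqr_ge0 (x - c)); nra.
    - move=> x; rewrite normrM (le_trans (ler_wpM2l _ (ler_normD _ _)))//.
      rewrite ger0_norm//; have := normr_le_expR x; have := expR_abs_ge1 x; lra.
    - move=> x h; rewrite (_ : _ - _ = h ^+ 2); last by ring.
      by rewrite ger0_norm ?sqr_ge0// ler_peMl ?sqr_ge0// ler1n.
  have := S 1; have := S (-1); rewrite normrN1 normr1 sqrrN => /(_ (lexx _)) + /(_ (lexx _)).
  by lra.
exists (s ^+ 2) => // t.
have bexp (K x : R) : 0 <= K -> K <= K * expR `|x|.
  by move=> K0; rewrite ler_peMr// expR_abs_ge1.
have K0 : 0 <= 2 + `|t| + t ^+ 2 by rewrite !addr_ge0// sqr_ge0.
have IZs : I (fun x => Z x * sin (t * Z x)).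
  apply: (@int_is_normal (fun x => x * sin (t * x)) 1 1) => [|x].
    apply: measurable_funM => //; apply: continuous_measurable_fun.
    exact/contM/continuous_sin.
  rewrite !mul1r normrM -[leRHS]mulr1 ler_pM// ?normr_le_expR//.
  exact: normr_sin_le1.
have IZc : I (fun x => Z x * cos (t * Z x)).
  apply: (@int_is_normal (fun x => x * cos (t * x)) 1 1) => [|x].
    apply: measurable_funM => //; apply: continuous_measurable_fun.
    exact/contM/continuous_cos.
  rewrite !mul1r normrM -[leRHS]mulr1 ler_pM// ?normr_le_expR//.
  exact: normr_cos_le1.
split.
(* The added 1 makes the function nonnegative; it contributes [E Z = 0] on the left and nothing to
   the derivative. *)
- have := @stein (fun x => 1 + sin (t * x)) (fun x => t * cos (t * x)) (2 + `|t| + t ^+ 2).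
  rewrite m0 mul0r add0r => H.
  transitivity (E (fun x => (1 + sin (t * Z x)) * Z x)).
    rewrite -[LHS]add0r -EZ0 -(E_onD measurableT)//.
    by apply: eq_E_on => x _; ring.
  rewrite [LHS]H {H}.
  + by rewrite (E_onZ measurableT) 1?[LHS]mulrCA ?mulrA//; exact: int_cos_normal.
  + exact/cont1D/contM/continuous_sin.
  + by move=> x; rewrite -lerBlDl sub0r sin_geN1.
  + apply: measurable_funM => //; apply: continuous_measurable_fun.
    exact/contM/continuous_cos.
  + move=> x; apply: le_trans (bexp _ x K0).
    have := sin_le1 (t * x); have := normr_ge0 t; have := sqr_ge0 t; lra.
  + move=> x; apply: le_trans (bexp _ x K0).
    rewrite normrM (le_trans (ler_wpM2l _ (normr_cos_le1 _)))//.
    have := normr_ge0 t; have := sqr_ge0 t; lra.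
  + move=> x h; have := sin_taylor1 (t * x) (t * h); rewrite exprMn => B.
    rewrite (_ : _ - _ = sin (t * x + t * h) - sin (t * x) - t * h * cos (t * x)); last first.
      by rewrite mulrDr; ring.
    rewrite (le_trans B)// ler_wpM2r ?sqr_ge0//.
    have := normr_ge0 t; have := sqr_ge0 t; lra.
- have := @stein (fun x => 1 + cos (t * x)) (fun x => - t * sin (t * x)) (2 + `|t| + t ^+ 2).
  rewrite m0 mul0r add0r => H.
  transitivity (E (fun x => (1 + cos (t * Z x)) * Z x)).
    rewrite -[LHS]add0r -EZ0 -(E_onD measurableT)//.
    by apply: eq_E_on => x _; ring.
  rewrite [LHS]H {H}.
  + by rewrite (E_onZ measurableT) 1?[LHS]mulrCA ?mulNr ?mulrA//; exact: int_sin_normal.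
  + exact/cont1D/contM/continuous_cos.
  + by move=> x; rewrite -lerBlDl sub0r cos_geN1.
  + apply: measurable_funM => //; apply: continuous_measurable_fun.
    exact/contM/continuous_sin.
  + move=> x; apply: le_trans (bexp _ x K0).
    have := cos_le1 (t * x); have := normr_ge0 t; have := sqr_ge0 t; lra.
  + move=> x; apply: le_trans (bexp _ x K0).
    rewrite normrM normrN (le_trans (ler_wpM2l _ (normr_sin_le1 _)))//.
    have := normr_ge0 t; have := sqr_ge0 t; lra.
  + move=> x h; have := cos_taylor1 (t * x) (t * h); rewrite exprMn => B.
    rewrite (_ : _ - _ = cos (t * x + t * h) - cos (t * x) + t * h * sin (t * x)); last first.
      by rewrite mulrDr; ring.
    rewrite (le_trans B)// ler_wpM2r ?sqr_ge0//.
    have := normr_ge0 t; have := sqr_ge0 t; lra.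
Qed.

Lemma is_derive_cos_normal (t : R) :
  is_derive t 1 (fun t => E (fun x => cos (t * Z x))) (- E (fun x => Z x * sin (t * Z x))).
Proof.
have IZ2 := int_is_normal_sqr.
have IZs : I (fun x => Z x * sin (t * Z x)).
  apply: (@int_is_normal (fun x => x * sin (t * x)) 1 1) => [|x].
    apply: measurable_funM => //; apply: continuous_measurable_fun.
    exact/contM/continuous_sin.
  rewrite !mul1r normrM -[leRHS]mulr1 ler_pM// ?normr_le_expR//.
  exact: normr_sin_le1.
apply: (@is_derive_quadratic_bound _ _ _ _ (E (fun x => Z x ^+ 2))) => h _.
have Ic := int_cos_normal.
rewrite mulrN opprK -(E_onZ measurableT)// -(E_onB measurableT)//.
rewrite -(E_onD measurableT)//; [|exact: int_onB|exact: int_onZ].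
rewrite mulrC -(E_onZ measurableT)//; apply: (normr_E_on_le measurableT).
- by apply: int_onD => //; [exact: int_onB|exact: int_onZ].
- exact: int_onZ.
- move=> x _; rewrite mulrDl -exprMn mulrA; exact: cos_taylor1.
Qed.

Lemma is_derive_sin_normal (t : R) :
  is_derive t 1 (fun t => E (fun x => sin (t * Z x))) (E (fun x => Z x * cos (t * Z x))).
Proof.
have IZ2 := int_is_normal_sqr.
have IZs : I (fun x => Z x * cos (t * Z x)).
  apply: (@int_is_normal (fun x => x * cos (t * x)) 1 1) => [|x].
    apply: measurable_funM => //; apply: continuous_measurable_fun.
    exact/contM/continuous_cos.
  rewrite !mul1r normrM -[leRHS]mulr1 ler_pM// ?normr_le_expR//.
  exact: normr_cos_le1.
apply: (@is_derive_quadratic_bound _ _ _ _ (E (fun x => Z x ^+ 2))) => h _.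
have Ic := int_sin_normal.
rewrite -(E_onZ measurableT)// -(E_onB measurableT)//.
rewrite -(E_onB measurableT)//; [|exact: int_onB|exact: int_onZ].
rewrite mulrC -(E_onZ measurableT)//; apply: (normr_E_on_le measurableT).
- by apply: int_onB => //; [exact: int_onB|exact: int_onZ].
- exact: int_onZ.
- move=> x _; rewrite mulrDl -exprMn mulrA; exact: sin_taylor1.
Qed.

(** Both parts solve [y' = - t v y] with [v] the variance. Multiplied by the integrating factor
    [expR (t ^+ 2 * v / 2)] they are constant, hence equal to their values 1 and 0 at the origin. *)
Lemma normal_characteristic (t : R) :
  E (fun x => cos (t * Z x)) = expR (- (t ^+ 2 * E (fun x => Z x ^+ 2) / 2)) /\
  E (fun x => sin (t * Z x)) = 0.
Proof.
have [v -> S] := normal_stein_trig.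
pose e (u : R) := expR (u ^+ 2 * v / 2).
have de (u : R) : is_derive u (1 : R) e (u * v * e u).
  have D : is_derive u (1 : R) (fun u : R => u ^+ 2 * v / 2) (u * v).
    by apply: is_derive_eq; rewrite /GRing.scale/=; field.
  rewrite /e; apply: is_derive_eq; rewrite /GRing.scale/=; ring.
have cst (f df : R -> R) : (forall u : R, is_derive u 1 f (df u)) ->
    (forall u, df u = - (u * v * f u)) -> forall u, f u * e u = f 0.
  move=> fdf dfE u.
  have D (x : R) : is_derive x (1 : R) (f * e) 0.
    have Df := fdf x; apply: is_derive_eq; rewrite dfE /GRing.scale/=; ring.
  have := is_derive_0_is_cst u 0 D.
  by rewrite /= !fctE /e expr0n/= !mul0r expR0 mulr1.
have e0 u : e u != 0 by rewrite gt_eqF// expR_gt0.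
split.
  have := cst _ _ is_derive_cos_normal (fun u => congr1 -%R (S u).1) t.
  under [X in _ = X -> _]eq_E_on do rewrite mul0r cos0.
  rewrite [X in _ = X -> _](E_on_cst measurableT PT) expRN -/(e t) => H.
  by apply: (mulIf (e0 t)); rewrite mulVf.
have := cst _ _ is_derive_sin_normal (fun u => (S u).2) t.
under [X in _ = X -> _]eq_E_on do rewrite mul0r sin0.
rewrite [X in _ = X -> _](E_on_cst measurableT PT) => /eqP.
by rewrite mulf_eq0 (negbTE (e0 t)) orbF => /eqP.
Qed.

End normal_characteristic.

(** * Euclidean inner product and norm *)

Section euclidean.
Variables (R : realType) (k : nat).
Implicit Types (x y z : 'cV[R]_k) (c : R).

Lemma dotpE x y : dotp x y = (x^T *m y) 0 0.
Proof. by rewrite mxE; apply: eq_bigr => i _; rewrite mxE. Qed.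

Lemma dotpC x y : dotp x y = dotp y x.
Proof. by apply: eq_bigr => i _; rewrite mulrC. Qed.

Lemma dotpDl x y z : dotp (x + y) z = dotp x z + dotp y z.
Proof. by rewrite !dotpE linearD mulmxDl mxE. Qed.

Lemma dotpZl c x y : dotp (c *: x) y = c * dotp x y.
Proof. by rewrite !dotpE linearZ -scalemxAl mxE. Qed.

Lemma dotpDr x y z : dotp z (x + y) = dotp z x + dotp z y.
Proof. by rewrite dotpC dotpDl !(dotpC z). Qed.

Lemma dotpZr c x y : dotp x (c *: y) = c * dotp x y.
Proof. by rewrite dotpC dotpZl dotpC. Qed.

Lemma dotp0l x : dotp 0 x = 0.
Proof. by rewrite -(scale0r 0) dotpZl mul0r. Qed.

Lemma dotp0r x : dotp x 0 = 0.
Proof. by rewrite dotpC dotp0l. Qed.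

Lemma dotpNl x y : dotp (- x) y = - dotp x y.
Proof. by rewrite -scaleN1r dotpZl mulN1r. Qed.

Lemma dotpNr x y : dotp x (- y) = - dotp x y.
Proof. by rewrite dotpC dotpNl dotpC. Qed.

Lemma dotp_ge0 x : 0 <= dotp x x.
Proof. by apply: sumr_ge0 => i _; rewrite -expr2 sqr_ge0. Qed.

Lemma dotp_eq0 x : dotp x x = 0 -> x = 0.
Proof.
move=> /eqP; rewrite psumr_eq0 => [/allP x0|i _]; last by rewrite -expr2 sqr_ge0.
apply/colP => i; have := x0 i; rewrite mem_index_enum -expr2 sqrf_eq0 mxE.
by move=> /(_ isT)/eqP.
Qed.

Lemma dotp_delta x i : dotp (delta_mx i 0) x = x i 0.
Proof. by rewrite dotpE trmx_delta -rowE mxE. Qed.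

Lemma enorm_ge0 x : 0 <= enorm x.
Proof. exact: sqrtr_ge0. Qed.

Lemma sqr_enorm x : enorm x ^+ 2 = dotp x x.
Proof. by rewrite sqr_sqrtr// dotp_ge0. Qed.

Lemma enormZ c x : enorm (c *: x) = `|c| * enorm x.
Proof. by rewrite /enorm dotpZl dotpZr mulrA -expr2 sqrtrM ?sqr_ge0// sqrtr_sqr. Qed.

Lemma enorm0 : enorm (0 : 'cV[R]_k) = 0.
Proof. by rewrite /enorm dotp0l sqrtr0. Qed.

Lemma enormN x : enorm (- x) = enorm x.
Proof. by rewrite -scaleN1r enormZ normrN1 mul1r. Qed.

Lemma enorm_eq0 x : enorm x = 0 -> x = 0.
Proof. by move=> x0; apply: dotp_eq0; rewrite -sqr_enorm x0 expr0n. Qed.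

Lemma enorm_gt0 x : x != 0 -> 0 < enorm x.
Proof.
by move=> x0; rewrite lt_neqAle enorm_ge0 andbT eq_sym; apply: contra_neq x0 => /enorm_eq0.
Qed.

Lemma cauchy_schwarz x y : `|dotp x y| <= enorm x * enorm y.
Proof.
have [->|y0] := eqVneq y 0; first by rewrite dotp0r normr0 mulr_ge0 ?enorm_ge0.
have yy : 0 < dotp y y by rewrite -sqr_enorm exprn_gt0// enorm_gt0.
have := dotp_ge0 (dotp y y *: x - dotp x y *: y).
rewrite dotpDl !dotpDr !dotpNl !dotpNr !dotpZl !dotpZr (dotpC y x) => H.
rewrite -(@ler_pXn2r _ 2) ?nnegrE ?mulr_ge0 ?enorm_ge0//.
rewrite exprMn !sqr_enorm real_normK ?num_real//.
rewrite -(ler_pM2l yy) -subr_ge0; apply: le_trans H _.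
by rewrite le_eqVlt; apply/orP; left; apply/eqP; ring.
Qed.

Lemma coord_le_enorm x i : `|x i 0| <= enorm x.
Proof.
rewrite -sqrtr_sqr ler_wsqrtr// /dotp (bigD1 i)//= -expr2 lerDl.
by apply: sumr_ge0 => j _; rewrite -expr2 sqr_ge0.
Qed.

Lemma enorm_le_sum x : enorm x <= \sum_i `|x i 0|.
Proof.
rewrite -(@ler_pXn2r _ 2) ?nnegrE ?enorm_ge0 ?sumr_ge0// sqr_enorm.
rewrite expr2 mulr_suml; apply: ler_sum => i _.
rewrite -expr2 -real_normK ?num_real// expr2 ler_wpM2l// (bigD1 i)//= lerDl.
exact: sumr_ge0.
Qed.

End euclidean.

Lemma dotp_mulmxl (R : realType) (m n : nat) (A : 'M[R]_(m, n)) x y :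
  dotp (A *m x) y = dotp x (A^T *m y).
Proof. by rewrite !dotpE trmx_mul mulmxA. Qed.

Lemma dotp_mulmxr (R : realType) (m n : nat) (A : 'M[R]_(m, n)) x y :
  dotp x (A *m y) = dotp (A^T *m x) y.
Proof. by rewrite dotpC dotp_mulmxl dotpC. Qed.

(** * Trigonometric polynomials *)

Section trigonometric_polynomials.
Variables (R : realType) (k : nat).
Implicit Types (s : seq (R * 'cV[R]_k * R)) (x v : 'cV[R]_k).

(* [(c, w, b)] in [s] stands for the wave [c cos (<w, x> + b)]; [dtrig_poly s x v]
   is the derivative of [trig_poly s] at [x] in the direction [v]. *)
Definition trig_poly s x : R := \sum_(z <- s) z.1.1 * cos (dotp z.1.2 x + z.2).

Definition dtrig_poly s x v : R :=
  - \sum_(z <- s) z.1.1 * (sin (dotp z.1.2 x + z.2) * dotp z.1.2 v).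

End trigonometric_polynomials.

(** * Gaussian means of waves and integration by parts *)

Section standard_gaussian.
Context d (T : measurableType d) (R : realType) (P : probability T R) (k : nat).
Variable Z : T -> 'cV[R]_k.
Hypotheses (mZ : forall a, measurable_fun setT (fun t => dotp a (Z t)))
  (nZ : forall a, is_normal P (fun t => dotp a (Z t)))
  (EZ : forall a, E_on P setT (fun t => dotp a (Z t)) = 0)
  (VZ : forall a, E_on P setT (fun t => dotp a (Z t) ^+ 2) = dotp a a).
Let I f := int_on P setT f.
Let E f := E_on P setT f.
Let PT : P setT = 1%E. Proof. exact: probability_setT. Qed.

Lemma int_abs_gaussian a : I (fun t => `|dotp a (Z t)|).
Proof.
apply: (@int_is_normal _ _ _ _ _ (mZ a) (nZ a) (fun x => `|x|) 1 1) => [|x].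
  exact: measurableT_comp.
by rewrite !mul1r normr_id normr_le_expR.
Qed.

Lemma int_gaussian_bounded (f : T -> R) a : measurable_fun setT f ->
  (forall t, `|f t| <= 1) -> I (fun t => f t * dotp a (Z t)).
Proof.
move=> mf f1; apply: (@le_int_on _ _ _ P setT measurableT _ (fun t => `|dotp a (Z t)|)).
- exact: measurable_funM.
- by move=> t _; rewrite normrM ler_piMl.
- exact: int_abs_gaussian.
Qed.

Lemma int_trig_gaussian (g : R -> R) a b : continuous g -> (forall x, `|g x| <= 1) ->
  I (fun t => g (dotp a (Z t) + b)).
Proof.
move=> cg g1; apply: (@le_int_on _ _ _ P setT measurableT _ (fun=> 1)).
- apply: (measurableT_comp (f := g)); first exact: continuous_measurable_fun.
  exact: measurable_funD.
- by move=> t _; exact: g1.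
- exact: int_on_cst.
Qed.

Lemma gaussian_cos a b :
  E (fun t => cos (dotp a (Z t) + b)) = expR (- (dotp a a / 2)) * cos b.
Proof.
have [c s] := normal_characteristic (mZ a) (nZ a) (EZ a) 1.
rewrite VZ expr1n mul1r in c.
have Ic := int_cos_normal P (mZ a) 1; have Is := int_sin_normal P (mZ a) 1.
transitivity (E (fun t => cos b * cos (1 * dotp a (Z t)) - sin b * sin (1 * dotp a (Z t)))).
  by apply: eq_E_on => t _; rewrite cosD mul1r; ring.
rewrite /E (E_onB measurableT); [|exact: int_onZ|exact: int_onZ].
by rewrite !(E_onZ measurableT)// s c mulr0 subr0 mulrC.
Qed.

(** The mean of [cos (dotp (a + u *: e) (Z t) + b)] is differentiated at [u = 0] in two ways: under
    the expectation, and in the closed formula [gaussian_cos]. *)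
Lemma gaussian_ibp a e b :
  E (fun t => sin (dotp a (Z t) + b) * dotp e (Z t)) =
  expR (- (dotp a a / 2)) * cos b * dotp a e.
Proof.
pose J (u : R) := E (fun t => cos (dotp (a + u *: e) (Z t) + b)).
have D1 : is_derive (0 : R) (1 : R) J (- E (fun t => sin (dotp a (Z t) + b) * dotp e (Z t))).
  apply: (@is_derive_quadratic_bound _ _ _ _ (E (fun t => dotp e (Z t) ^+ 2))) => h _.
  have Ic u : I (fun t => cos (dotp (a + u *: e) (Z t) + b)).
    by apply: int_trig_gaussian; [exact: continuous_cos|exact: normr_cos_le1].
  have Is : I (fun t => sin (dotp a (Z t) + b) * dotp e (Z t)).
    apply: int_gaussian_bounded => [|t]; last exact: normr_sin_le1.
    apply: measurableT_comp; last exact: measurable_funD.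
    by apply: continuous_measurable_fun; exact: continuous_sin.
  have I2 : I (fun t => dotp e (Z t) ^+ 2) by exact: int_is_normal_sqr (mZ e) (nZ e).
  rewrite mulrN opprK -(E_onZ measurableT)// /J -(E_onB measurableT)//.
  rewrite -(E_onD measurableT)//; [|exact: int_onB|exact: int_onZ].
  rewrite mulrC -(E_onZ measurableT)//; apply: (normr_E_on_le measurableT).
  - by apply: int_onD => //; [exact: int_onB|exact: int_onZ].
  - exact: int_onZ.
  - move=> t _; rewrite add0r scale0r addr0 dotpDl dotpZl.
    rewrite -exprMn (_ : _ + b = dotp a (Z t) + b + h * dotp e (Z t)); last by ring.
    rewrite (_ : h * (_ * _) = h * dotp e (Z t) * sin (dotp a (Z t) + b)); last by ring.
    exact: cos_taylor1.
pose q (u : R) := - ((dotp a a + 2 * u * dotp a e + u ^+ 2 * dotp e e) / 2).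
have JE : J = (fun u => expR (q u) * cos b).
  apply/funext => u; rewrite /J gaussian_cos; congr (expR (- (_ / 2)) * _).
  rewrite dotpDl !dotpDr !dotpZl !dotpZr (dotpC e a); ring.
have D2 : is_derive (0 : R) (1 : R) J (- (expR (- (dotp a a / 2)) * cos b * dotp a e)).
  rewrite JE /q.
  apply: is_derive_eq; rewrite /GRing.scale/=.
  by rewrite !mulr0 mul0r expr0n/= mul0r !addr0; field.
by have := @derive_val _ _ _ _ _ _ _ D1; rewrite (@derive_val _ _ _ _ _ _ _ D2) => /oppr_inj.
Qed.

(* The sum is [c] times the Frobenius pairing of [H] with minus the Hessian of
   [x |-> E f(x + c Z)], [f = trig_poly s]. One Gaussian integration by parts
   trades the second derivative for a gradient, so only the Lipschitz constant
   [l] of [f] enters; [mu] is the AM-GM parameter. *)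
Lemma gaussian_gradient_bound s (l mu : R) (H : 'M[R]_k) (c : R) x :
  0 <= l -> 0 < mu -> (forall y v, `|dtrig_poly s y v| <= l * enorm v) ->
  `|\sum_(z <- s) z.1.1 * (expR (- (c ^+ 2 * dotp z.1.2 z.1.2 / 2)) * c *
      cos (dotp z.1.2 x + z.2) * dotp z.1.2 (H *m z.1.2))| <=
  l * ((mu + (\sum_i \sum_j H i j ^+ 2) / mu) / 2).
Proof.
move=> l0 mu0 sl.
have Is a e b : I (fun t => sin (dotp a (Z t) + b) * dotp e (Z t)).
  apply: int_gaussian_bounded => [|t]; last exact: normr_sin_le1.
  apply: measurableT_comp; last exact: measurable_funD.
  by apply: continuous_measurable_fun; exact: continuous_sin.
(* [gaussian_ibp] is read backwards, with [a = c *: z.1.2] and [e = H^T *m z.1.2]: one factor of the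
   frequency vector becomes the Gaussian vector. *)
pose F (z : R * 'cV[R]_k * R) t := z.1.1 *
  (sin (dotp (c *: z.1.2) (Z t) + (dotp z.1.2 x + z.2)) * dotp (H^T *m z.1.2) (Z t)).
have IF z : I (F z) by apply: int_onZ.
have -> : \sum_(z <- s) z.1.1 * (expR (- (c ^+ 2 * dotp z.1.2 z.1.2 / 2)) * c *
      cos (dotp z.1.2 x + z.2) * dotp z.1.2 (H *m z.1.2)) = E (fun t => \sum_(z <- s) F z t).
  rewrite /E (E_on_sum measurableT PT)//; apply: eq_bigr => z _.
  rewrite (E_onZ measurableT)// [E_on _ _ _]gaussian_ibp !dotpZl dotpZr.
  rewrite (_ : c * (c * _) = c ^+ 2 * dotp z.1.2 z.1.2); last by ring.
  rewrite (dotp_mulmxr H) [dotp (H^T *m _) _]dotpC; congr (_ * _); ring.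
pose r i : 'cV[R]_k := (row i H)^T.
have HZ t i : (H *m Z t) i 0 = dotp (r i) (Z t).
  by rewrite dotpE trmxK -row_mul !mxE.
have I2 i : I (fun t => dotp (r i) (Z t) ^+ 2).
  exact: int_is_normal_sqr (mZ _) (nZ _).
have IS : I (fun t => \sum_i dotp (r i) (Z t) ^+ 2) by exact: int_on_sum.
pose G t := l * ((mu + mu^-1 * \sum_i dotp (r i) (Z t) ^+ 2) * 2^-1).
have IG : I (fun t => mu + mu^-1 * \sum_i dotp (r i) (Z t) ^+ 2).
  by apply: int_onD => //; [exact: int_on_cst|exact: int_onZ].
have IG2 : I (fun t => 2^-1 * (mu + mu^-1 * \sum_i dotp (r i) (Z t) ^+ 2)).
  exact: int_onZ.
have -> : l * ((mu + (\sum_i \sum_j H i j ^+ 2) / mu) / 2) =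
    E (fun t => l * (2^-1 * (mu + mu^-1 * \sum_i dotp (r i) (Z t) ^+ 2))).
  rewrite /E !(E_onZ measurableT)// (E_onD measurableT); [|exact: int_on_cst|exact: int_onZ].
  rewrite (E_on_cst measurableT PT) (E_onZ measurableT)// (E_on_sum measurableT PT)//.
  congr (_ * _); rewrite mulrC; congr (_ * (_ + _)); rewrite mulrC; congr (_ * _).
  apply: eq_bigr => i _; rewrite VZ; apply: eq_bigr => j _.
  by rewrite !mxE expr2.
apply: (normr_E_on_le measurableT).
- exact: int_on_sum.
- exact: int_onZ.
move=> t _.
(* Summed over the waves, the integrand is a single directional derivative of [f], along [H *m Z t];
   only here does the Lipschitz bound apply. *)
have -> : \sum_(z <- s) F z t = - dtrig_poly s (c *: Z t + x) (H *m Z t).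
  rewrite opprK; apply: eq_bigr => z _; rewrite /F; congr (_ * (sin _ * _)).
    by rewrite dotpDr dotpZr dotpZl addrA.
  by rewrite dotp_mulmxl trmxK.
rewrite normrN (le_trans (sl _ _))// ler_wpM2l//.
have -> : \sum_i dotp (r i) (Z t) ^+ 2 = enorm (H *m Z t) ^+ 2.
  by rewrite sqr_enorm; apply: eq_bigr => i _; rewrite HZ expr2.
(* AM-GM for [enorm (H *m Z t)]; the mean of its square is the squared Hilbert-Schmidt norm of
   [H]. *)
rewrite -(ler_pM2l mu0) -subr_ge0; set e := enorm _.
rewrite (_ : _ - _ = 2^-1 * (mu - e) ^+ 2); last by field; rewrite gt_eqF.
by rewrite mulr_ge0// sqr_ge0.
Qed.

End standard_gaussian.

(** * Continuity on matrix spaces *)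

Lemma lipschitz_continuous (R : realType) (V W : normedModType R) (f : V -> W) (K : R) :
  (forall x y, `|f x - f y| <= K * `|x - y|) -> continuous f.
Proof.
move=> fK x; apply/cvgrPdist_lt => e e0.
have K1 : 0 < `|K| + 1 by rewrite ltr_wpDl.
near=> y; rewrite (le_lt_trans (fK x y))//.
rewrite (@le_lt_trans _ _ ((`|K| + 1) * `|x - y|))//.
  by rewrite ler_wpM2r// (le_trans (ler_norm K))// lerDl.
rewrite mulrC -ltr_pdivlMr//; near: y.
by apply: cvgr_dist_lt => //; rewrite divr_gt0.
Unshelve. all: by end_near. Qed.

Lemma entry_le_norm (R : realType) (m n : nat) (A : 'M[R]_(m, n)) i j : `|A i j| <= `|A|.
Proof.
have -> : `|A| = mx_norm A by [].
by rewrite mx_normrE (@le_bigmax _ _ _ 0 (fun ij => `|A ij.1 ij.2|) (i, j)).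
Qed.

Lemma norm_le_entries (R : realType) (m n : nat) (A : 'M[R]_(m, n)) (K : R) :
  0 <= K -> (forall i j, `|A i j| <= K) -> `|A| <= K.
Proof.
have -> : `|A| = mx_norm A by [].
by move=> K0 AK; rewrite mx_normrE; apply/bigmax_leP; split => // -[i j] _ /=.
Qed.

Lemma continuous_mulmxl (R : realType) (m n p : nat) (A : 'M[R]_(m, n)) :
  continuous (fun B : 'M[R]_(n, p) => A *m B).
Proof.
apply: (@lipschitz_continuous _ _ _ _ (\sum_(j < n) `|A|)) => B C.
rewrite -mulmxBr; apply: norm_le_entries => [|i j].
  by rewrite mulr_ge0// sumr_ge0.
rewrite mxE (le_trans (ler_norm_sum _ _ _))// mulr_suml ler_sum// => l _.
by rewrite normrM ler_pM// entry_le_norm.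
Qed.

Lemma continuous_borel_measurable2 (S S' : ptopologicalType) (f : S -> S') :
  continuous f -> measurable_fun setT (f : borel S -> borel S').
Proof.
move=> cf; apply: (@measurability _ _ (borel S) (borel S') setT f (@open S')) => // _ [B oB <-].
rewrite setTI; apply: sub_sigma_algebra.
exact: open_comp.
Qed.

(** * Haar measure on the orthogonal group *)

Section haar.
Variables (R : realType) (n : nat) (mu : probability (borel 'M[R]_n) R).
Hypothesis hmu : is_haar_orthogonal mu.
Let D : set (borel 'M[R]_n) := @orthogonal_group R n.

Lemma orthogonal_trmx (Q : 'M[R]_n) : orthogonal_group Q -> orthogonal_group Q^T.
Proof. by rewrite /orthogonal_group/= trmxK => /mulmx1C. Qed.

Lemma orthogonal_mulmx (Q U : 'M[R]_n) :
  orthogonal_group Q -> orthogonal_group U -> orthogonal_group (Q *m U).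
Proof.
rewrite /orthogonal_group/= => QQ UU.
by rewrite trmx_mul mulmxA -(mulmxA Q) UU mulmx1.
Qed.

Lemma orthogonal_entry_le1 (Q : 'M[R]_n) i j : orthogonal_group Q -> `|Q i j| <= 1.
Proof.
move=> /matrixP/(_ i i); rewrite !mxE eqxx mulr1n (bigD1 j)//= mxE => H.
rewrite -(@ler_pXn2r _ 2) ?nnegrE// expr1n real_normK ?num_real// expr2 -[leRHS]H.
by rewrite lerDl sumr_ge0// => l _; rewrite mxE -expr2 sqr_ge0.
Qed.

Lemma measurable_entry i j : measurable_fun setT (fun M : borel 'M[R]_n => (M : 'M[R]_n) i j).
Proof. by apply: continuous_borel_measurable; exact: coord_continuous. Qed.

Lemma measurable_orthogonal : measurable D.
Proof.
have -> : D = \bigcap_(ij in [set: 'I_n * 'I_n])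
    ((fun M : borel 'M[R]_n => ((M : 'M[R]_n) *m M^T) ij.1 ij.2) @^-1`
      [set (1%:M : 'M[R]_n) ij.1 ij.2]).
  apply/seteqP; split => M /=.
    by move=> MM [i j] _ /=; rewrite MM.
  by move=> MM; apply/matrixP => i j; exact: (MM (i, j)).
apply: fin_bigcap_measurable => [|[i j] _] /=; first exact: finite_finset.
rewrite -[X in measurable X]setTI.
suff mf : measurable_fun setT (fun M : borel 'M[R]_n => ((M : 'M[R]_n) *m M^T) i j).
  by apply: mf => //; exact: measurable_set1.
have -> : (fun M : borel 'M[R]_n => ((M : 'M[R]_n) *m M^T) i j) =
    (fun M : borel 'M[R]_n => \sum_l (M : 'M[R]_n) i l * (M : 'M[R]_n) j l).
  by apply/funext => M; rewrite mxE; apply: eq_bigr => l _; rewrite mxE.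
apply: measurable_sum => l; apply: measurable_funM; exact: measurable_entry.
Qed.

Lemma haar_orthogonal1 : mu D = 1%E. Proof. by case: hmu. Qed.

(* Haar measure gives no control of [f] off the orthogonal group, so boundedness
   is only asked there. *)
Definition mbounded (f : 'M[R]_n -> R) :=
  measurable_fun setT (f : borel 'M[R]_n -> R) /\
  exists K, forall Q, orthogonal_group Q -> `|f Q| <= K.

Lemma mbounded_int f : mbounded f -> int_on mu D f.
Proof.
move=> [mf [K fK]]; apply: (le_int_on measurable_orthogonal mf fK).
by apply: int_on_cst; exact: measurable_orthogonal.
Qed.

Lemma mbounded_cst c : mbounded (fun=> c).
Proof. by split; [exact: measurable_cst|exists `|c|]. Qed.

Lemma mbounded_entry i j : mbounded (fun M => M i j).
Proof. by split; [exact: measurable_entry|exists 1 => Q; exact: orthogonal_entry_le1]. Qed.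

Lemma mboundedD f g : mbounded f -> mbounded g -> mbounded (fun M => f M + g M).
Proof.
move=> [mf [K fK]] [mg [L gL]]; split; first exact: measurable_funD.
by exists (K + L) => Q OQ; rewrite (le_trans (ler_normD _ _))// lerD ?fK ?gL.
Qed.

Lemma mboundedM f g : mbounded f -> mbounded g -> mbounded (fun M => f M * g M).
Proof.
move=> [mf [K fK]] [mg [L gL]]; split; first exact: measurable_funM.
by exists (K * L) => Q OQ; rewrite normrM ler_pM ?fK ?gL.
Qed.

Lemma mboundedN f : mbounded f -> mbounded (fun M => - f M).
Proof.
move=> [mf [K fK]]; split; first exact: measurableT_comp.
by exists K => Q OQ; rewrite normrN fK.
Qed.

Lemma mboundedB f g : mbounded f -> mbounded g -> mbounded (fun M => f M - g M).
Proof. by move=> gf /mboundedN gg; exact: mboundedD. Qed.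

Lemma mbounded_sum (I : Type) (r : seq I) (p : pred I) (f : I -> 'M[R]_n -> R) :
  (forall i, mbounded (f i)) -> mbounded (fun M => \sum_(i <- r | p i) f i M).
Proof.
move=> gf; elim: r => [|a r ih].
  by under eq_fun do rewrite big_nil; exact: mbounded_cst.
under eq_fun do rewrite big_cons; case: (p a) => //.
exact: mboundedD.
Qed.

Lemma mbounded_comp (g : R -> R) f K : continuous g -> (forall x, `|g x| <= K) ->
  mbounded f -> mbounded (fun M => g (f M)).
Proof.
move=> cg gK [mf _]; split; last by exists K => Q _; exact: gK.
by apply: (measurableT_comp (f := g)) => //; exact: continuous_measurable_fun.
Qed.

Lemma mbounded_cos f : mbounded f -> mbounded (fun M => cos (f M)).
Proof. by apply: mbounded_comp; [exact: continuous_cos|exact: normr_cos_le1]. Qed.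

Lemma mbounded_sin f : mbounded f -> mbounded (fun M => sin (f M)).
Proof. by apply: mbounded_comp; [exact: continuous_sin|exact: normr_sin_le1]. Qed.

Lemma mboundedX f (k : nat) : mbounded f -> mbounded (fun M => f M ^+ k).
Proof.
move=> gf; elim: k => [|k ih]; first by under eq_fun do rewrite expr0; exact: mbounded_cst.
by under eq_fun do rewrite exprS; exact: mboundedM.
Qed.

Lemma mbounded_mulmxr (m : nat) (B : 'M[R]_(n, m)) i j : mbounded (fun M => (M *m B) i j).
Proof.
under eq_fun do rewrite mxE; apply: mbounded_sum => l.
by apply: mboundedM; [exact: mbounded_entry|exact: mbounded_cst].
Qed.

Let E (f : 'M[R]_n -> R) := E_on mu D f.

(** The preimage of a set under multiplication by [Q] is its image under [Q^T], so the hypothesis on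
    images says that this multiplication preserves the law. The change of variables is then made for
    a nonnegative function. *)
Lemma haar_invariance (Q : 'M[R]_n) f : orthogonal_group Q -> mbounded f ->
  E (fun M => f (Q *m M)) = E f.
Proof.
move=> OQ gf; have [mf [K fK]] := gf.
have mQ : measurable_fun setT (fun M : borel 'M[R]_n => (Q *m (M : 'M[R]_n) : borel 'M[R]_n)).
  by apply: continuous_borel_measurable2; exact: continuous_mulmxl.
have gfQ : mbounded (fun M => f (Q *m M)).
  split; first exact: (measurableT_comp mf mQ).
  by exists K => U OU; apply: fK; exact: orthogonal_mulmx.
(* Adding the bound [K] makes [f] nonnegative on the group, and cutting off outside is harmless
   because multiplication by [Q] maps the group and its complement to themselves. *)
pose g (M : borel 'M[R]_n) : \bar R := ((fun M => (f M + K)%:E) \_ D) M.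
have mg : measurable_fun setT g.
  apply/measurable_restrict => //; first exact: measurable_orthogonal.
  rewrite setTI; apply/measurable_EFinP; apply: measurable_funD => //.
  exact: measurable_funS mf.
have g0 M : (0 <= g M)%E.
  rewrite /g patchE; case: ifPn => //; rewrite inE => /fK; rewrite ler_norml => /andP[H _].
  by rewrite lee_fin addrC -lerBlDl sub0r.
have lawQ A : measurable A -> mu ((fun M : borel 'M[R]_n => (Q *m (M : 'M[R]_n) : borel 'M[R]_n)) @^-1` A) = mu A.
  move=> mA; rewrite -(hmu.2 Q^T A (orthogonal_trmx OQ) mA); congr (mu _).
  have QQ : Q^T *m Q = 1%:M by exact: mulmx1C.
  apply/seteqP; split => M /=.
    by move=> AM; exists (Q *m M) => //; rewrite mulmxA QQ mul1mx.
  by move=> [U AU <-]; rewrite mulmxA (OQ : _ = _) mul1mx.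
have H := ge0_integral_law mQ lawQ mg g0.
have Ig h : mbounded h -> (\int[mu]_(M in D) (h M + K)%:E = (E h + K)%:E)%E.
  move=> gh; have Ih := mbounded_int gh.
  have mD := measurable_orthogonal.
  have IhK : int_on mu D (fun M => h M + K) by apply: int_onD => //; exact: int_on_cst.
  rewrite (E_onE mD IhK) (E_onD mD Ih); last exact: int_on_cst.
  by rewrite (E_on_cst mD haar_orthogonal1).
have : (\int[mu]_(M in D) (f (Q *m M) + K)%:E = \int[mu]_(M in D) (f M + K)%:E)%E.
  rewrite [RHS]integral_mkcond [LHS]integral_mkcond -[RHS]H.
  apply: eq_integral => M _; rewrite /g !patchE.
  have -> // : (M \in D) = ((Q *m M : borel 'M[R]_n) \in D).
  apply/idP/idP; rewrite !inE; first exact: orthogonal_mulmx.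
  move=> /(orthogonal_mulmx (orthogonal_trmx OQ)).
  by rewrite mulmxA (mulmx1C OQ) mul1mx.
rewrite (Ig _ gf) (Ig _ gfQ) => -[] /eqP.
by rewrite -subr_eq addrK => /eqP.
Qed.

End haar.

(** * Plane rotations and uniform first-order expansions *)

Section rotations.
Variables (R : realType) (n : nat).
Implicit Types (p q : 'I_n) (c s : R).

(** The parameters [c] and [s] stay free because two kinds of rotation are needed: small angles for
    Stein's identity, and [c = s = 1 / sqrt 2] for the fourth moments. *)
Definition rotation p q c s : 'M[R]_n :=
  1%:M + (c - 1) *: (delta_mx p p + delta_mx q q)
       + s *: (delta_mx p q - delta_mx q p).

Lemma delta_mulE m p q (N : 'M[R]_(n, m)) i j : (delta_mx p q *m N) i j = (i == p)%:R * N q j.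
Proof.
rewrite mxE (bigD1 q)//= mxE eqxx andbT big1 ?addr0// => l lq.
by rewrite mxE (negbTE lq) andbF mul0r.
Qed.

Lemma rotation_mulE m p q c s (N : 'M[R]_(n, m)) i j : (rotation p q c s *m N) i j =
  N i j + (c - 1) * ((i == p)%:R * N p j + (i == q)%:R * N q j)
        + s * ((i == p)%:R * N q j - (i == q)%:R * N p j).
Proof.
rewrite !mulmxDl mul1mx -!scalemxAl !mulmxDl mulNmx.
move: (delta_mulE p p N i j) (delta_mulE q q N i j) (delta_mulE p q N i j)
  (delta_mulE q p N i j).
move: (delta_mx p p *m N) (delta_mx q q *m N) (delta_mx p q *m N) (delta_mx q p *m N).
by move=> a b a' b' <- <- <- <-; rewrite !mxE.
Qed.

Lemma rotation_orthogonal p q c s : p != q -> c ^+ 2 + s ^+ 2 = 1 ->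
  orthogonal_group (rotation p q c s).
Proof.
move=> pq cs; have qp : q != p by rewrite eq_sym.
apply/matrixP => i j; rewrite rotation_mulE !mxE !eqxx (negbTE pq) (negbTE qp) !andbF.
have cs' : s ^+ 2 = 1 - c ^+ 2 by rewrite -cs; ring.
have [ip|ip] := eqVneq i p.
  rewrite ip (negbTE pq).
  have [->|jp] := eqVneq j p; first by rewrite (negbTE pq) /=; ring: cs'.
  by have [_|_] := eqVneq j q; rewrite /=; ring.
have [iq|iq] := eqVneq i q.
  rewrite iq.
  have [->|jp] := eqVneq j p; first by rewrite (negbTE pq) (negbTE qp) /=; ring: cs'.
  by have [_|_] := eqVneq j q; rewrite /=; ring: cs'.
by rewrite !andbF [j == i]eq_sym /=; ring.
Qed.

Lemma tr_rotation p q c s (N : 'M[R]_n) : \tr (rotation p q c s *m N) =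
  \tr N + (c - 1) * (N p p + N q q) + s * (N q p - N p q).
Proof.
rewrite /mxtrace; under eq_bigr do rewrite rotation_mulE.
have D r (x : 'I_n -> R) : \sum_i (i == r)%:R * x i = x r.
  by rewrite (bigD1 r)//= eqxx mul1r big1 ?addr0// => i /negbTE ->; rewrite mul0r.
rewrite !big_split/= -!mulr_sumr big_split/= !D; congr (_ + _ * _).
by rewrite sumrB !D.
Qed.

End rotations.

Section uniform_taylor.
Variables (R : realType) (U : Type) (D : set U).

(** A first-order expansion at [h = 0], uniform in [M], so that it can be integrated. The bounds on
    [f0] and [f1] are part of it because the rules for products and compositions consume them; with
    these rules, derivatives along rotations are assembled from elementary pieces. *)
Definition taylor1 (f : R -> U -> R) (f0 f1 : U -> R) := exists K, forall M, D M ->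
  [/\ `|f0 M| <= K, `|f1 M| <= K &
   forall h, `|h| <= 1 -> `|f h M - f0 M - h * f1 M| <= K * h ^+ 2].

Lemma taylor1_cst (a : U -> R) : (exists K, forall M, D M -> `|a M| <= K) ->
  taylor1 (fun=> a) a (fun=> 0).
Proof.
move=> [K aK]; exists K => M /aK H; have K0 : 0 <= K by exact: le_trans H.
split => //; first by rewrite normr0.
by move=> h _; rewrite subrr mulr0 subrr normr0 mulr_ge0// sqr_ge0.
Qed.

Lemma taylor1_id : taylor1 (fun h _ => h) (fun=> 0) (fun=> 1).
Proof.
exists 1 => M _; split; rewrite ?normr0 ?normr1// => h _.
by rewrite subr0 mulr1 subrr normr0 mul1r sqr_ge0.
Qed.

Lemma taylor1_sinh : taylor1 (fun h _ => sin h) (fun=> 0) (fun=> 1).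
Proof.
exists 1 => M _; split; rewrite ?normr0 ?normr1// => h _.
by have := sin_taylor1 0 h; rewrite add0r sin0 cos0 mul1r.
Qed.

Lemma taylor1_cosh : taylor1 (fun h _ => cos h) (fun=> 1) (fun=> 0).
Proof.
exists 1 => M _; split; rewrite ?normr0 ?normr1// => h _.
by have := cos_taylor1 0 h; rewrite add0r sin0 cos0 mul1r mulr0 addr0 subr0.
Qed.

Lemma taylor1D f f0 f1 g g0 g1 : taylor1 f f0 f1 -> taylor1 g g0 g1 ->
  taylor1 (fun h M => f h M + g h M) (fun M => f0 M + g0 M) (fun M => f1 M + g1 M).
Proof.
move=> [K HK] [L HL]; exists (K + L) => M DM.
have [a b c] := HK M DM; have [a' b' c'] := HL M DM; split.
- by rewrite (le_trans (ler_normD _ _))// lerD.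
- by rewrite (le_trans (ler_normD _ _))// lerD.
- move=> h h1; rewrite (_ : _ - _ = (f h M - f0 M - h * f1 M) + (g h M - g0 M - h * g1 M)); last by ring.
  by rewrite (le_trans (ler_normD _ _))// mulrDl lerD ?c ?c'.
Qed.

Lemma taylor1M f f0 f1 g g0 g1 : taylor1 f f0 f1 -> taylor1 g g0 g1 ->
  taylor1 (fun h M => f h M * g h M) (fun M => f0 M * g0 M)
    (fun M => f1 M * g0 M + f0 M * g1 M).
Proof.
(* 6 = 1 + 3 + 2: the cross term [h ^+ 2 * (f1 * g1)], the remainder of [f] times [g] (at most
   [3 * L]), and [f0 + h * f1] (at most [2 * K]) times the remainder of [g]. *)
move=> [K HK] [L HL]; exists (6 * K * L) => M DM.
have [a b c] := HK M DM; have [a' b' c'] := HL M DM.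
have K0 : 0 <= K by exact: le_trans a. have L0 : 0 <= L by exact: le_trans a'.
have KL : 0 <= K * L by rewrite mulr_ge0.
split.
- rewrite normrM (le_trans (ler_pM _ _ a a'))// -mulrA ler_peMl//.
  by rewrite ler1n.
- rewrite (le_trans (ler_normD _ _))// !normrM.
  have := ler_pM (normr_ge0 _) (normr_ge0 _) b a'.
  have := ler_pM (normr_ge0 _) (normr_ge0 _) a b'.
  by rewrite -mulrA; lra.
move=> h h1; move: (c h h1) (c' h h1).
set r := _ - _ - _ => Hr; set r' := _ - _ - _ => Hr'.
have h2 : h ^+ 2 <= `|h|.
  by rewrite -real_normK ?num_real// expr2 ler_piMl.
have hh : `|h| ^+ 2 = h ^+ 2 by rewrite real_normK ?num_real.
have gb : `|g h M| <= 3 * L.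
  have -> : g h M = r' + g0 M + h * g1 M by rewrite /r'; ring.
  rewrite (le_trans (ler_normD _ _))//.
  have -> : 3 * L = (L + L) + L by ring.
  apply: lerD; last by rewrite normrM -[leRHS]mul1r ler_pM.
  rewrite (le_trans (ler_normD _ _))// lerD// (le_trans Hr')// ler_piMr//.
  exact: le_trans h1.
have -> : f h M * g h M - f0 M * g0 M - h * (f1 M * g0 M + f0 M * g1 M) =
  h ^+ 2 * (f1 M * g1 M) + r * g h M + (f0 M + h * f1 M) * r'.
  by rewrite /r /r'; ring.
have -> : 6 * K * L * h ^+ 2 = h ^+ 2 * (K * L) + (K * h ^+ 2) * (3 * L) + (2 * K) * (L * h ^+ 2).
  by ring.
rewrite (le_trans (ler_normD _ _))// lerD//; last first.
  rewrite normrM ler_pM// (le_trans (ler_normD _ _))// (_ : 2 * K = K + K); last by ring.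
  by rewrite lerD// normrM -[leRHS]mul1r ler_pM.
rewrite (le_trans (ler_normD _ _))// lerD//; last by rewrite normrM ler_pM.
by rewrite normrM ger0_norm ?sqr_ge0// ler_wpM2l ?sqr_ge0// normrM ler_pM.
Qed.

Lemma taylor1_comp (F F' : R -> R) f f0 f1 :
  (forall x, `|F x| <= 1) -> (forall x, `|F' x| <= 1) ->
  (forall x u, `|F (x + u) - F x - u * F' x| <= u ^+ 2) ->
  taylor1 f f0 f1 ->
  taylor1 (fun h M => F (f h M)) (fun M => F (f0 M)) (fun M => f1 M * F' (f0 M)).
Proof.
(* The increment of [f] is at most [2 * K * |h|], whence [4 * K ^+ 2]; its own remainder costs [K];
   the 1 covers the bound on [F] itself. *)
move=> F1 F'1 FT [K HK]; exists (4 * K ^+ 2 + K + 1) => M DM.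
have [a b c] := HK M DM; have K0 : 0 <= K by exact: le_trans a.
have K2 := sqr_ge0 K; split.
- by rewrite (le_trans (F1 _))// lerDr addr_ge0// mulr_ge0.
- rewrite normrM (@le_trans _ _ (K * 1))//; first by rewrite ler_pM.
  by rewrite mulr1; lra.
move=> h h1; move: (c h h1); set r := _ - _ - _ => Hr.
have h2 : h ^+ 2 <= `|h|.
  by rewrite -real_normK ?num_real// expr2 ler_piMl.
set u := h * f1 M + r.
have fE : f h M = f0 M + u by rewrite /u /r; ring.
have Hu : `|u| <= 2 * K * `|h|.
  rewrite (le_trans (ler_normD _ _))// (_ : 2 * K * `|h| = K * `|h| + K * `|h|); last by ring.
  rewrite lerD//; first by rewrite normrM mulrC ler_wpM2r.
  by rewrite (le_trans Hr)// ler_wpM2l.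
rewrite fE (_ : _ - _ = (F (f0 M + u) - F (f0 M) - u * F' (f0 M)) + r * F' (f0 M)); last first.
  by rewrite /u; ring.
rewrite (le_trans (ler_normD _ _))//.
have -> : (4 * K ^+ 2 + K + 1) * h ^+ 2 = (2 * K * `|h|) ^+ 2 + (K * h ^+ 2 + h ^+ 2).
  by rewrite -[h ^+ 2]real_normK ?num_real//; ring.
apply: lerD.
  rewrite (le_trans (FT _ _))// -real_normK ?num_real//.
  by rewrite lerXn2r// nnegrE// !mulr_ge0.
rewrite normrM -[leLHS]addr0 lerD ?sqr_ge0//.
by rewrite (le_trans _ Hr)// ler_piMr.
Qed.

Lemma taylor1_sin f f0 f1 : taylor1 f f0 f1 ->
  taylor1 (fun h M => sin (f h M)) (fun M => sin (f0 M)) (fun M => f1 M * cos (f0 M)).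
Proof.
apply: taylor1_comp => [x|x|x u]; [exact: normr_sin_le1|exact: normr_cos_le1|].
exact: sin_taylor1.
Qed.

Lemma taylor1_cos f f0 f1 : taylor1 f f0 f1 ->
  taylor1 (fun h M => cos (f h M)) (fun M => cos (f0 M)) (fun M => f1 M * - sin (f0 M)).
Proof.
apply: (taylor1_comp (F := cos) (F' := fun x => - sin x)) => [x|x|x u]; [exact: normr_cos_le1|by rewrite normrN normr_sin_le1|].
by rewrite mulrN opprK; exact: cos_taylor1.
Qed.

End uniform_taylor.

(** * Stein's identity for Haar measure *)

Section haar_stein.
Variables (R : realType) (n : nat) (mu : probability (borel 'M[R]_n) R).
Hypothesis hmu : is_haar_orthogonal mu.
Let D : set (borel 'M[R]_n) := @orthogonal_group R n.
Let E (f : 'M[R]_n -> R) := E_on mu D f.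
Let mD : measurable D := @measurable_orthogonal R n.
Let muD : mu D = 1%E := haar_orthogonal1 hmu.

Lemma taylor1_derive (f : R -> 'M[R]_n -> R) (s : R) f1 :
  (forall x, mbounded (f x)) -> mbounded f1 ->
  taylor1 D (fun h => f (s + h)) (f s) f1 ->
  is_derive s 1 (fun x => E (f x)) (E f1).
Proof.
move=> gf gf1 [K HK]; apply: (@is_derive_quadratic_bound _ _ _ _ K) => h h1.
have If x := mbounded_int mu (gf x); have If1 := mbounded_int mu gf1.
rewrite /E -(E_onB mD)// -(E_onZ mD)// -(E_onB mD)//; last 2 first.
- exact: int_onB.
- exact: int_onZ.
rewrite -[leRHS](E_on_cst mD muD); apply: (normr_E_on_le mD).
- by apply: int_onB => //; [exact: int_onB|exact: int_onZ].
- exact: int_on_cst.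
- by move=> M DM; have [_ _] := HK M DM; apply.
Qed.

(** Infinitesimal form of an invariance: [h * E f1] is minus the mean remainder of the expansion,
    hence of order [h ^+ 2]. *)
Lemma taylor1_invariant (f : R -> 'M[R]_n -> R) f0 f1 :
  (forall x, mbounded (f x)) -> mbounded f0 -> mbounded f1 ->
  taylor1 D f f0 f1 -> (forall h, E (f h) = E f0) -> E f1 = 0.
Proof.
move=> gf gf0 gf1 [K HK] fE; apply: (@eq0_quadratic_bound _ _ K) => h h1.
have If x := mbounded_int mu (gf x); have If0 := mbounded_int mu gf0.
have If1 := mbounded_int mu gf1.
have -> : h * E f1 = - (E (f h) - E f0 - h * E f1) by rewrite fE; ring.
rewrite normrN /E -(E_onB mD)// -(E_onZ mD)// -(E_onB mD)//; last 2 first.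
- exact: int_onB.
- exact: int_onZ.
rewrite -[leRHS](E_on_cst mD muD); apply: (normr_E_on_le mD).
- by apply: int_onB => //; [exact: int_onB|exact: int_onZ].
- exact: int_on_cst.
- by move=> M DM; have [_ _] := HK M DM; apply.
Qed.

Variable A : 'M[R]_n.
Let F (M : 'M[R]_n) := \tr (M *m A).
Let Nm (M : 'M[R]_n) := M *m A.

Lemma mbounded_tr : mbounded F.
Proof. by apply: mbounded_sum => i; exact: mbounded_mulmxr. Qed.

Lemma mbounded_tr_aff (s b : R) : mbounded (fun M => s * F M + b).
Proof.
apply: mboundedD; last exact: mbounded_cst.
by apply: mboundedM; [exact: mbounded_cst|exact: mbounded_tr].
Qed.

Lemma is_derive_haar_cos (s b : R) :
  is_derive s 1 (fun s => E (fun M => cos (s * F M + b)))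
    (- E (fun M => F M * sin (s * F M + b))).
Proof.
have gs : mbounded (fun M => F M * sin (s * F M + b)).
  exact: mboundedM mbounded_tr (mbounded_sin (mbounded_tr_aff _ _)).
rewrite /E -(E_onN mD) ?mbounded_int//.
apply: (taylor1_derive (f := fun s M => cos (s * F M + b))).
- by move=> x; exact: mbounded_cos (mbounded_tr_aff _ _).
- exact: mboundedN.
have [_ bF] := mbounded_tr.
have T := taylor1_cos (taylor1D (taylor1_cst (mbounded_tr_aff s b).2)
    (taylor1M (@taylor1_id R _ D) (taylor1_cst bF))).
have [K HK] := T; exists K => M DM; have [a b' c] := HK M DM.
have E0 : s * F M + b + 0 * F M = s * F M + b by rewrite mul0r addr0.
have E1 : (0 + (1 * F M + 0 * 0)) * - sin (s * F M + b + 0 * F M) = - (F M * sin (s * F M + b)).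
  by rewrite E0; ring.
split; [by rewrite -E0|by rewrite -E1|move=> h h1].
rewrite -E1 -[X in _ - cos X]E0 (_ : (s + h) * F M + b = s * F M + b + h * F M); last by ring.
exact: c.
Qed.

(** Under rotation in the plane of [p] and [q], [F] has derivative [v = N_qp - N_pq] and [v] has
    derivative [- (N_pp + N_qq)], where [N = M A]. Invariance is applied to [sin (s F + b) * v],
    which up to sign and scale is the first derivative of the wave; differentiating it once more
    brings out the square of [v]. *)
Lemma haar_stein_pair (s b : R) (p q : 'I_n) : p != q ->
  E (fun M => s * (cos (s * F M + b) * (Nm M q p - Nm M p q) ^+ 2)
     - sin (s * F M + b) * (Nm M p p + Nm M q q)) = 0.
Proof.
move=> pq.
pose u M := Nm M p p + Nm M q q; pose v M := Nm M q p - Nm M p q.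
have gN i j : mbounded (fun M => Nm M i j) by exact: mbounded_mulmxr.
have gu : mbounded u by exact: mboundedD.
have gv : mbounded v by exact: mboundedB.
pose h0 M := sin (s * F M + b) * v M.
have gh0 : mbounded h0 by apply: mboundedM => //; apply: mbounded_sin; exact: mbounded_tr_aff.
pose f (h : R) M := sin (s * F M + b + ((cos h + -1) * (s * u M) + sin h * (s * v M))) *
   (cos h * v M + sin h * - u M).
have gsu : mbounded (fun M => s * u M) by apply: mboundedM => //; exact: mbounded_cst.
have gsv : mbounded (fun M => s * v M) by apply: mboundedM => //; exact: mbounded_cst.
(* The rotation turns [F] into [F + (cos h - 1) u + sin h v] and [v] into [cos h v - sin h u]. *)
have fE h M : f h M = h0 (rotation p q (cos h) (sin h) *m M).
  rewrite /f /h0 /F /v /Nm -!mulmxA tr_rotation !rotation_mulE !eqxx.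
  rewrite eq_sym (negbTE pq) mulr1n mulr0n /u /v /Nm; congr (sin _ * _); ring.
have Orot h : orthogonal_group (rotation p q (cos h : R) (sin h)).
  by apply: rotation_orthogonal => //; rewrite cos2Dsin2.
have gf h : mbounded (f h).
  rewrite /f; apply: mboundedM.
    apply/mbounded_sin/mboundedD; first exact: mbounded_tr_aff.
    by apply: mboundedD; apply: mboundedM => //; exact: mbounded_cst.
  by apply: mboundedD; apply: mboundedM; try exact: mbounded_cst; [exact: gv|exact: mboundedN].
have T := taylor1M
  (taylor1_sin (taylor1D (taylor1_cst (mbounded_tr_aff s b).2)
    (taylor1D (taylor1M (taylor1D (@taylor1_cosh R _ D) (taylor1_cst (@mbounded_cst _ n (-1)).2)) (taylor1_cst gsu.2))
              (taylor1M (@taylor1_sinh R _ D) (taylor1_cst gsv.2)))))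
  (taylor1D (taylor1M (@taylor1_cosh R _ D) (taylor1_cst gv.2))
            (taylor1M (@taylor1_sinh R _ D) (taylor1_cst (mboundedN gu).2))).
set k0 := (X in taylor1 _ _ X _) in T; set k1 := (X in taylor1 _ _ _ X) in T.
have k0E : k0 = h0.
  apply/funext => M; rewrite /k0 /h0; congr (sin _ * _).
    by rewrite subrr !mul0r !addr0.
  by rewrite mul1r mul0r addr0.
have k1E : k1 = fun M => s * (cos (s * F M + b) * v M ^+ 2) - sin (s * F M + b) * u M.
  apply/funext => M; rewrite /k1 ?subrr ?mul0r ?addr0 ?mul1r ?add0r ?mulr0 ?addr0.
  move: (F M) (u M) (v M) => x y z; ring.
rewrite k0E k1E in T.
apply: (taylor1_invariant gf gh0 _ T).
  apply: mboundedB.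
    apply: mboundedM; first exact: mbounded_cst.
    by apply: mboundedM; [apply: mbounded_cos; exact: mbounded_tr_aff|exact: mboundedX].
  by apply: mboundedM => //; apply: mbounded_sin; exact: mbounded_tr_aff.
move=> h; have H := haar_invariance hmu (Orot h) gh0.
rewrite -[RHS]H.
by apply: eq_E_on => M _; rewrite fE.
Qed.

(** Sum of [haar_stein_pair] over ordered pairs. As [M] is orthogonal, the squared Frobenius norm of
    [M A] is that of [A], so the squares of [N_qp - N_pq] add up to twice the trace difference. Each
    diagonal entry occurs in [2 (n - 1)] ordered pairs, which gives the factor on the left. *)
Lemma haar_stein (s b : R) :
  (n%:R - 1) * E (fun M => F M * sin (s * F M + b)) =
  s * E (fun M => (\tr (A *m A^T) - \tr (M *m A *m M *m A)) * cos (s * F M + b)).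
Proof.
(* On the diagonal there is no plane to rotate; the conditional makes those terms vanish, and the
   square does so by itself. *)
pose h1 (p q : 'I_n) M := s * (cos (s * F M + b) * (Nm M q p - Nm M p q) ^+ 2)
     - sin (s * F M + b) * (if p == q then 0 else Nm M p p + Nm M q q).
have gN i j : mbounded (fun M => Nm M i j) by exact: mbounded_mulmxr.
have gc : mbounded (fun M => cos (s * F M + b)) by exact: mbounded_cos (mbounded_tr_aff _ _).
have gs : mbounded (fun M => sin (s * F M + b)) by exact: mbounded_sin (mbounded_tr_aff _ _).
have gh1 p q : mbounded (h1 p q).
  rewrite /h1; apply: mboundedB.
    apply: mboundedM; first exact: mbounded_cst.
    by apply: mboundedM => //; apply: mboundedX; exact: mboundedB.
  apply: mboundedM => //; case: eqP => _; [exact: mbounded_cst|exact: mboundedD].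
have h10 p q : E (h1 p q) = 0.
  have [->|pq] := eqVneq p q.
    rewrite -[RHS](E_on_cst mD muD); apply: eq_E_on => M _.
    by rewrite /h1 eqxx subrr expr0n/= !mulr0 subrr.
  by rewrite -[RHS](haar_stein_pair s b pq); apply: eq_E_on => M _; rewrite /h1 (negbTE pq).
have : E (fun M => \sum_p \sum_q h1 p q M) = 0.
  rewrite /E (E_on_sum mD muD); last first.
    by move=> p; apply: int_on_sum => // q; exact: mbounded_int.
  rewrite big1// => p _; rewrite (E_on_sum mD muD); last by move=> q; exact: mbounded_int.
  by rewrite big1// => q _; exact: h10.
have gF := mbounded_tr.
have g1 : mbounded (fun M => F M * sin (s * F M + b)) by exact: mboundedM.
have gW : mbounded (fun M => \tr (M *m A *m M *m A)).
  rewrite /mxtrace; apply: mbounded_sum => i.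
  under eq_fun do rewrite -mulmxA mxE.
  by apply: mbounded_sum => j; apply: mboundedM; exact: mbounded_mulmxr.
have g2 : mbounded (fun M => (\tr (A *m A^T) - \tr (M *m A *m M *m A)) * cos (s * F M + b)).
  by apply: mboundedM => //; apply: mboundedB => //; exact: mbounded_cst.
have -> : E (fun M => \sum_p \sum_q h1 p q M) =
    E (fun M => 2 * s * ((\tr (A *m A^T) - \tr (M *m A *m M *m A)) * cos (s * F M + b))
      - 2 * (n%:R - 1) * (F M * sin (s * F M + b))).
  apply: eq_E_on => M OM; rewrite /h1.
  under eq_bigr do rewrite sumrB -!mulr_sumr.
  rewrite sumrB -!mulr_sumr.
  have S1 : \sum_p \sum_q (Nm M q p - Nm M p q) ^+ 2 =
      2 * (\tr (A *m A^T) - \tr (M *m A *m M *m A)).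
    have -> : \tr (A *m A^T) = \sum_p \sum_q Nm M p q ^+ 2.
      transitivity (\tr (Nm M *m (Nm M)^T)).
        by rewrite /Nm trmx_mul mulmxA [RHS]mxtrace_mulC !mulmxA (mulmx1C OM) mul1mx.
      move: (Nm M) => N; rewrite /mxtrace; apply: eq_bigr => p _; rewrite mxE.
      by apply: eq_bigr => q _; rewrite mxE expr2.
    have -> : \tr (M *m A *m M *m A) = \sum_p \sum_q Nm M p q * Nm M q p.
      by rewrite -mulmxA /mxtrace; apply: eq_bigr => p _; rewrite mxE.
    rewrite -sumrB mulr_sumr.
    have -> : \sum_p \sum_q (Nm M q p - Nm M p q) ^+ 2 =
       \sum_p \sum_q (Nm M q p ^+ 2) + \sum_p \sum_q (Nm M p q ^+ 2 - 2 * (Nm M p q * Nm M q p)).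
      rewrite -big_split; apply: eq_bigr => p _; rewrite -big_split; apply: eq_bigr => q _ /=.
      by ring.
    rewrite exchange_big/= -big_split/=; apply: eq_bigr => p _.
    rewrite -sumrB mulr_sumr -big_split/=; apply: eq_bigr => q _; ring.
  have S2 : \sum_p \sum_q (if p == q then 0 else Nm M p p + Nm M q q) = 2 * (n%:R - 1) * F M.
    have -> : F M = \sum_p Nm M p p by [].
    rewrite mulr_sumr.
    have -> : \sum_p \sum_q (if p == q then 0 else Nm M p p + Nm M q q) =
        \sum_p (n%:R * Nm M p p + \sum_q Nm M q q - 2 * Nm M p p).
      apply: eq_bigr => p _.
      have -> : n%:R * Nm M p p = \sum_(q < n) Nm M p p.
        by rewrite sumr_const card_ord mulr_natl.
      rewrite -big_split/= [in RHS](bigD1 p)//= (bigD1 p)//= eqxx add0r.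
      rewrite addrAC (_ : _ + _ - _ = 0) ?add0r; last by ring.
      by apply: eq_bigr => q; rewrite eq_sym => /negbTE ->.
    rewrite sumrB big_split/= sumr_const card_ord -[(\sum_i _) *+ n]mulr_natl mulr_sumr.
    by rewrite -big_split -sumrB /=; apply: eq_bigr => p _; ring.
  by rewrite S1 S2; ring.
have I1 := mbounded_int mu g1; have I2 := mbounded_int mu g2.
rewrite /E (E_onB mD); [|exact: int_onZ|exact: int_onZ].
rewrite !(E_onZ mD)//.
move=> /eqP; rewrite subr_eq0 => /eqP H.
have n2 : (2 : R) != 0 by rewrite pnatr_eq0.
by apply: (mulfI n2); rewrite !mulrA.
Qed.

End haar_stein.

(** * Fourth moments of Haar measure *)

Section orthogonal_matrices.
Variables (R : realType) (n : nat).

Definition sign_flip (r : 'I_n) : 'M[R]_n := 1%:M - 2 *: delta_mx r r.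

Lemma sign_flip_mulE m r (N : 'M[R]_(n, m)) i j :
  (sign_flip r *m N) i j = (-1) ^+ (i == r) * N i j.
Proof.
rewrite mulmxBl mul1mx -scalemxAl.
move: (delta_mulE r r N i j); move: (delta_mx r r *m N) => b H.
by rewrite !mxE H; case: eqP => [->|_]; rewrite /= ?expr1 ?expr0; ring.
Qed.

Lemma sign_flip_orthogonal r : orthogonal_group (sign_flip r).
Proof.
apply/matrixP => i j; rewrite sign_flip_mulE !mxE (andbC (j == r)) [j == i]eq_sym.
have [->|ir] := eqVneq i r.
  by rewrite eq_sym; have [_|_] := eqVneq j r; rewrite /= ?expr1; ring.
by rewrite /= expr0; ring.
Qed.

Lemma perm_mx_mulE m (s : 'S_n) (N : 'M[R]_(n, m)) i j : (perm_mx s *m N) i j = N (s i) j.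
Proof. by rewrite -row_permE mxE. Qed.

Lemma perm_mx_orthogonal (s : 'S_n) : orthogonal_group (perm_mx s : 'M[R]_n).
Proof. by rewrite /orthogonal_group/= tr_perm_mx -perm_mxM mulgV perm_mx1. Qed.

Lemma exists_perm2 (p q a e : 'I_n) : p != q -> a != e ->
  exists s : 'S_n, s p = a /\ s q = e.
Proof.
move=> pq ae; exists (tperm p a * tperm (tperm p a q) e)%g.
rewrite !permM tpermL tpermL; split => //.
have aq : tperm p a q != a by rewrite -[X in _ != X](tpermL p a) (inj_eq perm_inj) eq_sym.
by apply: tpermD; rewrite // eq_sym.
Qed.

End orthogonal_matrices.

Section row_tensor.
Variables (R : realType) (n : nat) (mu : probability (borel 'M[R]_n) R).
Hypothesis hmu : is_haar_orthogonal mu.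
Let D : set (borel 'M[R]_n) := @orthogonal_group R n.
Let E (f : 'M[R]_n -> R) := E_on mu D f.
Let mD : measurable D := @measurable_orthogonal R n.
Let muD : mu D = 1%E := haar_orthogonal1 hmu.
Variables u1 u2 u3 u4 : 'cV[R]_n.

(** Left multiplication acts on row indices only. Absorbing the column indices in [u1], ..., [u4]
    leaves a tensor of order four in the row indices, invariant under the whole orthogonal group. *)
Definition monomial4 (a c e g : 'I_n) (M : 'M[R]_n) : R :=
  (M *m u1) a 0 * (M *m u2) c 0 * (M *m u3) e 0 * (M *m u4) g 0.

Definition moment4 a c e g : R := E (monomial4 a c e g).
Let T := moment4.

Lemma mbounded_monomial4 a c e g : mbounded (monomial4 a c e g).
Proof.
by apply: mboundedM; [apply: mboundedM; [apply: mboundedM|]|]; exact: mbounded_mulmxr.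
Qed.

Lemma moment4_mulmx Q a c e g : orthogonal_group Q ->
  T a c e g = E (fun M => monomial4 a c e g (Q *m M)).
Proof. by move=> OQ; rewrite /E (haar_invariance hmu OQ (mbounded_monomial4 _ _ _ _)). Qed.

Lemma moment4_flip r a c e g :
  T a c e g = (-1) ^+ (a == r) * (-1) ^+ (c == r) * (-1) ^+ (e == r) * (-1) ^+ (g == r)
     * T a c e g.
Proof.
rewrite {1}(moment4_mulmx _ _ _ _ (sign_flip_orthogonal R r)) -(E_onZ mD); last first.
  exact/mbounded_int/mbounded_monomial4.
apply: eq_E_on => M _; rewrite /monomial4 -!mulmxA.
rewrite !sign_flip_mulE.
by ring.
Qed.


(** Reflection of the coordinate [r] changes the sign of the moment. *)
Lemma moment4_odd r a c e g :
  odd ((a == r) + (c == r) + (e == r) + (g == r)) -> T a c e g = 0.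
Proof.
move=> o; have := moment4_flip r a c e g.
rewrite -!exprD -signr_odd o expr1 mulN1r => /eqP.
by rewrite -subr_eq0 opprK -mulr2n mulrn_eq0/= => /eqP.
Qed.

Lemma moment4_perm (s : 'S_n) a c e g : T (s a) (s c) (s e) (s g) = T a c e g.
Proof.
rewrite [RHS](moment4_mulmx _ _ _ _ (perm_mx_orthogonal R s)).
apply: eq_E_on => M _; rewrite /monomial4 -!mulmxA.
by rewrite !perm_mx_mulE.
Qed.

(** Rotation by an eighth of a turn replaces row [p] by the sum of rows [p] and [q] over [sqrt 2].
    Of the sixteen terms of the expansion the odd ones vanish, and exchanging [p] and [q] pairs the
    others: four times the left side is twice it plus twice the right side. *)
Lemma moment4_diag p q : p != q -> T p p p p = T p p q q + T p q p q + T p q q p.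
Proof.
move=> pq; have qp : q != p by rewrite eq_sym.
pose c : R := (Num.sqrt 2)^-1.
have c2 : c ^+ 2 = 2^-1 by rewrite exprVn sqr_sqrtr.
have OQ : orthogonal_group (rotation p q c c).
  by apply: rotation_orthogonal => //; rewrite c2; field.
pose B : seq 'I_n := [:: p; q].
have H : T p p p p = 4^-1 * \sum_(i <- B) \sum_(j <- B) \sum_(k <- B) \sum_(l <- B) T i j k l.
  rewrite (moment4_mulmx _ _ _ _ OQ).
  transitivity (E (fun M => 4^-1 * \sum_(i <- B) \sum_(j <- B) \sum_(k <- B)
      \sum_(l <- B) monomial4 i j k l M)).
    apply: eq_E_on => M _; rewrite /monomial4 -!mulmxA !rotation_mulE !eqxx (negbTE pq).
    rewrite !big_cons !big_nil mulr1n mulr0n.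
    have -> : (4^-1 : R) = c ^+ 2 * c ^+ 2 by rewrite c2; field.
    by ring.
  have G i j k l := mbounded_int mu (mbounded_monomial4 i j k l).
  rewrite /E (E_onZ mD); last by do 4 (apply: int_on_sum => // ?).
  congr (_ * _); rewrite (E_on_sum mD muD); last by move=> ?; do 3 (apply: int_on_sum => // ?).
  apply: eq_bigr => i _; rewrite (E_on_sum mD muD); last by move=> ?; do 2 (apply: int_on_sum => // ?).
  apply: eq_bigr => j _; rewrite (E_on_sum mD muD); last by move=> ?; do 1 (apply: int_on_sum => // ?).
  by apply: eq_bigr => k _; rewrite (E_on_sum mD muD).
have P i j k l : T (tperm p q i) (tperm p q j) (tperm p q k) (tperm p q l) = T i j k l.
  exact: moment4_perm.
have o i j k l : odd ((i == p) + (j == p) + (k == p) + (l == p)) -> T i j k l = 0.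
  exact: moment4_odd.
move: H; rewrite !big_cons !big_nil.
have Eo := (o p p p q, o p p q p, o p q p p, o q p p p, o p q q q, o q p q q, o q q p q, o q q q p).
rewrite !Eo ?eqxx ?(negbTE qp)//.
have := P p p p p; have := P p p q q; have := P p q p q; have := P p q q p.
rewrite !tpermL !tpermR => -> -> -> ->; set t := T p p p p => H.
by lra.
Qed.

(** An isotropic tensor of order four is a combination of the three pairings. Patterns with an
    unpaired index vanish by reflection, those with two distinct pairs are carried to [p] and [q] by
    a permutation, and four equal indices are [moment4_diag]. *)
Lemma moment4_tensor p q : p != q -> forall a c e g,
  T a c e g = T p p q q * ((a == c) && (e == g))%:R +
    T p q p q * ((a == e) && (c == g))%:R + T p q q p * ((a == g) && (c == e))%:R.
Proof.
move=> pq a c e g.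
have perm2 (i j : 'I_n) : i != j -> exists s : 'S_n, s p = i /\ s q = j by exact: exists_perm2.
have [<-{c}|ac] := eqVneq a c.
  have [<-{g}|eg] := eqVneq e g.
    have [<-{e}|ae] := eqVneq a e.
      rewrite -[LHS](moment4_perm (tperm p a)) !tpermR (moment4_diag pq).
      by rewrite /=; ring.
    have [s [<- <-]] := perm2 _ _ ae.
    by rewrite moment4_perm ?(inj_eq perm_inj) ?(negbTE pq)/=; ring.
  rewrite (moment4_odd (r := e)).
    have [->|_] := eqVneq a e; first by rewrite (negbTE eg)/=; ring.
    by rewrite !andbF/=; ring.
  by rewrite eqxx [g == e]eq_sym (negbTE eg); case: (a == e).
have [<-{e}|ae] := eqVneq a e.
  have [<-{g}|cg] := eqVneq c g.
    have [s [<- <-]] := perm2 _ _ ac.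
    by rewrite moment4_perm ?(inj_eq perm_inj) ?(negbTE pq)/=; ring.
  rewrite (moment4_odd (r := c)).
    by rewrite [c == a]eq_sym (negbTE ac) !andbF/=; ring.
  by rewrite eqxx (negbTE ac) [g == c]eq_sym (negbTE cg).
have [<-{g}|ag] := eqVneq a g.
  have [<-{e ae}|ce] := eqVneq c e.
    have [s [<- <-]] := perm2 _ _ ac.
    by rewrite moment4_perm ?(inj_eq perm_inj) ?(negbTE pq)/=; ring.
  rewrite (moment4_odd (r := c)) /=; first by ring.
  by rewrite eqxx (negbTE ac) [e == c]eq_sym (negbTE ce).
rewrite (moment4_odd (r := a)) /=; first by ring.
by rewrite eqxx [c == a]eq_sym [e == a]eq_sym [g == a]eq_sym (negbTE ac) (negbTE ae) (negbTE ag).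
Qed.

Hypothesis hn : (2 <= n)%N.

Lemma orthogonal_dotp (M : 'M[R]_n) (v w : 'cV[R]_n) : orthogonal_group M ->
  \sum_a (M *m v) a 0 * (M *m w) a 0 = dotp v w.
Proof.
move=> OM; rewrite -/(dotp (M *m v) (M *m w)) dotp_mulmxl mulmxA.
by rewrite (mulmx1C OM) mul1mx.
Qed.

(* The three contractions of the tensor determine its three coefficients. *)
Lemma moment4_contractions p q : p != q ->
  let al := T p p q q in let be := T p q p q in let ga := T p q q p in
  [/\ n%:R ^+ 2 * al + n%:R * be + n%:R * ga = dotp u1 u2 * dotp u3 u4,
      n%:R * al + n%:R ^+ 2 * be + n%:R * ga = dotp u1 u3 * dotp u2 u4 &
      n%:R * al + n%:R * be + n%:R ^+ 2 * ga = dotp u1 u4 * dotp u2 u3].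
Proof.
move=> pq al be ga; have tens := moment4_tensor pq.
have G i j k l := mbounded_int mu (mbounded_monomial4 i j k l).
have SE (f : 'I_n -> 'I_n -> 'M[R]_n -> R) : (forall i j, int_on mu D (f i j)) ->
    \sum_i \sum_j E (f i j) = E (fun M => \sum_i \sum_j f i j M).
  move=> If; rewrite /E (E_on_sum mD muD); last by move=> ?; apply: int_on_sum.
  by apply: eq_bigr => i _; rewrite (E_on_sum mD muD).
have dsum (x : R) : \sum_(i < n) \sum_(j < n) x * (i == j)%:R = n%:R * x.
  have -> : n%:R * x = \sum_(i < n) x by rewrite sumr_const card_ord mulr_natl.
  apply: eq_bigr => i _; rewrite (bigD1 i)//= eqxx mulr1 big1 ?addr0// => j.
  by rewrite eq_sym => /negbTE ->; rewrite mulr0.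
have csum (x : R) : \sum_(i < n) \sum_(j < n) x = n%:R ^+ 2 * x.
  by rewrite !sumr_const card_ord -mulrnA -[LHS]mulr_natl natrM -expr2.
have split3 (x y z : R) (f g h : 'I_n -> 'I_n -> R) :
    \sum_i \sum_j (x * f i j + y * g i j + z * h i j) =
    \sum_i \sum_j x * f i j + \sum_i \sum_j y * g i j + \sum_i \sum_j z * h i j.
  by rewrite -!big_split/=; apply: eq_bigr => i _; rewrite -!big_split.
have Ec (f : 'M[R]_n -> R) x : (forall M, D M -> f M = x) -> E f = x.
  by move=> fx; rewrite -[RHS](E_on_cst mD muD); exact: eq_E_on.
split.
- transitivity (\sum_i \sum_j T i i j j).
    under [RHS]eq_bigr do under eq_bigr do rewrite tens !eqxx/= andbb.
    by rewrite split3 !dsum -csum; congr (_ + _ + _); apply: eq_bigr => i _; apply: eq_bigr => j _; rewrite mulr1.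
  rewrite SE//; apply: Ec => M OM; rewrite -(orthogonal_dotp u1 u2 OM) -(orthogonal_dotp u3 u4 OM).
  rewrite mulr_suml; apply: eq_bigr => i _; rewrite mulr_sumr; apply: eq_bigr => j _.
  by rewrite /monomial4; ring.
- transitivity (\sum_i \sum_j T i j i j).
    under [RHS]eq_bigr do under eq_bigr do rewrite tens !eqxx/= andbb [X in _ && X]eq_sym andbb.
    by rewrite split3 !dsum -csum; congr (_ + _ + _); apply: eq_bigr => i _; apply: eq_bigr => j _; rewrite mulr1.
  rewrite SE//; apply: Ec => M OM; rewrite -(orthogonal_dotp u1 u3 OM) -(orthogonal_dotp u2 u4 OM).
  rewrite mulr_suml; apply: eq_bigr => i _; rewrite mulr_sumr; apply: eq_bigr => j _.
  by rewrite /monomial4; ring.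
- transitivity (\sum_i \sum_j T i j j i).
    under [RHS]eq_bigr do under eq_bigr do rewrite tens !eqxx/= [X in _ && X]eq_sym andbb.
    by rewrite split3 !dsum -csum; congr (_ + _ + _); apply: eq_bigr => i _; apply: eq_bigr => j _; rewrite mulr1.
  rewrite SE//; apply: Ec => M OM; rewrite -(orthogonal_dotp u1 u4 OM) -(orthogonal_dotp u2 u3 OM).
  rewrite mulr_suml; apply: eq_bigr => i _; rewrite mulr_sumr; apply: eq_bigr => j _.
  by rewrite /monomial4; ring.
Qed.

(** Solution of the linear system of the contractions, the order-four Weingarten formula, kept free
    of division. The indices 0 and 1 serve as the distinct pair, which is where [n >= 2] enters. *)
Lemma moment4E a c e g :
  let N : R := n%:R in
  let P := dotp u1 u2 * dotp u3 u4 in let Q := dotp u1 u3 * dotp u2 u4 in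
  let S := dotp u1 u4 * dotp u2 u3 in
  T a c e g * ((N - 1) * N * (N + 2)) =
    ((N + 1) * P - Q - S) * ((a == c) && (e == g))%:R +
    ((N + 1) * Q - P - S) * ((a == e) && (c == g))%:R +
    ((N + 1) * S - P - Q) * ((a == g) && (c == e))%:R.
Proof.
move=> N P Q S; pose p : 'I_n := Ordinal (ltnW hn); pose q : 'I_n := Ordinal hn.
have pq : p != q by [].
have [] := moment4_contractions pq; rewrite -/N -/P -/Q -/S => HP HQ HS.
rewrite (moment4_tensor pq) -HP -HQ -HS; ring.
Qed.

End row_tensor.

Section delta_sums.
Variables (R : realType) (n : nat).

Lemma sum_delta (x : 'I_n -> R) e : \sum_g x g * (e == g)%:R = x e.
Proof.
rewrite (bigD1 e)//= eqxx mulr1 big1 ?addr0// => g.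
by rewrite eq_sym => /negbTE ->; rewrite mulr0.
Qed.

Let natrb (b1 b2 : bool) : (b1 && b2)%:R = b1%:R * b2%:R :> R.
Proof. by rewrite -natrM mulnb. Qed.

Variable F : 'I_n -> 'I_n -> 'I_n -> 'I_n -> R.

Lemma sum_delta_ac_eg :
  \sum_a \sum_c \sum_e \sum_g F a c e g * ((a == c) && (e == g))%:R = \sum_a \sum_e F a a e e.
Proof.
apply: eq_bigr => a _.
transitivity (\sum_c (\sum_e F a c e e) * (a == c)%:R); last exact: sum_delta.
apply: eq_bigr => c _; rewrite mulr_suml; apply: eq_bigr => e _.
rewrite -(sum_delta (fun g => F a c e g) e) mulr_suml; apply: eq_bigr => g _.
by rewrite natrb; ring.
Qed.

Lemma sum_delta_ae_cg :
  \sum_a \sum_c \sum_e \sum_g F a c e g * ((a == e) && (c == g))%:R = \sum_a \sum_c F a c a c.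
Proof.
apply: eq_bigr => a _; apply: eq_bigr => c _.
transitivity (\sum_e F a c e c * (a == e)%:R); last exact: sum_delta.
apply: eq_bigr => e _.
rewrite -(sum_delta (fun g => F a c e g) c) mulr_suml; apply: eq_bigr => g _.
by rewrite natrb; ring.
Qed.

Lemma sum_delta_ag_ce :
  \sum_a \sum_c \sum_e \sum_g F a c e g * ((a == g) && (c == e))%:R = \sum_a \sum_c F a c c a.
Proof.
apply: eq_bigr => a _; apply: eq_bigr => c _.
transitivity (\sum_e F a c e a * (c == e)%:R); last exact: sum_delta.
apply: eq_bigr => e _.
rewrite -(sum_delta (fun g => F a c e g) a) mulr_suml; apply: eq_bigr => g _.
by rewrite natrb; ring.
Qed.

End delta_sums.

(** * First and second moments of the quadratic traces *)

Section quadratic_variance.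
Variables (R : realType) (n : nat) (mu : probability (borel 'M[R]_n) R).
Hypotheses (hmu : is_haar_orthogonal mu) (hn : (2 <= n)%N).
Let D : set (borel 'M[R]_n) := @orthogonal_group R n.
Let E (f : 'M[R]_n -> R) := E_on mu D f.
Let mD : measurable D := @measurable_orthogonal R n.
Let muD : mu D = 1%E := haar_orthogonal1 hmu.
Let N : R := n%:R.

Let N2 : 2 <= N. Proof. by rewrite ler_nat. Qed.

Lemma mul_col (m : nat) (M : 'M[R]_n) (A : 'M[R]_(n, m)) a c :
  (M *m A) a c = (M *m col c A) a 0.
Proof. by rewrite !mxE; apply: eq_bigr => j _; rewrite mxE. Qed.

Lemma mbounded_quadratic (A B : 'M[R]_n) : mbounded (fun M => \tr (M *m A *m M *m B)).
Proof.
rewrite /mxtrace; apply: mbounded_sum => i; under eq_fun do rewrite -mulmxA mxE.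
by apply: mbounded_sum => j; apply: mboundedM; exact: mbounded_mulmxr.
Qed.

(** A contraction of the fourth moments: for the unit vector [e0], the factor
    [dotp (M e0) (M e0) = 1] is inserted and expanded. *)
Lemma haar_moment2 (v w : 'cV[R]_n) a c :
  E (fun M => (M *m v) a 0 * (M *m w) c 0) * N = dotp v w * (a == c)%:R.
Proof.
pose i0 : 'I_n := Ordinal (ltnW hn); pose e0 : 'cV[R]_n := delta_mx i0 0.
have e01 : dotp e0 e0 = 1.
  rewrite /dotp (bigD1 i0)//= !mxE !eqxx mulr1 big1 ?addr0// => j ji.
  by rewrite !mxE (negbTE ji) mul0r.
have EE : E (fun M => (M *m v) a 0 * (M *m w) c 0) = \sum_e moment4 mu v w e0 e0 a c e e.
  rewrite -(E_on_sum mD muD); last by move=> e; exact/mbounded_int/mbounded_monomial4.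
  apply: eq_E_on => M OM; rewrite -[LHS]mulr1 -e01 -(orthogonal_dotp e0 e0 OM) mulr_sumr.
  by apply: eq_bigr => e _; rewrite /monomial4 mulrA.
have K0 : (N - 1) * (N + 2) != 0 by apply: lt0r_neq0; move: N2; nra.
apply: (mulIf K0); rewrite -mulrA (_ : N * _ = (N - 1) * N * (N + 2)); last by ring.
rewrite EE mulr_suml.
have M4 e := moment4E hmu v w e0 e0 hn a c e e; rewrite -/N in M4.
under eq_bigr do rewrite {}M4 eqxx andbT.
set P := dotp v w * _; set Q := dotp v e0 * _;
rewrite !big_split/= sumr_const card_ord -mulr_natl -/N.
have dd (x : R) : \sum_e x * ((a == e) && (c == e))%:R = x * (a == c)%:R.
  transitivity (\sum_e (x * (c == e)%:R) * (a == e)%:R).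
    by apply: eq_bigr => e _; case: (a == e); rewrite /= ?mulr1 ?mulr0.
  by rewrite (sum_delta (fun e => x * (c == e)%:R)) eq_sym.
rewrite !dd /P e01 mulr1; ring.
Qed.

Variables A B : 'M[R]_n.
Let X := A^T *m B.
Let G := A^T *m A.
Let H := B^T *m B.

Lemma haar_tr_mean : E (fun M => \tr (M *m A *m M *m B)) * N = \tr X.
Proof.
have -> : E (fun M => \tr (M *m A *m M *m B)) =
    \sum_a \sum_c E (fun M => (M *m col c A) a 0 * (M *m col a B) c 0).
  have g a c : int_on mu D (fun M => (M *m col c A) a 0 * (M *m col a B) c 0).
    by apply: mbounded_int; apply: mboundedM; exact: mbounded_mulmxr.
  transitivity (E (fun M => \sum_a \sum_c (M *m col c A) a 0 * (M *m col a B) c 0)).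
    apply: eq_E_on => M _; rewrite -mulmxA /mxtrace; apply: eq_bigr => a _.
    by rewrite mxE; apply: eq_bigr => c _; rewrite -!mul_col.
  rewrite /E (E_on_sum mD muD); last by move=> a; exact: int_on_sum.
  by apply: eq_bigr => a _; rewrite (E_on_sum mD muD).
rewrite mulr_suml; apply: eq_bigr => a _; rewrite mulr_suml.
under eq_bigr do rewrite haar_moment2.
rewrite (sum_delta (fun c => dotp (col c A) (col a B))) mxE.
by apply: eq_bigr => j _; rewrite !mxE.
Qed.

Lemma dotp_col (U V : 'M[R]_n) a c : dotp (col a U) (col c V) = (U^T *m V) a c.
Proof. by rewrite mxE; apply: eq_bigr => j _; rewrite !mxE. Qed.

(** In the expanded square the columns of [A] and [B] play the part of [u1], ..., [u4], so the inner
    products in [moment4E] are entries of [X], [G] and [H]. *)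
Lemma haar_sqr_quadratic :
  E (fun M => \tr (M *m A *m M *m B) ^+ 2) * ((N - 1) * N * (N + 2)) =
  (N + 1) * (2 * \tr X ^+ 2 + \tr G * \tr H)
  - 2 * (\sum_a \sum_c G a c * H a c) - 2 * (\sum_a \sum_c X a c * X c a)
  - 2 * (\sum_a \sum_c X a c ^+ 2).
Proof.
pose m4 a c e g := monomial4 (col c A) (col a B) (col g A) (col e B) a c e g.
have gm a c e g : int_on mu D (m4 a c e g) by exact/mbounded_int/mbounded_monomial4.
have -> : E (fun M => \tr (M *m A *m M *m B) ^+ 2) =
    \sum_a \sum_c \sum_e \sum_g E (m4 a c e g).
  transitivity (E (fun M => \sum_a \sum_c \sum_e \sum_g m4 a c e g M)).
    apply: eq_E_on => M _.
    have -> : \tr (M *m A *m M *m B) = \sum_a \sum_c (M *m col c A) a 0 * (M *m col a B) c 0.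
      rewrite -mulmxA /mxtrace; apply: eq_bigr => a _.
      by rewrite mxE; apply: eq_bigr => c _; rewrite -!mul_col.
    rewrite expr2 mulr_suml; apply: eq_bigr => a _.
    rewrite mulr_suml; apply: eq_bigr => c _.
    rewrite mulr_sumr; apply: eq_bigr => e _.
    rewrite mulr_sumr; apply: eq_bigr => g _.
    by rewrite /m4 /monomial4 mulrA.
  rewrite /E (E_on_sum mD muD); last by move=> ?; do 3 (apply: int_on_sum => // ?).
  apply: eq_bigr => a _; rewrite (E_on_sum mD muD); last by move=> ?; do 2 (apply: int_on_sum => // ?).
  apply: eq_bigr => c _; rewrite (E_on_sum mD muD); last by move=> ?; do 1 (apply: int_on_sum => // ?).
  by apply: eq_bigr => e _; rewrite (E_on_sum mD muD).
(* Coefficients of the three pairings in [moment4E]; each pairing collapses the fourfold sum to a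
   double one. *)
pose F1 a c e g := (N + 1) * (X c a * X g e) - G c g * H a e - X c e * X g a.
pose F2 a c e g := (N + 1) * (G c g * H a e) - X c a * X g e - X c e * X g a.
pose F3 a c e g := (N + 1) * (X c e * X g a) - X c a * X g e - G c g * H a e.
transitivity (\sum_a \sum_c \sum_e \sum_g (F1 a c e g * ((a == c) && (e == g))%:R +
    F2 a c e g * ((a == e) && (c == g))%:R + F3 a c e g * ((a == g) && (c == e))%:R)).
  rewrite mulr_suml; apply: eq_bigr => a _; rewrite mulr_suml; apply: eq_bigr => c _.
  rewrite mulr_suml; apply: eq_bigr => e _; rewrite mulr_suml; apply: eq_bigr => g _.
  have := moment4E hmu (col c A) (col a B) (col g A) (col e B) hn a c e g.
  rewrite -/N !dotp_col -/X -/G -/H => M4; rewrite [LHS]M4 /F1 /F2 /F3.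
  have -> : (B^T *m A) a g = X g a.
    have -> : B^T *m A = X^T by rewrite /X trmx_mul trmxK.
    by rewrite mxE.
  by [].
have S4 (f g h : 'I_n -> 'I_n -> 'I_n -> 'I_n -> R) :
  \sum_a \sum_c \sum_e \sum_l (f a c e l + g a c e l + h a c e l) =
  \sum_a \sum_c \sum_e \sum_l f a c e l + \sum_a \sum_c \sum_e \sum_l g a c e l
  + \sum_a \sum_c \sum_e \sum_l h a c e l.
  rewrite -!big_split; apply: eq_bigr => a _; rewrite -!big_split; apply: eq_bigr => c _.
  by rewrite -!big_split; apply: eq_bigr => e _; rewrite -!big_split.
rewrite S4 sum_delta_ac_eg sum_delta_ae_cg sum_delta_ag_ce.
have prod (f g : 'I_n -> R) : \sum_a \sum_c f a * g c = (\sum_a f a) * (\sum_c g c).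
  by rewrite mulr_suml; apply: eq_bigr => a _; rewrite mulr_sumr.
have S2 (x : R) (f g h : 'I_n -> 'I_n -> R) :
  \sum_a \sum_c (x * f a c - g a c - h a c) =
  x * (\sum_a \sum_c f a c) - \sum_a \sum_c g a c - \sum_a \sum_c h a c.
  rewrite mulr_sumr -!sumrB; apply: eq_bigr => a _.
  by rewrite mulr_sumr -!sumrB.
have symm (U : 'M[R]_n) i j : (U^T *m U) i j = (U^T *m U) j i.
  by rewrite -[in LHS](trmxK U) -trmx_mul trmxK mxE.
rewrite {1}/F1 S2 (prod (fun a => X a a) (fun a => X a a)) -/(\tr X).
rewrite {1}/F2 S2 (exchange_big _ _ _ _ _ (fun a c => G c c * H a a))/=.
rewrite (prod (fun a => G a a) (fun a => H a a)) -/(\tr G) -/(\tr H).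
rewrite {1}/F3 S2 (exchange_big _ _ _ _ _ (fun a c => X c c * X a a))/=.
rewrite (prod (fun a => X a a) (fun a => X a a)) -/(\tr X).
have E1 : \sum_a \sum_c X c a * X c a = \sum_a \sum_c X a c ^+ 2.
  by rewrite exchange_big; apply: eq_bigr => a _; apply: eq_bigr => c _; rewrite expr2.
have E2 : \sum_a \sum_c X c a * X a c = \sum_a \sum_c X a c * X c a.
  by rewrite exchange_big.
have E3 : \sum_a \sum_c G c a * H a c = \sum_a \sum_c G a c * H a c.
  by apply: eq_bigr => a _; apply: eq_bigr => c _; rewrite /G symm.
rewrite E1 E2 E3; ring.
Qed.

End quadratic_variance.

Section variance_bounds.
Variables (R : realType) (n : nat) (mu : probability (borel 'M[R]_n) R).
Hypotheses (hmu : is_haar_orthogonal mu) (hn : (2 <= n)%N).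
Let D : set (borel 'M[R]_n) := @orthogonal_group R n.
Let E (f : 'M[R]_n -> R) := E_on mu D f.
Let mD : measurable D := @measurable_orthogonal R n.
Let muD : mu D = 1%E := haar_orthogonal1 hmu.
Let N : R := n%:R.
Let N2 : 2 <= N. Proof. by rewrite ler_nat. Qed.
Let K : R := (N - 1) * N * (N + 2).
Let K0 : 0 < K. Proof. by rewrite /K !mulr_gt0//; move: N2; lra. Qed.

(** The trace has mean 1, so it suffices to bound its second moment by 3. Up to the factor [K] that
    moment is [3 N^2 (N + 1) - 6 S], with [S] the squared Frobenius norm of [G], and
    [3 K = 3 N^2 (N + 1) - 6 N]. So [S >= N] is all that is needed; it follows from [Tr G = N] by
    expanding the squares of [G_aa - 1]. *)
Lemma haar_variance_diag (A : 'M[R]_n) : \tr (A^T *m A) = N ->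
  E (fun M => (1 - \tr (M *m A *m M *m A)) ^+ 2) <= 2.
Proof.
move=> trA.
have IW := mbounded_int mu (mbounded_quadratic A A).
have IW2 := mbounded_int mu (mboundedX 2 (mbounded_quadratic A A)).
have EW : E (fun M => \tr (M *m A *m M *m A)) = 1.
  have := haar_tr_mean hmu hn A A; rewrite trA -/N => H.
  have N0 : N != 0 by apply: lt0r_neq0; move: N2; lra.
  by apply: (mulIf N0); rewrite mul1r.
have EW2 : E (fun M => \tr (M *m A *m M *m A) ^+ 2) <= 3.
  rewrite -(ler_pM2r K0); have := haar_sqr_quadratic hmu hn A A.
  rewrite -/N -/K => H; rewrite [leLHS]H trA; clear H.
  set G := A^T *m A; set S := \sum_a \sum_c G a c ^+ 2.
  have -> : \sum_a \sum_c G a c * G c a = S.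
    apply: eq_bigr => a _; apply: eq_bigr => c _; rewrite expr2; congr (_ * _).
    have GT : G^T = G by rewrite /G trmx_mul trmxK.
    by rewrite -[in LHS]GT mxE.
  have SN : N <= S.
    have S1 : \sum_a G a a ^+ 2 <= S.
      apply: ler_sum => a _; rewrite (bigD1 a)//= lerDl.
      by apply: sumr_ge0 => c _; exact: sqr_ge0.
    have : 0 <= \sum_a (G a a - 1) ^+ 2 by apply: sumr_ge0 => a _; exact: sqr_ge0.
    have -> : \sum_a (G a a - 1) ^+ 2 = \sum_a G a a ^+ 2 - 2 * \tr G + N.
      rewrite /mxtrace mulr_sumr -sumrB.
      have -> : N = \sum_(a < n) 1 by rewrite sumr_const card_ord.
      by rewrite -big_split; apply: eq_bigr => a _ /=; ring.
    by rewrite trA; lra.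
  by rewrite /K; move: N2; nra.
have -> : E (fun M => (1 - \tr (M *m A *m M *m A)) ^+ 2) =
    1 - 2 * E (fun M => \tr (M *m A *m M *m A)) + E (fun M => \tr (M *m A *m M *m A) ^+ 2).
  have I1 : int_on mu D (fun=> 1) by exact: int_on_cst.
  rewrite -[X in X - _](E_on_cst mD muD) /E -(E_onZ mD)// -(E_onB mD)//; last exact: int_onZ.
  rewrite -(E_onD mD)//; last by apply: int_onB => //; exact: int_onZ.
  by apply: eq_E_on => M _; ring.
by rewrite EW; lra.
Qed.

(** With [Tr X = 0] only [(N + 1) N^2] remains besides two subtracted terms, both nonnegative: twice
    the squared Frobenius norm of [A B^T], and the squared Frobenius norm of [X + X^T]. Then
    [(N + 1) N^2 <= 2 K] for [N >= 2]. *)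
Lemma haar_variance_offdiag (A B : 'M[R]_n) :
  \tr (A^T *m A) = N -> \tr (B^T *m B) = N -> \tr (A^T *m B) = 0 ->
  E (fun M => \tr (M *m A *m M *m B) ^+ 2) <= 2.
Proof.
move=> trA trB trAB.
rewrite -(ler_pM2r K0); have := haar_sqr_quadratic hmu hn A B.
rewrite -/N -/K => H; rewrite [leLHS]H trA trB trAB; clear H.
set G := A^T *m A; set H := B^T *m B; set X := A^T *m B.
have S1 : 0 <= \sum_a \sum_c G a c * H a c.
  have -> : \sum_a \sum_c G a c * H a c = \tr (G *m H).
    apply: eq_bigr => a _; rewrite mxE; apply: eq_bigr => c _; congr (_ * _).
    have HT : H^T = H by rewrite /H trmx_mul trmxK.
    by rewrite -[in LHS]HT mxE.
  rewrite /G /H mulmxA mxtrace_mulC !mulmxA.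
  have -> : B *m A^T *m A *m B^T = (A *m B^T)^T *m (A *m B^T) by rewrite trmx_mul trmxK !mulmxA.
  apply: sumr_ge0 => a _; rewrite mxE; apply: sumr_ge0 => c _.
  by rewrite mxE -expr2 sqr_ge0.
have S2 : 0 <= \sum_a \sum_c X a c * X c a + \sum_a \sum_c X a c ^+ 2.
  have E1 : \sum_a \sum_c X c a ^+ 2 = \sum_a \sum_c X a c ^+ 2 by rewrite exchange_big.
  have : 0 <= \sum_a \sum_c (X a c + X c a) ^+ 2.
    by apply: sumr_ge0 => a _; apply: sumr_ge0 => c _; exact: sqr_ge0.
  have -> : \sum_a \sum_c (X a c + X c a) ^+ 2 =
     \sum_a \sum_c X a c ^+ 2 + 2 * (\sum_a \sum_c X a c * X c a) + \sum_a \sum_c X c a ^+ 2.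
    rewrite mulr_sumr -!big_split; apply: eq_bigr => a _ /=.
    by rewrite mulr_sumr -!big_split; apply: eq_bigr => c _ /=; ring.
  by rewrite E1; lra.
by rewrite /K; move: N2 S1 S2; nra.
Qed.

End variance_bounds.

(** * Interpolation in the orthonormal case *)

Lemma is_derive_sum_seq (R : realType) (I : Type) (r : seq I) (f : I -> R -> R)
    (df : I -> R) (x : R) :
  (forall i, is_derive x 1 (f i) (df i)) ->
  is_derive x 1 (fun y => \sum_(i <- r) f i y) (\sum_(i <- r) df i).
Proof.
move=> fdf; elim: r => [|a r ih].
  by under eq_fun do rewrite big_nil; rewrite big_nil; exact: is_derive_cst.
under eq_fun do rewrite big_cons; rewrite big_cons.
exact: (@is_deriveD _ _ _ (f a)).
Qed.

Section orthonormal_case.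
Variables (R : realType) (n k : nat) (mu : probability (borel 'M[R]_n) R).
Hypotheses (hmu : is_haar_orthogonal mu) (hn : (2 <= n)%N) (hk : (0 < k)%N).
Let D : set (borel 'M[R]_n) := @orthogonal_group R n.
Let E (f : 'M[R]_n -> R) := E_on mu D f.
Let mD : measurable D := @measurable_orthogonal R n.
Let muD : mu D = 1%E := haar_orthogonal1 hmu.

Variable B : 'I_k -> 'M[R]_n.
Hypothesis onB : forall i j, \tr (B i *m (B j)^T) = n%:R * (i == j)%:R.

Definition lin_stat (M : 'M[R]_n) : 'cV[R]_k := \col_i \tr (B i *m M).
Definition lin_comb (a : 'cV[R]_k) : 'M[R]_n := \sum_i a i 0 *: B i.
(* Under Haar measure the entries have mean zero; paired with the Hessian of a
   test function they are the error term of Stein's identity for [lin_stat]. *)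
Definition stein_defect (M : 'M[R]_n) : 'M[R]_k :=
  \matrix_(i, j) ((i == j)%:R - \tr (M *m B i *m M *m B j)).

Lemma dotp_lin_stat a M : dotp a (lin_stat M) = \tr (M *m lin_comb a).
Proof.
rewrite mxtrace_mulC mulmx_suml raddf_sum; apply: eq_bigr => i _ /=.
by rewrite mxE -scalemxAl mxtraceZ.
Qed.

Lemma lin_comb_norm a : \tr (lin_comb a *m (lin_comb a)^T) = n%:R * dotp a a.
Proof.
rewrite mulmx_suml raddf_sum /dotp mulr_sumr; apply: eq_bigr => i _ /=.
rewrite linear_sum mulmx_sumr raddf_sum (bigD1 i)//= big1 ?addr0 => [|j ji].
  by rewrite linearZ/= -scalemxAl -scalemxAr !mxtraceZ onB eqxx mulr1; ring.
by rewrite linearZ/= -scalemxAl -scalemxAr !mxtraceZ onB eq_sym (negbTE ji) !mulr0.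
Qed.

(** A wave with frequency vector [a] sees only the matrix [lin_comb a]; this links the one-matrix
    identity [haar_stein] to the full matrix of errors. *)
Lemma dotp_stein_defect a M : dotp a (stein_defect M *m a) =
  dotp a a - \tr (M *m lin_comb a *m M *m lin_comb a).
Proof.
have -> : \tr (M *m lin_comb a *m M *m lin_comb a) =
    \sum_i \sum_j a i 0 * (a j 0 * \tr (M *m B i *m M *m B j)).
  have trl U : \tr (U *m lin_comb a) = \sum_j a j 0 * \tr (U *m B j).
    rewrite mulmx_sumr raddf_sum; apply: eq_bigr => j _ /=.
    by rewrite -scalemxAr mxtraceZ.
  rewrite trl exchange_big /=; apply: eq_bigr => j _.
  have -> : \tr (M *m lin_comb a *m M *m B j) = \tr (M *m B j *m M *m lin_comb a).
    by rewrite -mulmxA mxtrace_mulC !mulmxA.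
  rewrite trl mulr_sumr; apply: eq_bigr => i _.
  have -> : \tr (M *m B j *m M *m B i) = \tr (M *m B i *m M *m B j).
    by rewrite -mulmxA mxtrace_mulC !mulmxA.
  by rewrite mulrCA.
rewrite /dotp -sumrB; apply: eq_bigr => i _.
rewrite mxE (_ : a i 0 * a i 0 = a i 0 * \sum_j a j 0 * (i == j)%:R); last by rewrite sum_delta.
rewrite !mulr_sumr -sumrB; apply: eq_bigr => j _; rewrite mxE; ring.
Qed.

Lemma stein_defect_variance :
  E (fun M => \sum_i \sum_j stein_defect M i j ^+ 2) <= 2 * k%:R ^+ 2.
Proof.
have g i j : mbounded (fun M => stein_defect M i j ^+ 2).
  apply: mboundedX; under eq_fun do rewrite mxE.
  by apply: mboundedB; [exact: mbounded_cst|exact: mbounded_quadratic].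
rewrite /E (E_on_sum mD muD); last by move=> i; apply: int_on_sum => // j; exact: mbounded_int.
have -> : 2 * k%:R ^+ 2 = \sum_(i < k) \sum_(j < k) 2 :> R.
  by rewrite !sumr_const card_ord -mulrnA -[RHS]mulr_natr natrM expr2.
apply: ler_sum => i _; rewrite (E_on_sum mD muD); last by move=> j; exact: mbounded_int.
apply: ler_sum => j _.
have T i' j' : \tr ((B i')^T *m B j') = n%:R * (i' == j')%:R.
  by rewrite mxtrace_mulC -mxtrace_tr trmx_mul trmxK onB.
have [<-|ij] := eqVneq i j.
  apply: le_trans (haar_variance_diag hmu hn (A := B i) _); last by rewrite T eqxx mulr1.
  rewrite le_eqVlt; apply/orP; left; apply/eqP; apply: eq_E_on => M _.
  by rewrite mxE eqxx.
apply: le_trans (haar_variance_offdiag hmu hn (A := B i) (B := B j) _ _ _);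
  rewrite ?T ?eqxx ?mulr1 ?(negbTE ij) ?mulr0//.
rewrite le_eqVlt; apply/orP; left; apply/eqP; apply: eq_E_on => M _.
by rewrite mxE (negbTE ij) sub0r sqrrN.
Qed.

Context d (T : measurableType d) (P : probability T R).
Variable Z : T -> 'cV[R]_k.
Hypotheses (mZ : forall a, measurable_fun setT (fun t => dotp a (Z t)))
  (nZ : forall a, is_normal P (fun t => dotp a (Z t)))
  (EZ : forall a, E_on P setT (fun t => dotp a (Z t)) = 0)
  (VZ : forall a, E_on P setT (fun t => dotp a (Z t) ^+ 2) = dotp a a).

Variables (s : seq (R * 'cV[R]_k * R)) (l : R).
Hypotheses (l0 : 0 <= l) (sl : forall y v, `|dtrig_poly s y v| <= l * enorm v).

Let N : R := n%:R - 1.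
Let N0 : 0 < N. Proof. by rewrite subr_gt0 ltr1n. Qed.

Let kap (z : R * 'cV[R]_k * R) (x : R) :=
  E (fun M => cos (x * \tr (M *m lin_comb z.1.2) + z.2)).

(** The interpolation between the two laws, with independence built into the formula: given [M], the
    Gaussian part of a wave averages to the exponential factor, so a product of two separate means
    replaces a joint law. *)
Let phi (t : R) :=
  \sum_(z <- s) z.1.1 * (expR (- (sin t ^+ 2 * dotp z.1.2 z.1.2 / 2)) * kap z (cos t)).

(** Shaped as the summand of [gaussian_gradient_bound], with [c = sin t], [x = cos t *: lin_stat M]
    and [H = stein_defect M]. *)
Let term (t : R) (z : R * 'cV[R]_k * R) (M : 'M[R]_n) :=
  z.1.1 * (expR (- (sin t ^+ 2 * dotp z.1.2 z.1.2 / 2)) * sin t *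
    cos (dotp z.1.2 (cos t *: lin_stat M) + z.2) * dotp z.1.2 (stein_defect M *m z.1.2)).

Let termE t z M : term t z M =
  (z.1.1 * expR (- (sin t ^+ 2 * dotp z.1.2 z.1.2 / 2)) * sin t) *
  ((dotp z.1.2 z.1.2 - \tr (M *m lin_comb z.1.2 *m M *m lin_comb z.1.2)) *
   cos (cos t * \tr (M *m lin_comb z.1.2) + z.2)).
Proof. by rewrite /term dotpZr dotp_lin_stat dotp_stein_defect; ring. Qed.

Let mbounded_term t z : mbounded (term t z).
Proof.
rewrite (funext (termE t z)).
apply: mboundedM; first exact: mbounded_cst.
apply: mboundedM; last by apply: mbounded_cos; exact: mbounded_tr_aff.
by apply: mboundedB; [exact: mbounded_cst|exact: mbounded_quadratic].
Qed.

Let dphi (t : R) : is_derive t 1 phi (cos t / N * E (fun M => \sum_(z <- s) term t z M)).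
Proof.
have -> : cos t / N * E (fun M => \sum_(z <- s) term t z M) =
    \sum_(z <- s) cos t / N * E (term t z).
  rewrite /E (E_on_sum mD muD) ?mulr_sumr// => z; exact/mbounded_int/mbounded_term.
apply: is_derive_sum_seq => z.
set A := lin_comb z.1.2; set q := dotp z.1.2 z.1.2.
have gF : mbounded (fun M => \tr (M *m A)) by exact: mbounded_tr.
have gc x : mbounded (fun M => cos (x * \tr (M *m A) + z.2)).
  by apply: mbounded_cos; exact: mbounded_tr_aff.
have gW : mbounded (fun M => \tr (M *m A *m M *m A)) by exact: mbounded_quadratic.
have dk (x : R) : is_derive x (1 : R) (kap z)
    (- (x / N * E (fun M => (n%:R * q - \tr (M *m A *m M *m A)) * cos (x * \tr (M *m A) + z.2)))).
  have Dk := is_derive_haar_cos hmu A x z.2.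
  apply: (@is_derive_eq _ _ _ _ _ _ _ _ Dk).
  congr (- _); have := haar_stein hmu A x z.2; rewrite -/N lin_comb_norm -/q => H.
  by apply: (mulfI (lt0r_neq0 N0)); rewrite [LHS]H [RHS]mulrA [N * (x / N)]mulrC divfK// gt_eqF.
have dkc : is_derive t (1 : R) (kap z \o cos) (- (cos t / N *
     E (fun M => (n%:R * q - \tr (M *m A *m M *m A)) * cos (cos t * \tr (M *m A) + z.2))) * (- sin t)).
  exact: is_derive1_comp.
have de : is_derive t (1 : R) (fun t : R => expR (- (sin t ^+ 2 * q / 2)))
    (- (sin t * cos t * q) * expR (- (sin t ^+ 2 * q / 2))).
  by apply: is_derive_eq; rewrite /GRing.scale/=; field.
have I1 : int_on mu D (fun M => (q - \tr (M *m A *m M *m A)) * cos (cos t * \tr (M *m A) + z.2)).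
  by apply: mbounded_int; apply: mboundedM => //; apply: mboundedB => //; exact: mbounded_cst.
have ET : E (term t z) = z.1.1 * expR (- (sin t ^+ 2 * q / 2)) * sin t *
    E (fun M => (q - \tr (M *m A *m M *m A)) * cos (cos t * \tr (M *m A) + z.2)).
  by rewrite /E -(E_onZ mD)//; apply: eq_E_on => M _; exact: termE.
(* Writing [n q = q + (n - 1) q] separates the defect from a multiple of [kap], which cancels
   exactly the derivative of the Gaussian factor. *)
have EN : E (fun M => (n%:R * q - \tr (M *m A *m M *m A)) * cos (cos t * \tr (M *m A) + z.2)) =
    E (fun M => (q - \tr (M *m A *m M *m A)) * cos (cos t * \tr (M *m A) + z.2)) +
    N * q * kap z (cos t).
  rewrite /kap /E -(E_onZ mD); last exact/mbounded_int/gc.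
  rewrite -(E_onD mD)//; last by apply: int_onZ => //; exact/mbounded_int/gc.
  by apply: eq_E_on => M _; rewrite -/A /N; ring.
rewrite EN in dkc.
have D1 := is_deriveM de dkc.
have D2 := is_deriveZ z.1.1 D1.
have fE : (fun y : R => z.1.1 * (expR (- (sin y ^+ 2 * q / 2)) * kap z (cos y))) =
  (z.1.1 \*: ((fun t : R => expR (- (sin t ^+ 2 * q / 2))) * (kap z \o cos))) by apply/funext.
rewrite fE; apply: (is_derive_eq D2); rewrite /GRing.scale/= ET.
by field; rewrite gt_eqF.
Qed.

(** The best AM-GM parameter: the square root of the bound [2 k^2] on the second moment of the
    defect, for which the two halves in [gaussian_gradient_bound] become equal. *)
Let mu0 : R := k%:R * Num.sqrt 2.
Let mu0_gt0 : 0 < mu0. Proof. by rewrite mulr_gt0 ?ltr0n// sqrtr_gt0. Qed.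

Let phi_bound (t : R) : 0 <= cos t ->
  `|cos t / N * E (fun M => \sum_(z <- s) term t z M)| <= cos t * (l * mu0 / N).
Proof.
move=> ct; rewrite normrM ger0_norm ?divr_ge0 ?(ltW N0)//.
rewrite -[leLHS]mulrA ler_wpM2l// [leLHS]mulrC ler_wpM2r ?invr_ge0 ?(ltW N0)//.
have g i j : mbounded (fun M => stein_defect M i j ^+ 2).
  apply: mboundedX; under eq_fun do rewrite mxE.
  by apply: mboundedB; [exact: mbounded_cst|exact: mbounded_quadratic].
have IS : int_on mu D (fun M => \sum_i \sum_j stein_defect M i j ^+ 2).
  by apply: mbounded_int; apply: mbounded_sum => i; exact: mbounded_sum.
have I1 : int_on mu D (fun M => mu0 + mu0^-1 * \sum_i \sum_j stein_defect M i j ^+ 2).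
  by apply: int_onD => //; [exact: int_on_cst|exact: int_onZ].
have I2 : int_on mu D (fun M => (l / 2) * (mu0 + mu0^-1 * \sum_i \sum_j stein_defect M i j ^+ 2)).
  exact: int_onZ.
apply: (@le_trans _ _ (E (fun M => (l / 2) * (mu0 + mu0^-1 * \sum_i \sum_j stein_defect M i j ^+ 2)))).
  apply: (normr_E_on_le mD) => //.
    by apply: int_on_sum => // z; exact/mbounded_int/mbounded_term.
  move=> M OM; have := gaussian_gradient_bound mZ nZ EZ VZ (stein_defect M) (sin t)
    (cos t *: lin_stat M) l0 mu0_gt0 sl.
  by move=> /le_trans; apply; rewrite le_eqVlt; apply/orP; left; apply/eqP; field; rewrite gt_eqF.
rewrite /E (E_onZ mD)// (E_onD mD); [|exact: int_on_cst|exact: int_onZ].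
rewrite (E_on_cst mD muD) (E_onZ mD)//.
have V := stein_defect_variance.
have mu2 : mu0 ^+ 2 = 2 * k%:R ^+ 2 by rewrite exprMn sqr_sqrtr//; ring.
rewrite -mulrA ler_wpM2l// mulrC ler_pdivrMr// mulr_natr mulr2n lerD2l.
by rewrite ler_pdivrMl// -expr2 mu2.
Qed.

Lemma lin_stat_trig_poly_bound :
  `|E (fun M => trig_poly s (lin_stat M)) - E_on P setT (fun t => trig_poly s (Z t))| <=
  l * (k%:R * Num.sqrt 2) / (n%:R - 1).
Proof.
have phi0 : phi 0 = E (fun M => trig_poly s (lin_stat M)).
  rewrite /phi /E /trig_poly (E_on_sum mD muD); last first.
    move=> z; apply: int_onZ => //; apply: mbounded_int; apply: mbounded_cos.
    under eq_fun do rewrite dotp_lin_stat -[\tr _]mul1r; exact: mbounded_tr_aff.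
  apply: eq_bigr => z _; rewrite (E_onZ mD); last first.
    apply: mbounded_int; apply: mbounded_cos.
    under eq_fun do rewrite dotp_lin_stat -[\tr _]mul1r; exact: mbounded_tr_aff.
  rewrite sin0 expr0n/= !mul0r oppr0 expR0 mul1r cos0; congr (_ * _).
  by apply: eq_E_on => M _; rewrite mul1r dotp_lin_stat.
have phi1 : phi (pi / 2) = E_on P setT (fun t => trig_poly s (Z t)).
  have I z : int_on P setT (fun t => cos (dotp z.1.2 (Z t) + z.2)).
    by apply: int_trig_gaussian; [exact: mZ|exact: continuous_cos|exact: normr_cos_le1].
  have PT : P setT = 1%E by exact: probability_setT.
  rewrite /phi /trig_poly (E_on_sum measurableT PT); last by move=> z; exact: int_onZ.
  apply: eq_bigr => z _; rewrite (E_onZ measurableT)//; congr (_ * _).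
  rewrite (gaussian_cos mZ nZ EZ VZ) sin_pihalf expr1n mul1r cos_pihalf; congr (_ * _).
  rewrite -[RHS](E_on_cst mD muD); apply: eq_E_on => M _.
  by rewrite mul0r add0r.
have pi2 : 0 <= pi / 2 :> R by rewrite divr_ge0// pi_ge0.
set L := l * _ / _.
(* The mean value theorem for [e * phi - L * sin], whose derivative is nonpositive on the quarter
   period, replaces the integration of [phi']; the signs [e = 1] and [e = -1] give the absolute
   value. *)
have key (e : R) : e ^+ 2 = 1 -> e * (phi (pi / 2) - phi 0) <= L.
  move=> e2; pose f (t : R) := e * phi t - L * sin t.
  have df (t : R) : is_derive t (1 : R) f (e * (cos t / N * E (fun M => \sum_(z <- s) term t z M)) - L * cos t).
    have D1 := is_deriveZ e (dphi t).
    have D2 := is_deriveZ L (is_derive_sin t).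
    exact: is_deriveB D1 D2.
  have cf : {within `[0, pi / 2 : R], continuous f}.
    by apply: continuous_subspaceT; exact: is_derive_continuousT df.
  have [c] := MVT_segment pi2 (fun x _ => df x) cf.
  rewrite in_itv/= => /andP[c0 c1].
  rewrite /f sin_pihalf sin0 mulr1 mulr0 subr0 => H.
  have cc : 0 <= cos c by rewrite cos_ge0_pihalf// (le_trans _ c0) ?oppr_le0.
  have e1 : `|e| = 1.
    by apply/eqP; rewrite -(@eqrXn2 _ 2) ?normr_ge0// real_normK ?num_real// e2 expr1n.
  have B1 : `|cos c / N * E (fun M => \sum_(z <- s) term c z M)| <= cos c * L := phi_bound cc.
  have : e * (cos c / N * E (fun M => \sum_(z <- s) term c z M)) <= L * cos c.
    by apply: le_trans (ler_norm _) _; rewrite normrM e1 mul1r [L * _]mulrC.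
  rewrite -subr_le0 => H1; rewrite mulrBr -subr_le0.
  have -> : e * phi (pi / 2) - e * phi 0 - L = e * phi (pi / 2) - L - e * phi 0 by ring.
  by rewrite H mulr_le0_ge0// subr0.
rewrite -phi0 -phi1 distrC ler_norml lerNl.
have := key 1 (expr1n _ _); have := key (-1).
by rewrite sqrrN expr1n mulN1r mul1r => /(_ erefl) -> ->.
Qed.

End orthonormal_case.

(** * Algebra of trigonometric polynomials *)

Section trigonometric_algebra.
Variables (R : realType) (k : nat).
Local Notation trig_poly_data := (seq (R * 'cV[R]_k * R)).
Implicit Types (s : trig_poly_data) (x v u a : 'cV[R]_k).

Lemma enormD x v : enorm (x + v) <= enorm x + enorm v.
Proof.
rewrite -(@ler_pXn2r _ 2) ?nnegrE ?addr_ge0 ?enorm_ge0// sqrrD !sqr_enorm.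
rewrite dotpDl !dotpDr (dotpC v x).
by have := le_trans (ler_norm _) (cauchy_schwarz x v); lra.
Qed.

Lemma trig_poly_bounds s : exists2 K, 0 <= K & forall x v,
  `|trig_poly s (x + v) - trig_poly s x| <= K * enorm v /\
  `|trig_poly s (x + v) - trig_poly s x - dtrig_poly s x v| <= K * enorm v ^+ 2.
Proof.
exists (\sum_(z <- s) `|z.1.1| * (enorm z.1.2 + enorm z.1.2 ^+ 2)) => [|x v].
  by apply: sumr_ge0 => z _; rewrite mulr_ge0// addr_ge0 ?sqr_ge0 ?enorm_ge0.
have B z : `|dotp z v| <= enorm z * enorm v by exact: cauchy_schwarz.
have e0 a := enorm_ge0 a.
split.
  rewrite -sumrB (le_trans (ler_norm_sum _ _ _))// mulr_suml ler_sum// => z _.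
  rewrite -mulrBr normrM -mulrA ler_wpM2l// dotpDr.
  rewrite addrAC (le_trans (cos_lip _ _))// (le_trans (B _))// ler_wpM2r//.
  by rewrite lerDl sqr_ge0.
rewrite /dtrig_poly opprK -sumrB -big_split/= (le_trans (ler_norm_sum _ _ _))// mulr_suml.
rewrite ler_sum// => z _.
rewrite -mulrBr -mulrDr normrM -mulrA ler_wpM2l// dotpDr.
rewrite (_ : _ + _ + z.2 = dotp z.1.2 x + z.2 + dotp z.1.2 v); last by ring.
rewrite [sin _ * _]mulrC (le_trans (cos_taylor1 _ _))//.
rewrite -real_normK ?num_real// (@le_trans _ _ ((enorm z.1.2 * enorm v) ^+ 2))//.
  by rewrite lerXn2r ?nnegrE// mulr_ge0.
by rewrite exprMn ler_wpM2r ?sqr_ge0// lerDr.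
Qed.

Definition trig_poly_translate s (c : R) u : trig_poly_data :=
  [seq (c * z.1.1, z.1.2, z.2 - dotp z.1.2 u) | z <- s].

Lemma trig_poly_translateE s c u x : trig_poly (trig_poly_translate s c u) x = c * trig_poly s (x - u).
Proof.
rewrite /trig_poly big_map mulr_sumr; apply: eq_bigr => z _ /=.
by rewrite dotpDr dotpNr -mulrA; congr (_ * (_ * cos _)); ring.
Qed.

Lemma dtrig_poly_translateE s c u x v : dtrig_poly (trig_poly_translate s c u) x v = c * dtrig_poly s (x - u) v.
Proof.
rewrite /dtrig_poly big_map mulrN mulr_sumr; congr (- _); apply: eq_bigr => z _ /=.
by rewrite dotpDr dotpNr -mulrA; congr (_ * (_ * (sin _ * _))); ring.
Qed.

Definition trig_poly_dilate s (e : R) : trig_poly_data := [seq (z.1.1, e *: z.1.2, z.2) | z <- s].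

Lemma trig_poly_dilateE s e x : trig_poly (trig_poly_dilate s e) x = trig_poly s (e *: x).
Proof. by rewrite /trig_poly big_map; apply: eq_bigr => z _ /=; rewrite dotpZl dotpZr. Qed.

Lemma dtrig_poly_dilateE s e x v : dtrig_poly (trig_poly_dilate s e) x v = dtrig_poly s (e *: x) (e *: v).
Proof.
by rewrite /dtrig_poly big_map; congr (- _); apply: eq_bigr => z _ /=; rewrite !dotpZl !dotpZr.
Qed.

Lemma trig_poly_flatten (ss : seq trig_poly_data) x : trig_poly (flatten ss) x = \sum_(s <- ss) trig_poly s x.
Proof. by rewrite /trig_poly big_flatten. Qed.

Lemma dtrig_poly_flatten (ss : seq trig_poly_data) x v : dtrig_poly (flatten ss) x v = \sum_(s <- ss) dtrig_poly s x v.
Proof. by rewrite /dtrig_poly big_flatten/= sumrN. Qed.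

Definition is_trig_poly (f : 'cV[R]_k -> R) := exists s, forall x, trig_poly s x = f x.

Lemma is_trig_poly_cst (c : R) : is_trig_poly (fun=> c).
Proof.
exists [:: (c, 0, 0)] => x.
by rewrite /trig_poly big_seq1/= dotp0l addr0 cos0 mulr1.
Qed.

Lemma is_trig_poly_cos_coord (i : 'I_k) : is_trig_poly (fun x => cos (x i 0)).
Proof.
exists [:: (1, delta_mx i 0, 0)] => x.
rewrite /trig_poly big_seq1/= mul1r addr0; congr cos.
by rewrite dotpE trmx_delta -rowE mxE.
Qed.

Lemma is_trig_polyD f g : is_trig_poly f -> is_trig_poly g -> is_trig_poly (fun x => f x + g x).
Proof. by move=> [s sf] [t tg]; exists (s ++ t) => x; rewrite /trig_poly big_cat/= -sf -tg. Qed.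

Lemma is_trig_polyM f g : is_trig_poly f -> is_trig_poly g -> is_trig_poly (fun x => f x * g x).
Proof.
move=> [s sf] [t tg].
pose p (z z' : R * 'cV[R]_k * R) : trig_poly_data :=
  [:: (z.1.1 * z'.1.1 / 2, z.1.2 + z'.1.2, z.2 + z'.2);
      (z.1.1 * z'.1.1 / 2, z.1.2 - z'.1.2, z.2 - z'.2)].
exists (flatten [seq flatten [seq p z z' | z' <- t] | z <- s]) => x.
rewrite trig_poly_flatten big_map -sf -tg mulr_suml; apply: eq_bigr => z _.
rewrite trig_poly_flatten big_map mulr_sumr; apply: eq_bigr => z' _.
rewrite /trig_poly big_cons big_seq1/= !dotpDl dotpNl.
set a := dotp _ _; set b := dotp _ _.
rewrite (_ : a + b + (z.2 + z'.2) = (a + z.2) + (b + z'.2)); last by ring.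
rewrite (_ : a - b + (z.2 - z'.2) = (a + z.2) - (b + z'.2)); last by ring.
by rewrite cosD cosB; field.
Qed.

Lemma is_trig_polyX f (N : nat) : is_trig_poly f -> is_trig_poly (fun x => f x ^+ N).
Proof.
move=> tf; elim: N => [|N ih].
  by under eq_fun do rewrite expr0; exact: is_trig_poly_cst.
by under eq_fun do rewrite exprS; exact: is_trig_polyM.
Qed.

Lemma is_trig_poly_prod (I : Type) (r : seq I) (f : I -> 'cV[R]_k -> R) :
  (forall i, is_trig_poly (f i)) -> is_trig_poly (fun x => \prod_(i <- r) f i x).
Proof.
move=> tf; elim: r => [|a r ih].
  by under eq_fun do rewrite big_nil; exact: is_trig_poly_cst.
by under eq_fun do rewrite big_cons; exact: is_trig_polyM.
Qed.

End trigonometric_algebra.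

(** * The de la Vallee-Poussin kernel on equidistant nodes *)

Section vallee_poussin_kernel.
Variable R : realType.
Implicit Types (t u : R) (N m l r : nat).

Definition node m l : R := pi *+ 2 * l%:R / m%:R.

(** Multiplied by the sine of half the step, the sum telescopes over a whole number of periods;
    [0 < j < m] keeps that sine away from 0. *)
Lemma sum_cos_nodes m j t : (0 < j < m)%N -> \sum_(l < m) cos (t - j%:R * node m l) = 0.
Proof.
move=> /andP[j0 jm]; have m0 : (0 < m)%N by exact: ltn_trans jm.
have mR : (m%:R : R) != 0 by rewrite pnatr_eq0 -lt0n.
set h : R := pi * j%:R / m%:R.
have sh : sin h != 0.
  rewrite gt_eqF// sin_gt0_pi// divr_gt0 ?mulr_gt0 ?pi_gt0 ?ltr0n//=.
  by rewrite ltr_pdivrMr ?ltr0n// ltr_pM2l ?pi_gt0// ltr_nat.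
pose S (l : nat) := sin (t + h - 2 * h * l%:R).
apply: (mulfI sh); rewrite mulr0 mulr_sumr.
have -> : \sum_(l < m) sin h * cos (t - j%:R * node m l) =
    \sum_(0 <= l < m) (2^-1 * S l - 2^-1 * S l.+1).
  rewrite big_mkord; apply: eq_bigr => l _; rewrite -mulrBr /S.
  rewrite (_ : t - j%:R * node m l = t - 2 * h * l%:R); last first.
    by rewrite /node /h; field.
  set x := t - _.
  rewrite (_ : t + h - 2 * h * l%:R = x + h); last by rewrite /x; ring.
  rewrite (_ : t + h - 2 * h * l.+1%:R = x - h); last by rewrite /x -natr1; ring.
  by rewrite sinD sinB; field.
have tel := @telescope_sumr R 0 m (fun l => - (2^-1 * S l)) (leq0n _).
under [in LHS]eq_bigr do rewrite addrC -[X in _ + X]opprK.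
rewrite [LHS]tel opprK /S mulr0 subr0.
rewrite (_ : t + h - 2 * h * m%:R = t + h - pi *+ 2 *+ j); last first.
  have -> : pi *+ 2 *+ j = pi * 2 * j%:R :> R.
    by rewrite -[LHS]mulr_natr -[pi *+ 2]mulr_natr.
  by rewrite /h; field.
rewrite -[X in _ + 2^-1 * sin X](subrK (pi *+ 2 *+ j)) (periodicn (@sinD2pi R)).
by rewrite addrC subrr.
Qed.

(** The binomial formula for the sum of [exp (i u)] and [exp (- i u)], in real form. *)
Lemma expr_2cos N u : (2 * cos u) ^+ N = \sum_(r < N.+1) 'C(N, r)%:R * cos ((N%:R - 2 * r%:R) * u).
Proof.
elim: N => [|N ih].
  by rewrite expr0 big_ord_recl big_ord0 bin0 addr0 mul1r mulr0 subr0 mul0r cos0.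
rewrite exprSr ih mulr_suml.
pose g (r : nat) := cos ((N.+1%:R - 2 * r%:R) * u).
have step (r : nat) : 'C(N, r)%:R * cos ((N%:R - 2 * r%:R) * u) * (2 * cos u) =
    'C(N, r)%:R * g r + 'C(N, r)%:R * g r.+1.
  rewrite /g -[N.+1%:R]natr1 -[r.+1%:R]natr1.
  rewrite (_ : (N%:R + 1 - 2 * r%:R) * u = (N%:R - 2 * r%:R) * u + u); last by ring.
  rewrite (_ : (N%:R + 1 - 2 * (r%:R + 1)) * u = (N%:R - 2 * r%:R) * u - u); last by ring.
  by rewrite cosD cosB; ring.
under eq_bigr do rewrite step.
rewrite big_split/= [RHS]big_ord_recl/= bin0.
have -> : \sum_(i < N.+1) 'C(N, i)%:R * g i = g 0 + \sum_(i < N.+1) 'C(N, i.+1)%:R * g i.+1.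
  rewrite big_ord_recl bin0 mul1r; congr (_ + _).
  by rewrite [RHS]big_ord_recr/= bin_small// mul0r addr0.
rewrite mul1r -addrA; congr (_ + _); rewrite -big_split/=; apply: eq_bigr => i _.
by rewrite binS natrD mulrDl.
Qed.

(** The mean of [(1 + cos x) ^+ N] over a period. *)
Definition vp_mass N : R := 'C(N.*2, N)%:R / 2 ^+ N.

Lemma vp_massS N : vp_mass N.+1 * (N%:R + 1) = vp_mass N * (2 * N%:R + 1).
Proof.
have H : ('C(N.+1.*2, N.+1) * N.+1 = 2 * (N.*2.+1 * 'C(N.*2, N)))%N.
  have H1 := mul_bin_diag N.+1.*2 N; have H2 := mul_bin_down N.*2.+1 N.
  rewrite doubleS/= in H1; rewrite /= -addnn subSn ?leq_addr// addnK addnn in H2.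
  rewrite mulnC -[X in (X * _)%N]/(N.+1) doubleS -H1 H2.
  by rewrite (_ : N.*2.+2 = 2 * N.+1)%N ?mulnA// -doubleS -mul2n.
have HR : ('C(N.+1.*2, N.+1))%:R * (N%:R + 1) = 2 * ((2 * N%:R + 1) * 'C(N.*2, N)%:R) :> R.
  have E2 : (N.*2.+1)%:R = 2 * N%:R + 1 :> R by rewrite -natr1 -mul2n natrM.
  by rewrite natr1 -natrM H !natrM E2.
rewrite /vp_mass mulrAC HR exprS.
by field; rewrite expf_neq0.
Qed.

Lemma vp_mass_ge1 N : 1 <= vp_mass N.
Proof.
elim: N => [|N ih]; first by rewrite /vp_mass bin0 expr0 divr1.
have N0 : 0 <= N%:R :> R by rewrite ler0n.
have := vp_massS N; nra.
Qed.

(** Equidistant quadrature is exact below degree [m]. By the half-angle formula the kernel is a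
    power of [2 * cos (x / 2)]; its frequencies [N - r] are at most [N < m] in absolute value, so
    only the constant term survives. *)
Lemma sum_vp_nodes N m t : (N < m)%N ->
  \sum_(l < m) (1 + cos (t - node m l)) ^+ N = m%:R * vp_mass N.
Proof.
move=> Nm; have m0 : (0 < m)%N by exact: leq_ltn_trans Nm.
have half (x : R) : 2 ^+ N * (1 + cos x) ^+ N =
    \sum_(r < N.*2.+1) 'C(N.*2, r)%:R * cos ((N%:R - r%:R) * x).
  have -> : 2 ^+ N * (1 + cos x) ^+ N = (2 * cos (x / 2)) ^+ N.*2.
    rewrite -mul2n exprM -exprMn; congr (_ ^+ _).
    have -> : cos x = cos (x / 2 + x / 2) by rewrite -splitr.
    by rewrite cosD -!expr2 sin2cos2; ring.
  rewrite expr_2cos; apply: eq_bigr => r _; congr (_ * cos _).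
  have -> : (N.*2)%:R = 2 * N%:R :> R by rewrite -mul2n natrM.
  by field.
have p2 : (2 ^+ N : R) != 0 by rewrite expf_neq0.
apply: (mulfI p2); rewrite mulr_sumr.
under eq_bigr do rewrite half.
rewrite exchange_big/=.
have NN : (N < N.*2.+1)%N by rewrite ltnS -addnn leq_addr.
rewrite (bigD1 (Ordinal NN))//= [X in _ + X]big1 ?addr0 => [|r rN].
  under eq_bigr do rewrite subrr mul0r cos0 mulr1.
  by rewrite sumr_const card_ord -[LHS]mulr_natl /vp_mass; field.
rewrite -mulr_sumr.
have rN' : nat_of_ord r != N by apply: contra_neq rN => rN; apply: val_inj.
rewrite (_ : \sum_(i < m) _ = 0) ?mulr0//.
case: (ltngtP N r) rN' => // Nr _.
  have lt : (0 < r - N < m)%N.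
    rewrite subn_gt0 Nr/= (leq_ltn_trans _ Nm)// leq_subLR addnn -ltnS; exact: ltn_ord.
  rewrite -[RHS](sum_cos_nodes ((r - N)%:R * t) lt); apply: eq_bigr => l _.
  by rewrite -cosN natrB ?(ltnW Nr)//; congr cos; ring.
have lt : (0 < N - r < m)%N.
  by rewrite subn_gt0 Nr/= (leq_ltn_trans _ Nm)// leq_subr.
rewrite -[RHS](sum_cos_nodes ((N - r)%:R * t) lt); apply: eq_bigr => l _.
by rewrite natrB ?(ltnW Nr)//; congr cos; ring.
Qed.

(** Since [1 - cos = 2 - (1 + cos)], this is [2 * vp_mass N - vp_mass N.+1] per node, and the ratio
    [(2 N + 1) / (N + 1)] of consecutive masses leaves [vp_mass N / (N + 1)]: the kernel
    concentrates as [N] grows. *)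
Lemma sum_vp_nodes_moment N m t : (N.+1 < m)%N ->
  \sum_(l < m) (1 + cos (t - node m l)) ^+ N * (1 - cos (t - node m l)) =
  m%:R * vp_mass N / (N%:R + 1).
Proof.
move=> Nm; have N1 : N%:R + 1 != 0 :> R by rewrite gt_eqF// ltr_wpDl.
have -> : \sum_(l < m) (1 + cos (t - node m l)) ^+ N * (1 - cos (t - node m l)) =
  2 * \sum_(l < m) (1 + cos (t - node m l)) ^+ N - \sum_(l < m) (1 + cos (t - node m l)) ^+ N.+1.
  by rewrite mulr_sumr -sumrB; apply: eq_bigr => l _; rewrite exprS; ring.
rewrite !sum_vp_nodes ?(ltnW Nm)//.
by apply: (mulIf N1); rewrite divfK// mulrBl -[m%:R * vp_mass N.+1 * _]mulrA vp_massS; ring.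
Qed.

End vallee_poussin_kernel.

(** * Approximation of Lipschitz functions by trigonometric polynomials *)

Lemma enorm_le_coord (R : realType) (k : nat) (x y : 'cV[R]_k) :
  (forall i, `|x i 0| <= `|y i 0|) -> enorm x <= enorm y.
Proof.
move=> xy; apply: ler_wsqrtr; apply: ler_sum => i _.
by rewrite -!expr2 -[leLHS]real_normK ?num_real// -[leRHS]real_normK ?num_real// lerXn2r ?nnegrE.
Qed.

Section grid_approximation.
Variables (R : realType) (k : nat) (g : 'cV[R]_k -> R) (lam L : R) (N m : nat).
Hypotheses (lam0 : 0 <= lam) (L0 : 0 < L) (Nm : (N < m)%N)
  (glip : forall x y, `|g x - g y| <= lam * enorm (x - y)).
Local Notation J := {ffun 'I_k -> 'I_m.+1}.
Implicit Types (x y v w : 'cV[R]_k) (j : J).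

Definition grid_point j : 'cV[R]_k := \col_i node R m.+1 (j i).
(** At [y = x / L] the argument of [g] is close to [x] for large [L], and its derivative in [x]
    never exceeds 1: periodicity is gained without enlarging the Lipschitz constant. *)
Definition periodized y : R := g (\col_i (L * sin (y i 0))).
Definition kernel y : R := \prod_i (1 + cos (y i 0)) ^+ N.
Definition kernel_mass : R := (m.+1%:R * vp_mass R N) ^+ k.
(** A discrete convolution: the weights are nonnegative and sum to 1 at every [y], yet the result is
    a finite sum of translates of one trigonometric polynomial. *)
Definition grid_approx y : R :=
  \sum_j periodized (grid_point j) * (kernel (y - grid_point j) / kernel_mass).

Lemma kernel_ge0 y : 0 <= kernel y.
Proof.
apply: prodr_ge0 => i _; apply: exprn_ge0.
by rewrite -lerBlDl sub0r cos_geN1.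
Qed.

Let mass1_gt0 : 0 < m.+1%:R * vp_mass R N.
Proof. by rewrite mulr_gt0// ?ltr0n// (lt_le_trans ltr01)// vp_mass_ge1. Qed.

Lemma kernel_mass_gt0 : 0 < kernel_mass. Proof. exact: exprn_gt0. Qed.

Lemma sum_kernel y : \sum_j kernel (y - grid_point j) = kernel_mass.
Proof.
transitivity (\prod_(i < k) \sum_(l < m.+1) (1 + cos (y i 0 - node R m.+1 l)) ^+ N).
  rewrite bigA_distr_bigA/=; apply: eq_bigr => j _; apply: eq_bigr => i _.
  by rewrite !mxE.
rewrite (eq_bigr (fun=> m.+1%:R * vp_mass R N)) ?prodr_const ?card_ord// => i _.
by apply: sum_vp_nodes; exact: (ltnW Nm).
Qed.

Lemma sum_kernel_moment y (i : 'I_k) :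
  \sum_j kernel (y - grid_point j) * (1 - cos (y i 0 - grid_point j i 0)) =
  kernel_mass / (N%:R + 1).
Proof.
pose F (i' : 'I_k) (l : 'I_m.+1) : R := (1 + cos (y i' 0 - node R m.+1 l)) ^+ N *
  (if i' == i then 1 - cos (y i' 0 - node R m.+1 l) else 1).
transitivity (\prod_(i' < k) \sum_(l < m.+1) F i' l).
  rewrite bigA_distr_bigA/=; apply: eq_bigr => j _.
  rewrite /F big_split/=; congr (_ * _).
    by apply: eq_bigr => i' _; rewrite !mxE.
  by rewrite -big_mkcond big_pred1_eq mxE.
rewrite (bigD1 i)//= /F eqxx sum_vp_nodes_moment//.
rewrite [X in _ * X](eq_bigr (fun=> m.+1%:R * vp_mass R N)); last first.
  move=> i' /negbTE ni; under eq_bigr do rewrite ni mulr1.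
  by apply: sum_vp_nodes; exact: (ltnW Nm).
have -> : kernel_mass = \prod_(i' < k) (m.+1%:R * vp_mass R N).
  by rewrite prodr_const card_ord.
by rewrite [in RHS](bigD1 i)//= [LHS]mulrAC.
Qed.

Lemma periodized_sin_lip y y' : `|periodized y - periodized y'| <=
  lam * L * enorm (\col_i (sin (y i 0) - sin (y' i 0))).
Proof.
rewrite (le_trans (glip _ _))// -mulrA ler_wpM2l//.
rewrite (_ : _ - _ = L *: \col_i (sin (y i 0) - sin (y' i 0))).
  by rewrite enormZ gtr0_norm.
by apply/colP => i; rewrite !mxE mulrBr.
Qed.

Lemma periodized_lip y y' : `|periodized y - periodized y'| <= lam * L * enorm (y - y').
Proof.
rewrite (le_trans (periodized_sin_lip _ _))// ler_wpM2l ?mulr_ge0 ?(ltW L0)//.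
apply: enorm_le_coord => i; rewrite !mxE.
by have := sin_lip (y' i 0) (y i 0 - y' i 0); rewrite subrKC.
Qed.

(** The right side is the squared chord between two points of the unit circle. In this form the
    error is measured by the kernel moment. *)
Lemma sqr_sinB_le (a b : R) : (sin a - sin b) ^+ 2 <= 2 * (1 - cos (a - b)).
Proof.
rewrite cosB -subr_ge0.
have -> : 2 * (1 - (cos a * cos b + sin a * sin b)) - (sin a - sin b) ^+ 2 = (cos a - cos b) ^+ 2.
  have := cos2Dsin2 a; have := cos2Dsin2 b; lra.
exact: sqr_ge0.
Qed.

Lemma grid_approx_close y (mu : R) : 0 < mu ->
  `|grid_approx y - periodized y| <=
  lam * L * ((mu + 2 * k%:R / (N%:R + 1) / mu) / 2).
Proof.
move=> mu0; have K0 := kernel_mass_gt0.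
have N1 : N%:R + 1 != 0 :> R by rewrite gt_eqF// ltr_wpDl.
have w0 j : 0 <= kernel (y - grid_point j) / kernel_mass.
  by rewrite divr_ge0 ?kernel_ge0 ?(ltW K0).
have w1 : \sum_j kernel (y - grid_point j) / kernel_mass = 1.
  by rewrite -mulr_suml sum_kernel divff// gt_eqF.
have -> : grid_approx y - periodized y = \sum_j
    (periodized (grid_point j) - periodized y) * (kernel (y - grid_point j) / kernel_mass).
  rewrite -[X in _ - X]mulr1 -w1 mulr_sumr -sumrB.
  by apply: eq_bigr => j _; rewrite mulrBl.
rewrite (le_trans (ler_norm_sum _ _ _))//.
pose e j := \sum_i 2 * (1 - cos (y i 0 - grid_point j i 0)).
apply: (@le_trans _ _ (\sum_j (lam * L * ((mu + e j / mu) / 2)) *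
    (kernel (y - grid_point j) / kernel_mass))).
  apply: ler_sum => j _; rewrite normrM (ger0_norm (w0 j)) ler_wpM2r//.
  rewrite (le_trans (periodized_sin_lip _ _))// ler_wpM2l ?mulr_ge0 ?(ltW L0)//.
  set x := \col_i _; have xe : enorm x ^+ 2 <= e j.
    rewrite sqr_enorm; apply: ler_sum => i _; rewrite -expr2 mxE.
    by rewrite -sqrrN opprB sqr_sinB_le.
  have H : 0 <= (mu - enorm x) ^+ 2 by exact: sqr_ge0.
  rewrite -(ler_pM2l mu0) (_ : mu * ((mu + e j / mu) / 2) = (mu ^+ 2 + e j) / 2).
    by rewrite ler_pdivlMr//; move: H; rewrite sqrrB; lra.
  by field; rewrite gt_eqF.
have e1 : \sum_j e j * (kernel (y - grid_point j) / kernel_mass) = 2 * k%:R / (N%:R + 1).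
  transitivity (\sum_(i < k) 2 / (N%:R + 1) : R); last first.
    by rewrite sumr_const card_ord -[LHS]mulr_natr mulrAC.
  under eq_bigr do rewrite mulr_suml.
  rewrite exchange_big/=; apply: eq_bigr => i _.
  transitivity (2 / kernel_mass *
      \sum_j kernel (y - grid_point j) * (1 - cos (y i 0 - grid_point j i 0))).
    by rewrite mulr_sumr; apply: eq_bigr => j _; ring.
  by rewrite sum_kernel_moment; field; rewrite N1 gt_eqF.
rewrite le_eqVlt; apply/orP; left; apply/eqP.
rewrite -e1 -[X in (X + _) / 2]mulr1 -w1 mulr_sumr !mulr_suml -big_split/= mulr_suml mulr_sumr.
by apply: eq_bigr => j _; ring.
Qed.

Definition lattice (r : 'I_k -> nat) : 'cV[R]_k := \col_i node R m.+1 (r i).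

Let mod_node (a : nat) : exists p : nat, node R m.+1 a = node R m.+1 (a %% m.+1) + pi *+ 2 *+ p.
Proof.
exists (a %/ m.+1)%N; rewrite /node {1}(divn_eq a m.+1) natrD natrM.
have -> : pi *+ 2 *+ (a %/ m.+1) = pi *+ 2 * (a %/ m.+1)%:R :> R by rewrite mulr_natr.
by field.
Qed.

Lemma sin_node_mod (t : R) (a : nat) : sin (t + node R m.+1 (a %% m.+1)) = sin (t + node R m.+1 a).
Proof. by have [p ->] := mod_node a; rewrite addrA (periodicn (@sinD2pi R)). Qed.

Lemma cos_node_mod (t : R) (a : nat) : cos (t - node R m.+1 (a %% m.+1)) = cos (t - node R m.+1 a).
Proof.
have [p ->] := mod_node a.
by rewrite -[RHS](periodicn (@cosD2pi R) p) opprD addrA subrK.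
Qed.

(** A lattice shift permutes the grid modulo the period, so it moves from the kernel to
    [periodized]. Lattice increments therefore inherit the Lipschitz constant of [periodized]
    without loss, whatever the kernel. *)
Lemma grid_approx_translate y (r : 'I_k -> nat) :
  grid_approx (y + lattice r) = \sum_j periodized (grid_point j + lattice r) *
    (kernel (y - grid_point j) / kernel_mass).
Proof.
pose h : J := [ffun i => inord (r i %% m.+1)].
pose sh (j : J) : J := [ffun i => inord ((j i + r i) %% m.+1)].
pose hs (j : J) : J := [ffun i => inord ((j i + (m.+1 - r i %% m.+1)) %% m.+1)].
have modlt a : (a %% m.+1 < m.+1)%N by rewrite ltn_mod.
have shK : cancel sh hs.
  move=> j; apply/ffunP => i; rewrite !ffunE; apply: val_inj; rewrite /= !inordK ?modlt//.
  rewrite modnDml -addnA -[(r i + _)%N]addnC.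
  rewrite -modnDmr -[X in (j i + X)%N]modnDmr subnK ?(ltnW (modlt _))// modnn addn0.
  exact/modn_small/ltn_ord.
rewrite /grid_approx (reindex_inj (can_inj shK))/=; apply: eq_bigr => j _.
have nd i : grid_point (sh j) i 0 = node R m.+1 ((j i + r i) %% m.+1).
  by rewrite !mxE ffunE inordK.
have nD a b : node R m.+1 (a + b) = node R m.+1 a + node R m.+1 b.
  by rewrite /node natrD mulrDr mulrDl.
congr (_ * (_ / _)).
  congr g; apply/colP => i; rewrite mxE nd mxE.
  have := sin_node_mod 0 (j i + r i); rewrite !add0r => ->.
  by rewrite !mxE nD.
apply: eq_bigr => i _; congr ((1 + _) ^+ _).
rewrite [in LHS]mxE [X in _ + X]mxE nd cos_node_mod nD !mxE; congr cos; ring.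
Qed.

Lemma grid_approx_lattice_lip y (r r' : 'I_k -> nat) :
  `|grid_approx (y + lattice r) - grid_approx (y + lattice r')| <=
  lam * L * enorm (lattice r - lattice r').
Proof.
rewrite !grid_approx_translate -sumrB (le_trans (ler_norm_sum _ _ _))//.
have K0 := kernel_mass_gt0.
have w1 : \sum_j kernel (y - grid_point j) / kernel_mass = 1.
  by rewrite -mulr_suml sum_kernel divff// gt_eqF.
rewrite -[leRHS]mulr1 -w1 mulr_sumr; apply: ler_sum => j _.
rewrite -mulrBl normrM [X in _ * X]ger0_norm ?divr_ge0 ?kernel_ge0 ?(ltW K0)//.
rewrite ler_wpM2r ?divr_ge0 ?kernel_ge0 ?(ltW K0)//.
by rewrite (le_trans (periodized_lip _ _))// opprD addrACA subrr add0r.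
Qed.

Variable s0 : seq (R * 'cV[R]_k * R).
Hypothesis s0E : forall y, trig_poly s0 y = kernel y.

Definition grid_trig_poly : seq (R * 'cV[R]_k * R) :=
  flatten [seq trig_poly_translate s0 (periodized (grid_point j) / kernel_mass) (grid_point j) | j <- (index_enum _ : seq J)].

Lemma grid_trig_polyE y : trig_poly grid_trig_poly y = grid_approx y.
Proof.
rewrite /grid_trig_poly trig_poly_flatten big_map /grid_approx; apply: eq_bigr => j _.
by rewrite trig_poly_translateE s0E; ring.
Qed.

Lemma dgrid_trig_polyE y v : dtrig_poly grid_trig_poly y v =
  \sum_j periodized (grid_point j) / kernel_mass * dtrig_poly s0 (y - grid_point j) v.
Proof.
rewrite /grid_trig_poly dtrig_poly_flatten big_map; apply: eq_bigr => j _.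
exact: dtrig_poly_translateE.
Qed.

Let Gam := `|g 0| + lam * (L * k%:R).

Lemma periodized_bound y : `|periodized y| <= Gam.
Proof.
rewrite -[periodized y](subrK (g 0)) (le_trans (ler_normD _ _))// addrC lerD//.
rewrite (le_trans (glip _ _))// ler_wpM2l// subr0 (le_trans (enorm_le_sum _))//.
have -> : L * k%:R = \sum_(i < k) L by rewrite sumr_const card_ord mulr_natr.
by apply: ler_sum => i _; rewrite mxE normrM gtr0_norm// ler_piMr ?normr_sin_le1// ltW.
Qed.

Variable K : R.
Hypotheses (K0 : 0 <= K) (s0K : forall x v,
  `|trig_poly s0 (x + v) - trig_poly s0 x| <= K * enorm v /\
  `|trig_poly s0 (x + v) - trig_poly s0 x - dtrig_poly s0 x v| <= K * enorm v ^+ 2).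

(* The bound does not involve the mesh: the weights sum to at most [Gam]. *)
Lemma grid_trig_poly_bounds y v :
  `|trig_poly grid_trig_poly (y + v) - trig_poly grid_trig_poly y| <= Gam * K * enorm v /\
  `|trig_poly grid_trig_poly (y + v) - trig_poly grid_trig_poly y - dtrig_poly grid_trig_poly y v| <= Gam * K * enorm v ^+ 2.
Proof.
have KM := kernel_mass_gt0; have G0 : 0 <= Gam by exact: le_trans (periodized_bound 0).
have sumw (f : J -> R) (b : R) : 0 <= b -> (forall j, `|f j| <= b) ->
    `|\sum_j periodized (grid_point j) / kernel_mass * f j| <= Gam * b.
  move=> b0 fb; rewrite (le_trans (ler_norm_sum _ _ _))//.
  apply: (@le_trans _ _ (\sum_(j : J) Gam * b / kernel_mass)).
    apply: ler_sum => j _; rewrite !normrM normfV (gtr0_norm KM) mulrAC.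
    by rewrite ler_wpM2r ?invr_ge0 ?(ltW KM)// ler_pM// periodized_bound.
  rewrite sumr_const -mulr_natr -mulrA ler_piMr ?mulr_ge0// mulrC.
  rewrite ler_pdivrMr// mul1r /kernel_mass card_ffun !card_ord natrX.
  rewrite lerXn2r ?nnegrE ?(ltW mass1_gt0)//.
  by rewrite ler_peMr// vp_mass_ge1.
have dE : trig_poly grid_trig_poly (y + v) - trig_poly grid_trig_poly y = \sum_j periodized (grid_point j) / kernel_mass *
    (trig_poly s0 (y - grid_point j + v) - trig_poly s0 (y - grid_point j)).
  rewrite !grid_trig_polyE -sumrB; apply: eq_bigr => j _; rewrite !s0E.
  by rewrite addrAC; ring.
split.
  rewrite dE -mulrA; apply: sumw; first by rewrite mulr_ge0 ?enorm_ge0.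
  by move=> j; have [] := s0K (y - grid_point j) v.
rewrite dE dgrid_trig_polyE -sumrB -mulrA.
have -> : \sum_j (periodized (grid_point j) / kernel_mass *
     (trig_poly s0 (y - grid_point j + v) - trig_poly s0 (y - grid_point j)) -
     periodized (grid_point j) / kernel_mass * dtrig_poly s0 (y - grid_point j) v) =
  \sum_j periodized (grid_point j) / kernel_mass *
     (trig_poly s0 (y - grid_point j + v) - trig_poly s0 (y - grid_point j) - dtrig_poly s0 (y - grid_point j) v).
  by apply: eq_bigr => j _; rewrite -mulrBr.
apply: sumw; first by rewrite mulr_ge0 ?sqr_ge0.
by move=> j; have [] := s0K (y - grid_point j) v.
Qed.

(** Indices are natural numbers, so a coordinate of either sign calls for a difference of two
    lattice points. Rounding costs at most one mesh per coordinate. *)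
Lemma lattice_approx (v : 'cV[R]_k) : exists r r' : 'I_k -> nat,
  enorm (lattice r - lattice r' - v) <= pi *+ 2 * k%:R / m.+1%:R.
Proof.
pose c : R := pi *+ 2 / m.+1%:R.
have c0 : 0 < c by rewrite divr_gt0 ?ltr0n// mulrn_wgt0// pi_gt0.
have nE l : node R m.+1 l = c * l%:R by rewrite /node /c mulrAC.
have P (u : R) : 0 <= u -> exists l : nat, `|c * l%:R - u| <= c.
  move=> u0; exists (Num.truncn (u / c)).
  have /andP[H1 H2] := truncn_itv (divr_ge0 u0 (ltW c0)).
  set l : nat := Num.truncn _ in H1 H2 *.
  have H3 : c * l%:R <= u by rewrite mulrC -ler_pdivlMr.
  have H4 : u < c * l.+1%:R by rewrite mulrC -ltr_pdivrMr.
  move: H4; rewrite -natr1 mulrDr mulr1 => H4.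
  by rewrite ler_norml; apply/andP; split; lra.
have Q (u : R) : exists lr : nat * nat, `|c * lr.1%:R - c * lr.2%:R - u| <= c.
  have [u0|u0] := leP 0 u.
    by have [l Hl] := P _ u0; exists (l, 0); rewrite /= mulr0 subr0.
  have [|l Hl] := P (- u); first by rewrite oppr_ge0 ltW.
  by exists (0, l); rewrite /= mulr0 sub0r -opprD normrN -[X in _ + X]opprK.
have [f fP] := choice (fun i : 'I_k => Q (v i 0)).
exists (fun i => (f i).1), (fun i => (f i).2).
rewrite (le_trans (enorm_le_sum _))//.
have -> : pi *+ 2 * k%:R / m.+1%:R = \sum_(i < k) c.
  by rewrite sumr_const card_ord -[RHS]mulr_natr /c mulrAC.
by apply: ler_sum => i _; rewrite !mxE !nE.
Qed.

(** The increment along [h *: v] is compared with that along a nearby lattice vector, where the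
    sharp constant holds. Rounding costs a multiple of the mesh and the Taylor remainder a multiple
    of [h ^+ 2]; dividing by [h] gives the bound, useful for small [h] and a mesh much smaller than
    [h]. *)
Lemma grid_trig_poly_gradient y v (h : R) : 0 < h -> enorm v = 1 ->
  `|dtrig_poly grid_trig_poly y v| <= lam * L + Gam * K * h +
     (lam * L + Gam * K) * (pi *+ 2 * k%:R / m.+1%:R) / h.
Proof.
move=> h0 v1; set eta := pi *+ 2 * _ / _.
have [r [r' Hr]] := lattice_approx (h *: v).
set w := lattice r - lattice r' in Hr.
have lamL : 0 <= lam * L by rewrite mulr_ge0// ltW.
have G0 : 0 <= Gam by exact: le_trans (periodized_bound 0).
have hv : enorm (h *: v) = h by rewrite enormZ v1 mulr1 gtr0_norm.
have ew : enorm w <= h + eta.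
  rewrite -[w](subrK (h *: v)) addrC (le_trans (enormD _ _))// hv lerD2l//.
have B1 : `|trig_poly grid_trig_poly (y + w) - trig_poly grid_trig_poly y| <= lam * L * (h + eta).
  have := grid_approx_lattice_lip (y - lattice r') r r'.
  rewrite -!grid_trig_polyE subrK -addrA [- _ + _]addrC => /le_trans; apply.
  by rewrite ler_wpM2l.
have B2 : `|trig_poly grid_trig_poly (y + h *: v) - trig_poly grid_trig_poly (y + w)| <= Gam * K * eta.
  have [+ _] := grid_trig_poly_bounds (y + w) (h *: v - w).
  rewrite (_ : y + w + (h *: v - w) = y + h *: v); last by rewrite addrACA subrr addr0.
  move=> /le_trans; apply; rewrite ler_wpM2l ?mulr_ge0//.
  by rewrite -enormN opprB.
have [_ B3] := grid_trig_poly_bounds y (h *: v); rewrite hv in B3.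
have dZ : dtrig_poly grid_trig_poly y (h *: v) = h * dtrig_poly grid_trig_poly y v.
  by rewrite /dtrig_poly mulrN mulr_sumr; congr (- _); apply: eq_bigr => z _; rewrite dotpZr; ring.
rewrite -(ler_pM2l h0) -[X in X * `|_|](gtr0_norm h0) -normrM -dZ.
have -> : dtrig_poly grid_trig_poly y (h *: v) =
  (trig_poly grid_trig_poly (y + w) - trig_poly grid_trig_poly y) + (trig_poly grid_trig_poly (y + h *: v) - trig_poly grid_trig_poly (y + w))
   - (trig_poly grid_trig_poly (y + h *: v) - trig_poly grid_trig_poly y - dtrig_poly grid_trig_poly y (h *: v)) by ring.
have -> : h * (lam * L + Gam * K * h + (lam * L + Gam * K) * eta / h) =
  lam * L * (h + eta) + Gam * K * eta + Gam * K * h ^+ 2 by field; rewrite gt_eqF.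
rewrite (le_trans (ler_normB _ _))// lerD//.
by rewrite (le_trans (ler_normD _ _))// lerD.
Qed.

End grid_approximation.

Lemma exists_natS_ge (R : realType) (b : R) : exists N : nat, b <= N.+1%:R.
Proof.
have [b0|b0] := leP 0 b; last by exists 0; rewrite (le_trans (ltW b0)).
by exists (Num.truncn b); have /andP[_ /ltW] := truncn_itv b0.
Qed.

(** The choices are nested: [L], then [mu] and the degree [N], then [h], and last the number of
    nodes. This order works because the constant [K] depends on the kernel, hence on [N], but not on
    the mesh. *)
Lemma trig_approx (R : realType) (k : nat) (g : 'cV[R]_k -> R) (lam eps : R) :
  0 <= lam -> 0 < eps -> (forall x y, `|g x - g y| <= lam * enorm (x - y)) ->
  exists s : seq (R * 'cV[R]_k * R),
    (forall y v, `|dtrig_poly s y v| <= (lam + eps) * enorm v) /\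
    forall x, `|trig_poly s x - g x| <= eps * (1 + dotp x x).
Proof.
move=> lam0 eps0 glip.
(* Gives [lam / L <= eps], for the error of periodization, and [L >= 1], so that dilating by [L^-1]
   does not enlarge the gradient error. *)
pose L := 1 + lam / eps.
have L1 : 1 <= L by rewrite lerDl divr_ge0// ltW.
have L0 : 0 < L by exact: lt_le_trans ltr01 L1.
have lamL : 0 <= lam * L by rewrite mulr_ge0// ltW.
pose mu := eps / (lam * L + 1).
have den0 : 0 < lam * L + 1 by rewrite ltr_wpDl.
have mu0 : 0 < mu by rewrite divr_gt0.
have mule : lam * L * mu <= eps.
  by rewrite /mu mulrA ler_pdivrMr// [eps * _]mulrC ler_wpM2r ?(ltW eps0)// lerDl.
have [N HN] := exists_natS_ge (lam * L * (2 * k%:R) / (mu * eps)).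
have [s0 s0E] : is_trig_poly (@kernel R k N).
  apply: is_trig_poly_prod => i; apply: is_trig_polyX.
  by apply: is_trig_polyD; [exact: is_trig_poly_cst|exact: is_trig_poly_cos_coord].
have [K K0 s0K] := trig_poly_bounds s0.
pose Gam := `|g 0| + lam * (L * k%:R); pose D := Gam * K.
have Gam0 : 0 <= Gam by rewrite addr_ge0// !mulr_ge0// ltW.
have D0 : 0 <= D by rewrite mulr_ge0.
pose h := eps / (2 * (D + 1)).
have D1 : 0 < 2 * (D + 1) by rewrite mulr_gt0// ltr_wpDl.
have h0 : 0 < h by rewrite divr_gt0.
have Dh : D * h <= eps / 2.
  have hE : h * (2 * (D + 1)) = eps by rewrite divfK// gt_eqF.
  have -> : eps / 2 = D * h + h by rewrite -hE; field.
  by rewrite lerDl ltW.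
have [m0 Hm0] := exists_natS_ge ((lam * L + D) * (pi *+ 2 * k%:R) * 2 / (h * eps)).
pose m := maxn N.+1 m0.
have Nm : (N < m)%N by rewrite /m leq_maxl.
have m1 : 0 < m.+1%:R :> R by rewrite ltr0n.
have Hm : (lam * L + D) * (pi *+ 2 * k%:R / m.+1%:R) / h <= eps / 2.
  have : (lam * L + D) * (pi *+ 2 * k%:R) * 2 / (h * eps) <= m.+1%:R.
    by rewrite (le_trans Hm0)// ler_nat ltnS leq_maxr.
  rewrite (ler_pdivrMr _ _ (mulr_gt0 h0 eps0)) => H.
  rewrite ler_pdivrMr// mulrA ler_pdivrMr//.
  rewrite (_ : eps / 2 * h * m.+1%:R = (m.+1%:R * (h * eps)) / 2); last by ring.
  by rewrite ler_pdivlMr.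
pose sG := grid_trig_poly g L N m s0.
have grad y v : `|dtrig_poly sG y v| <= (lam * L + eps) * enorm v.
  have [->|v0] := eqVneq v 0.
    have -> : dtrig_poly sG y 0 = 0.
      by rewrite /dtrig_poly big1 ?oppr0// => z _; rewrite dotp0r !mulr0.
    by rewrite normr0 mulr_ge0 ?enorm_ge0// addr_ge0// ltW.
  have ev := enorm_gt0 v0; set e := enorm v in ev *.
  have vE : v = e *: (e^-1 *: v) by rewrite scalerA divff ?scale1r// gt_eqF.
  have e1 : enorm (e^-1 *: v) = 1.
    by rewrite enormZ gtr0_norm ?invr_gt0// -/e mulVf// gt_eqF.
  have -> : dtrig_poly sG y v = e * dtrig_poly sG y (e^-1 *: v).
    rewrite {1}vE /dtrig_poly mulrN mulr_sumr; congr (- _); apply: eq_bigr => z _.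
    by rewrite dotpZr; ring.
  rewrite normrM gtr0_norm// mulrC ler_wpM2r ?(ltW ev)//.
  have := @grid_trig_poly_gradient R k g lam L N m lam0 L0 Nm glip s0 s0E K K0 s0K y (e^-1 *: v) h h0 e1.
  rewrite -/Gam -/D -/sG => /le_trans; apply.
  by rewrite -addrA lerD2l [leRHS](splitr eps) lerD.
exists (trig_poly_dilate sG L^-1); split => [y v|x].
  rewrite dtrig_poly_dilateE (le_trans (grad _ _))// enormZ gtr0_norm ?invr_gt0//.
  rewrite mulrA ler_wpM2r ?enorm_ge0// mulrDl mulfK ?gt_eqF// lerD2l.
  by rewrite ler_pdivrMr// ler_peMr// ltW.
rewrite trig_poly_dilateE (grid_trig_polyE g L m s0E); set y := L^-1 *: x.
have -> : grid_approx g L N m y - g x =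
    (grid_approx g L N m y - periodized g L y) + (periodized g L y - g x) by ring.
rewrite (le_trans (ler_normD _ _))// mulrDr mulr1 lerD//.
  rewrite (le_trans (grid_approx_close lam0 L0 Nm glip y mu0))//.
  have N1 : 0 < N%:R + 1 :> R by rewrite ltr_wpDl.
  have H1 : lam * L * (2 * k%:R / (N%:R + 1) / mu) <= eps.
    move: HN; rewrite -[N.+1%:R]natr1 (ler_pdivrMr _ _ (mulr_gt0 mu0 eps0)) => HN.
    rewrite mulrA ler_pdivrMr// mulrA ler_pdivrMr//.
    have -> : eps * mu * (N%:R + 1) = (N%:R + 1) * (mu * eps) by ring.
    exact: HN.
  rewrite mulrA ler_pdivrMr// mulrDr; lra.
rewrite (le_trans (glip _ _))//.
(* Each coordinate satisfies [|L sin (x_i / L) - x_i| <= x_i ^ 2 / L]; this is the source of the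
   quadratic growth in the error bound. *)
apply: (@le_trans _ _ (lam * (L^-1 * dotp x x))).
  rewrite ler_wpM2l// (le_trans (enorm_le_sum _))// /dotp mulr_sumr ler_sum// => i _.
  rewrite !mxE; have := sin_taylor1 0 (L^-1 * x i 0).
  rewrite add0r sin0 cos0 subr0 mulr1 => H.
  have -> : L * sin (L^-1 * x i 0) - x i 0 = L * (sin (L^-1 * x i 0) - L^-1 * x i 0).
    by field; rewrite gt_eqF.
  rewrite normrM gtr0_norm// (le_trans (ler_wpM2l (ltW L0) H))//.
  rewrite le_eqVlt; apply/orP; left; apply/eqP; field; by rewrite gt_eqF.
rewrite mulrA ler_wpM2r ?dotp_ge0// ler_pdivrMr// /L mulrDr mulr1.
by rewrite mulrCA divff ?mulr1 ?gt_eqF// lerDr ltW.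
Qed.

(** * Cholesky factorization and operator norm *)

Lemma dotp_col_mx (R : realType) (p q : nat) (x y : 'cV[R]_p) (z w : 'cV[R]_q) :
  dotp (col_mx x z) (col_mx y w) = dotp x y + dotp z w.
Proof.
rewrite /dotp big_split_ord; congr (_ + _); apply: eq_bigr => i _.
  by rewrite !col_mxEu.
by rewrite !col_mxEd.
Qed.

Lemma cholesky (R : realType) (k : nat) (C : 'M[R]_k) : C^T = C ->
  (forall v, v != 0 -> 0 < dotp v (C *m v)) ->
  exists L : 'M[R]_k, L *m L^T = C /\ L \in unitmx.
Proof.
elim: k C => [|k ih] C CT Cpos.
  by exists 1%:M; split; [apply/matrixP => -[]|exact: unitmx1].
pose C' : 'M[R]_(1 + k) := C.
pose a : R := ulsubmx C' 0 0; pose u : 'cV[R]_k := dlsubmx C'; pose S : 'M[R]_k := drsubmx C'.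
have CE : C' = block_mx a%:M u^T u S.
  rewrite -[LHS]submxK -/u -/S; congr block_mx.
    exact: mx11_scalar.
  by rewrite /u trmx_dlsub -[in LHS](CT : C'^T = C').
have ST : S^T = S by rewrite /S trmx_drsub (CT : C'^T = C').
have formE (x : R) (w : 'cV[R]_k) : dotp (col_mx x%:M w) (C' *m col_mx x%:M w) =
    a * x ^+ 2 + 2 * x * dotp u w + dotp w (S *m w).
  rewrite CE mul_block_col dotp_col_mx [X in _ + X]dotpDr [u *m _]mul_mx_scalar.
  rewrite [dotp w (x *: u)]dotpZr (dotpC w u).
  rewrite [X in X + _]/dotp big_ord1 -scalar_mxM.
  have -> : (u^T *m w) = (dotp u w)%:M by rewrite dotpE -mx11_scalar.
  by rewrite !mxE !eqxx !mulr1n; ring.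
have formP (x : R) (w : 'cV[R]_k) : (col_mx x%:M w : 'cV[R]_(1 + k)) != 0 ->
    0 < a * x ^+ 2 + 2 * x * dotp u w + dotp w (S *m w).
  by move=> nz; rewrite -formE; exact: (Cpos (col_mx x%:M w : 'cV[R]_(1 + k)) nz).
have a0 : 0 < a.
  have := formP 1 0.
  rewrite expr1n mulmx0 !dotp0r !mulr0 !addr0 mulr1; apply.
  apply/eqP => /colP/(_ (lshift k (0 : 'I_1))); rewrite col_mxEu !mxE eqxx mulr1n.
  by move/eqP; rewrite oner_eq0.
have aN : a != 0 by rewrite gt_eqF.
(* The Schur complement. Its form at [w] is that of [C] at the vector with first entry
   [- dotp u w / a] and remainder [w], so it stays positive definite. *)
pose S' := S - a^-1 *: (u *m u^T).
have S'T : S'^T = S' by rewrite /S' linearB linearZ/= trmx_mul trmxK ST.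
have S'pos w : w != 0 -> 0 < dotp w (S' *m w).
  move=> w0; have H := formP (- (dotp u w / a)) w.
  have -> : dotp w (S' *m w) = a * (- (dotp u w / a)) ^+ 2 +
      2 * (- (dotp u w / a)) * dotp u w + dotp w (S *m w).
    rewrite mulmxBl -scalemxAl dotpDr dotpNr dotpZr -mulmxA.
    have -> : (u^T *m w) = (dotp u w)%:M by rewrite dotpE -mx11_scalar.
    by rewrite mul_mx_scalar dotpZr (dotpC w u); field.
  apply: H; apply: contra_neq w0 => /(congr1 dsubmx); rewrite col_mxKd => ->.
  by apply/colP => i; rewrite !mxE.
have [L' [L'E L'u]] := ih S' S'T S'pos.
pose al := Num.sqrt a.
have al2 : al * al = a by rewrite -expr2 sqr_sqrtr// ltW.
have alN : al != 0 by rewrite gt_eqF// sqrtr_gt0.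
pose Lm : 'M[R]_(1 + k) := block_mx al%:M 0 (al^-1 *: u) L'.
have LmE : Lm *m Lm^T = C'.
  rewrite CE /Lm tr_block_mx mulmx_block !trmx0 !mulmx0 !mul0mx !addr0.
  rewrite tr_scalar_mx -scalar_mxM al2; congr block_mx.
  - by rewrite linearZ/= mul_scalar_mx scalerA mulfV// scale1r.
  - by rewrite mul_mx_scalar scalerA mulfV// scale1r.
  - rewrite linearZ/= -scalemxAr -scalemxAl scalerA L'E /S' -invfM al2.
    by rewrite addrC subrK.
have Lmu : Lm \in unitmx.
  rewrite unitmxE det_lblock det_scalar1 unitrM -[\det L' \is a _]/(L' \in unitmx) L'u andbT.
  by rewrite unitfE.
by exists Lm.
Qed.

Section operator_norm.
Variables (R : realType) (k : nat) (C L : 'M[R]_k).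
Hypothesis LC : L *m L^T = C.

Lemma opnorm_ge (v : 'cV[R]_k) : enorm v = 1 -> dotp (C *m v) v <= opnorm C.
Proof.
move=> v1; apply: ub_le_sup; last by exists v => //; exists v.
exists (\sum_i \sum_j `|C i j|) => _ [x x1] [w w1] <-.
rewrite (le_trans (ler_norm _))// (le_trans (cauchy_schwarz _ _))// w1 mulr1.
rewrite (le_trans (enorm_le_sum _))//; apply: ler_sum => i _.
rewrite mxE (le_trans (ler_norm_sum _ _ _))//; apply: ler_sum => j _.
by rewrite normrM ler_piMr// (le_trans (coord_le_enorm x j))// x1.
Qed.

Lemma dotp_gram v : dotp (C *m v) v = enorm (L^T *m v) ^+ 2.
Proof. by rewrite sqr_enorm -LC -mulmxA dotp_mulmxl. Qed.

Lemma enorm_le_opnorm_tr v : enorm (L^T *m v) <= Num.sqrt (opnorm C) * enorm v.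
Proof.
have [->|v0] := eqVneq v 0; first by rewrite mulmx0 !enorm0 mulr0.
have ev := enorm_gt0 v0.
have vE : v = enorm v *: ((enorm v)^-1 *: v) by rewrite scalerA divff ?scale1r// gt_eqF.
set w := _^-1 *: v in vE.
have w1 : enorm w = 1 by rewrite enormZ gtr0_norm ?invr_gt0// mulVf// gt_eqF.
rewrite {1}vE -scalemxAr enormZ gtr0_norm// mulrC ler_wpM2r ?enorm_ge0//.
rewrite -[leLHS]ger0_norm ?enorm_ge0// -sqrtr_sqr ler_wsqrtr//.
by rewrite -dotp_gram opnorm_ge.
Qed.

(** The form of [C] controls [L^T] directly; Cauchy-Schwarz applied to [dotp v (L^T *m (L *m v))]
    carries the bound over to [L]. *)
Lemma enorm_le_opnorm v : enorm (L *m v) <= Num.sqrt (opnorm C) * enorm v.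
Proof.
have [e0|e0] := leP (enorm (L *m v)) 0.
  by rewrite (le_trans e0)// mulr_ge0 ?sqrtr_ge0 ?enorm_ge0.
rewrite -(ler_pM2l e0) -expr2 sqr_enorm dotp_mulmxl.
rewrite (le_trans (ler_norm _))// (le_trans (cauchy_schwarz _ _))//.
rewrite [leRHS]mulrCA [leRHS]mulrA [leLHS]mulrC ler_wpM2r ?enorm_ge0//.
exact: enorm_le_opnorm_tr.
Qed.

End operator_norm.

(** * Moments of a centered Gaussian vector *)

Lemma enorm_lipschitz_continuous (R : realType) (k : nat) (g : 'cV[R]_k -> R) (K : R) :
  0 <= K -> (forall x y, `|g x - g y| <= K * enorm (x - y)) -> continuous g.
Proof.
move=> K0 gK; apply: (@lipschitz_continuous _ _ _ _ (K * k%:R)) => x y.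
rewrite (le_trans (gK x y))// -mulrA ler_wpM2l// (le_trans (enorm_le_sum _))//.
have -> : k%:R * `|x - y| = \sum_(i < k) `|x - y|.
  by rewrite sumr_const card_ord mulr_natl.
by apply: ler_sum => i _; exact: entry_le_norm.
Qed.

Section centered_gaussian.
Context (R : realType) (k : nat) d (T : measurableType d) (P : probability T R).
Variables (Y : {RV P >-> borel 'cV[R]_k}) (C : 'M[R]_k).
Hypothesis hY : is_centered_gaussian P C (Y : T -> 'cV[R]_k).
Let Yv (t : T) : 'cV[R]_k := Y t.
Let PT : P setT = 1%E. Proof. exact: probability_setT. Qed.

Lemma measurable_lipschitz_gaussian (g : 'cV[R]_k -> R) (K : R) : 0 <= K ->
  (forall x y, `|g x - g y| <= K * enorm (x - y)) -> measurable_fun setT (fun t => g (Yv t)).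
Proof.
move=> K0 gK.
have mg := continuous_borel_measurable (enorm_lipschitz_continuous K0 gK).
exact: (measurableT_comp mg (measurable_funP Y)).
Qed.

Lemma measurable_dotp_gaussian a : measurable_fun setT (fun t => dotp a (Yv t)).
Proof.
apply: (@measurable_lipschitz_gaussian (dotp a) (enorm a)); first exact: enorm_ge0.
by move=> x y; rewrite -dotpNr -dotpDr cauchy_schwarz.
Qed.

Let nY a : is_normal P (fun t => dotp a (Yv t)).
Proof. by case: hY => + _ _; apply. Qed.

Let int_coord i : int_on P setT (fun t => Yv t i 0).
Proof.
have := int_is_normal_id (measurable_dotp_gaussian (delta_mx i 0)) (nY (delta_mx i 0)).
by under eq_fun do rewrite dotp_delta.
Qed.

Let int_coord_sqr i : int_on P setT (fun t => Yv t i 0 ^+ 2).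
Proof.
have := int_is_normal_sqr (measurable_dotp_gaussian (delta_mx i 0)) (nY (delta_mx i 0)).
by under eq_fun do rewrite dotp_delta.
Qed.

Let measurable_coord i : measurable_fun setT (fun t => Yv t i 0).
Proof.
have := measurable_dotp_gaussian (delta_mx i 0).
by under eq_fun do rewrite dotp_delta.
Qed.

Let int_coord_mul i j : int_on P setT (fun t => Yv t i 0 * Yv t j 0).
Proof.
apply: (@le_int_on _ _ _ P setT measurableT _ (fun t => Yv t i 0 ^+ 2 + Yv t j 0 ^+ 2)).
- by apply: measurable_funM; exact: measurable_coord.
- move=> t _; move: (Yv t i 0) (Yv t j 0) => x y.
  rewrite ler_norml; apply/andP; split.
    by have := sqr_ge0 (x + y); have := sqr_ge0 x; have := sqr_ge0 y; nra.
  by have := sqr_ge0 (x - y); have := sqr_ge0 x; have := sqr_ge0 y; nra.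
- by apply: int_onD.
Qed.

Lemma gaussian_mean i : E_on P setT (fun t => Yv t i 0) = 0.
Proof.
have [_ + _] := hY; move=> /(_ i); rewrite unlock => H.
by rewrite /E_on /Rintegral H.
Qed.

Lemma gaussian_covariance i j : E_on P setT (fun t => Yv t i 0 * Yv t j 0) = C i j.
Proof.
have [_ m +] := hY; move=> /(_ i j); rewrite unlock !m => H.
have {}H : ('E_P[fun t => (Yv t i 0 * Yv t j 0)%R] = (C i j)%:E)%E.
  by rewrite -H; congr expectation; apply/funext => t /=; rewrite !fctE/= !subr0.
by move: H; rewrite unlock => H; rewrite /E_on /Rintegral H.
Qed.

Lemma gaussian_dotp_mean a : E_on P setT (fun t => dotp a (Yv t)) = 0.
Proof.
rewrite /dotp (E_on_sum measurableT PT); last by move=> i; exact: int_onZ.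
by rewrite big1// => i _; rewrite (E_onZ measurableT)// gaussian_mean mulr0.
Qed.

Lemma gaussian_dotp_sqr a : E_on P setT (fun t => dotp a (Yv t) ^+ 2) = dotp a (C *m a).
Proof.
have I2 i j : int_on P setT (fun t => a i 0 * a j 0 * (Yv t i 0 * Yv t j 0)) by exact: int_onZ.
transitivity (E_on P setT (fun t => \sum_i \sum_j a i 0 * a j 0 * (Yv t i 0 * Yv t j 0))).
  apply: eq_E_on => t _; rewrite expr2 /dotp mulr_suml; apply: eq_bigr => i _.
  by rewrite mulr_sumr; apply: eq_bigr => j _; ring.
rewrite (E_on_sum measurableT PT); last by move=> i; exact: int_on_sum.
apply: eq_bigr => i _; rewrite (E_on_sum measurableT PT)// mxE mulr_sumr.
apply: eq_bigr => j _; rewrite (E_onZ measurableT)// gaussian_covariance; ring.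
Qed.

End centered_gaussian.

(** * Transfer from the random matrix to its law, and integrability *)

Section haar_transfer.
Context (R : realType) (n : nat) d (T : measurableType d) (P : probability T R).
Variable M : {RV P >-> borel 'M[R]_n}.
Hypothesis hM : is_haar_orthogonal (distribution P M).
Let D : set (borel 'M[R]_n) := @orthogonal_group R n.

(** Off the orthogonal group [h] is uncontrolled, so the image law formula is applied to its
    cut-off; the two agree almost surely along [M]. *)
Lemma haar_expectation (h : 'M[R]_n -> R) : mbounded h ->
  (\int[P]_t (h (M t))%:E = (E_on (distribution P M) D h)%:E)%E.
Proof.
move=> gh; have mD := @measurable_orthogonal R n; have [mh [K hK]] := gh.
have Ih := mbounded_int (distribution P M) gh.
rewrite -(E_onE mD Ih) [RHS]integral_mkcond.
pose f : borel 'M[R]_n -> \bar R := (fun Q => (h Q)%:E) \_ D.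
have mf : measurable_fun setT f.
  apply/(measurable_restrict _ mD) => //; rewrite setTI; apply/measurable_EFinP.
  exact: measurable_funS mh.
have mM := measurable_funP M.
have mhM : measurable_fun setT ((h : borel 'M[R]_n -> R) \o M) by exact: measurableT_comp.
have mfM : measurable_fun setT (f \o M) by exact: measurableT_comp.
have If : P.-integrable setT (f \o M).
  apply: (@le_integrable _ _ _ P setT measurableT _ (fun=> (K%:E))) => //.
    move=> t _ /=; rewrite /f patchE; case: ifPn => [/set_mem Dt|_].
      by rewrite lee_fin (le_trans (hK _ Dt))//; exact: ler_norm.
    by rewrite abse0 lee_fin normr_ge0.
  exact: finite_measure_integrable_cst.
transitivity (\int[P]_t (f \o M) t)%E; last by rewrite -(integral_distribution mf If).
apply: ae_eq_integral => //.
  by apply/measurable_EFinP; exact: mhM.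
exists (M @^-1` (~` D)); split.
- rewrite -[X in measurable X]setTI; apply: mM => //; exact: measurableC.
- have := @probability_setC _ _ _ (distribution P M) _ mD.
  rewrite (haar_orthogonal1 hM) subee// => H; exact: H.
- move=> t /= nt Dt; apply: nt => _; rewrite /f /= patchE.
  by rewrite mem_set.
Qed.

End haar_transfer.

Lemma enorm_le1Ddotp (R : realType) (k : nat) (x : 'cV[R]_k) : enorm x <= 1 + dotp x x.
Proof. by rewrite -sqr_enorm; have := sqr_ge0 (enorm x - 1); have := enorm_ge0 x; nra. Qed.

Lemma lipschitz_growth (R : realType) (k : nat) (g : 'cV[R]_k -> R) (lam : R) : 0 <= lam ->
  (forall x y, `|g x - g y| <= lam * enorm (x - y)) ->
  forall x, `|g x| <= `|g 0| + lam * (1 + dotp x x).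
Proof.
move=> lam0 glip x; rewrite -[g x](subrK (g 0)) [_ + g 0]addrC (le_trans (ler_normD _ _))//.
rewrite lerD2l (le_trans (glip _ _))// subr0 ler_wpM2l//; exact: enorm_le1Ddotp.
Qed.

Section lin_stat.
Variables (R : realType) (n k : nat) (B : 'I_k -> 'M[R]_n).

Lemma lin_stat_continuous : continuous (lin_stat B).
Proof.
pose K := \sum_i \sum_p \sum_q `|B i p q|.
have K0 : 0 <= K by do 3 (apply: sumr_ge0 => ? _).
apply: (@lipschitz_continuous _ _ _ _ K) => M N.
apply: norm_le_entries => [|i j]; first by rewrite mulr_ge0.
rewrite !mxE -linearB/= -mulmxBr /mxtrace (le_trans (ler_norm_sum _ _ _))//.
apply: (@le_trans _ _ ((\sum_p \sum_q `|B i p q|) * `|M - N|)).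
  rewrite mulr_suml; apply: ler_sum => p _; rewrite mxE (le_trans (ler_norm_sum _ _ _))// mulr_suml.
  by apply: ler_sum => q _; rewrite normrM ler_wpM2l// entry_le_norm.
rewrite ler_wpM2r// /K (bigD1 i)//= lerDl.
by do 3 (apply: sumr_ge0 => ? _).
Qed.

Lemma mbounded_dotp_lin_stat a : mbounded (fun M => dotp a (lin_stat B M)).
Proof. by under eq_fun do rewrite dotp_lin_stat; exact: mbounded_tr. Qed.

Lemma mbounded_dotp2_lin_stat : mbounded (fun M => dotp (lin_stat B M) (lin_stat B M)).
Proof.
rewrite /dotp; apply: mbounded_sum => i; rewrite (_ : (fun M => _) = fun M => dotp (delta_mx i 0) (lin_stat B M) ^+ 2).
  apply: mboundedX; exact: mbounded_dotp_lin_stat.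
by apply/funext => M; rewrite dotp_delta expr2.
Qed.

Lemma mbounded_trig_poly_lin_stat s : mbounded (fun M => trig_poly s (lin_stat B M)).
Proof.
rewrite /trig_poly; apply: mbounded_sum => z; apply: mboundedM; first exact: mbounded_cst.
by apply: mbounded_cos; apply: mboundedD; [exact: mbounded_dotp_lin_stat|exact: mbounded_cst].
Qed.

Lemma mbounded_lipschitz_lin_stat (g : 'cV[R]_k -> R) (lam : R) : 0 <= lam ->
  (forall x y, `|g x - g y| <= lam * enorm (x - y)) -> mbounded (fun M => g (lin_stat B M)).
Proof.
move=> lam0 glip; split.
  apply: (@continuous_borel_measurable R 'M[R]_n (g \o lin_stat B)) => M.
  apply: continuous_comp; first exact: lin_stat_continuous.
  exact: enorm_lipschitz_continuous lam0 glip _.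
have [_ [K HK]] := mbounded_dotp2_lin_stat; exists (`|g 0| + lam * (1 + K)) => Q OQ.
rewrite (le_trans (lipschitz_growth lam0 glip _))// lerD2l ler_wpM2l// lerD2l.
by rewrite (le_trans (ler_norm _))// HK.
Qed.

End lin_stat.

Section standard_gaussian_growth.
Context d (T : measurableType d) (R : realType) (P : probability T R) (k : nat).
Variable Z : T -> 'cV[R]_k.
Hypotheses (mZ : forall a, measurable_fun setT (fun t => dotp a (Z t)))
  (nZ : forall a, is_normal P (fun t => dotp a (Z t))).

Lemma int_dotp2_gaussian : int_on P setT (fun t => dotp (Z t) (Z t)).
Proof.
rewrite /dotp; apply: int_on_sum => // i; rewrite (_ : (fun M => _) = fun t => dotp (delta_mx i 0) (Z t) ^+ 2).
  exact: int_is_normal_sqr (mZ _) (nZ _).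
by apply/funext => M; rewrite dotp_delta expr2.
Qed.

Lemma int_lipschitz_gaussian (g : 'cV[R]_k -> R) (lam : R) : 0 <= lam ->
  (forall x y, `|g x - g y| <= lam * enorm (x - y)) ->
  measurable_fun setT (fun t => g (Z t)) -> int_on P setT (fun t => g (Z t)).
Proof.
move=> lam0 glip mg.
apply: (@le_int_on _ _ _ P setT measurableT _ (fun t => `|g 0| + lam * (1 + dotp (Z t) (Z t)))) => //.
  by move=> t _; exact: lipschitz_growth.
apply: int_onD => //; first exact: int_on_cst.
apply: int_onZ => //; apply: int_onD => //; [exact: int_on_cst|exact: int_dotp2_gaussian].
Qed.

Lemma int_trig_poly_gaussian s : int_on P setT (fun t => trig_poly s (Z t)).
Proof.
rewrite /trig_poly; apply: int_on_sum => // z; apply: int_onZ => //.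
by apply: int_trig_gaussian; [exact: mZ|exact: continuous_cos|exact: normr_cos_le1].
Qed.

End standard_gaussian_growth.

(** * Lipschitz test functions in the orthonormal case *)

Section lipschitz_case.
Variables (R : realType) (n k : nat) (mu : probability (borel 'M[R]_n) R).
Hypotheses (hmu : is_haar_orthogonal mu) (hn : (2 <= n)%N) (hk : (0 < k)%N).
Let D : set (borel 'M[R]_n) := @orthogonal_group R n.
Variable B : 'I_k -> 'M[R]_n.
Hypothesis onB : forall i j, \tr (B i *m (B j)^T) = n%:R * (i == j)%:R.
Context d (T : measurableType d) (P : probability T R).
Variable Z : T -> 'cV[R]_k.
Hypotheses (mZ : forall a, measurable_fun setT (fun t => dotp a (Z t)))
  (nZ : forall a, is_normal P (fun t => dotp a (Z t)))
  (EZ : forall a, E_on P setT (fun t => dotp a (Z t)) = 0)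
  (VZ : forall a, E_on P setT (fun t => dotp a (Z t) ^+ 2) = dotp a a).

Lemma lin_stat_lipschitz_bound (g : 'cV[R]_k -> R) (lam : R) : 0 <= lam ->
  (forall x y, `|g x - g y| <= lam * enorm (x - y)) ->
  measurable_fun setT (fun t => g (Z t)) ->
  `|E_on mu D (fun M => g (lin_stat B M)) - E_on P setT (fun t => g (Z t))| <=
  lam * (k%:R * Num.sqrt 2) / (n%:R - 1).
Proof.
move=> lam0 glip mg.
have mD : measurable D := @measurable_orthogonal R n.
have muD : mu D = 1%E := haar_orthogonal1 hmu.
have PT : P setT = 1%E by exact: probability_setT.
have N0 : 0 < n%:R - 1 :> R by rewrite subr_gt0 ltr1n.
set c := k%:R * Num.sqrt 2.
have c0 : 0 <= c by rewrite mulr_ge0 ?sqrtr_ge0.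
pose a := E_on mu D (fun M => 1 + dotp (lin_stat B M) (lin_stat B M)).
pose b := E_on P setT (fun t => 1 + dotp (Z t) (Z t)).
have Ia : int_on mu D (fun M => 1 + dotp (lin_stat B M) (lin_stat B M)).
  by apply/mbounded_int; apply: mboundedD; [exact: mbounded_cst|exact: mbounded_dotp2_lin_stat].
have Ib : int_on P setT (fun t => 1 + dotp (Z t) (Z t)).
  by apply: int_onD => //; [exact: int_on_cst|exact: int_dotp2_gaussian mZ nZ].
have a0 : 0 <= a.
  rewrite -(E_on_cst mD muD 0); apply: le_E_on => //; first exact: int_on_cst.
  by move=> M _; rewrite addr_ge0// dotp_ge0.
have b0 : 0 <= b.
  rewrite -(E_on_cst measurableT PT 0); apply: le_E_on => //; first exact: int_on_cst.
  by move=> M _; rewrite addr_ge0// dotp_ge0.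
(* Total error per unit of [eps]: the enlarged Lipschitz constant, and the approximation error
   averaged under each of the two laws. The 1 makes [w] positive. *)
pose w := c / (n%:R - 1) + a + b + 1.
have w0 : 0 < w by rewrite ltr_wpDl// !addr_ge0// divr_ge0// ltW.
apply/ler_addgt0Pr => e e0; pose eps := e / w.
have eps0 : 0 < eps by rewrite divr_gt0.
have [s [s1 s2]] := trig_approx lam0 eps0 glip.
have S := lin_stat_trig_poly_bound hmu hn hk onB mZ nZ EZ VZ (addr_ge0 lam0 (ltW eps0)) s1.
have Ig := mbounded_int mu (mbounded_lipschitz_lin_stat B lam0 glip).
have Is := mbounded_int mu (mbounded_trig_poly_lin_stat B s).
have Jg := int_lipschitz_gaussian mZ nZ lam0 glip mg.
have Js := int_trig_poly_gaussian P mZ s.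
have H1 : `|E_on mu D (fun M => g (lin_stat B M)) - E_on mu D (fun M => trig_poly s (lin_stat B M))| <= eps * a.
  rewrite distrC -(E_onB mD)// -(E_onZ mD)//; apply: (normr_E_on_le mD) => //.
  - exact: int_onB.
  - exact: int_onZ.
have H2 : `|E_on P setT (fun t => trig_poly s (Z t)) - E_on P setT (fun t => g (Z t))| <= eps * b.
  rewrite -(E_onB measurableT)// -(E_onZ measurableT)//; apply: (normr_E_on_le measurableT) => //.
  - exact: int_onB.
  - exact: int_onZ.
rewrite -[X in `|X - _|](subrK (E_on mu D (fun M => trig_poly s (lin_stat B M)))) -addrA.
rewrite (le_trans (ler_normD _ _))//.
rewrite -[X in _ + `|X - _|](subrK (E_on P setT (fun t => trig_poly s (Z t)))) -[X in _ + `|X|]addrA.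
have H3 := ler_normD (E_on mu D (fun M => trig_poly s (lin_stat B M)) - E_on P setT (fun t => trig_poly s (Z t)))
  (E_on P setT (fun t => trig_poly s (Z t)) - E_on P setT (fun t => g (Z t))).
apply: le_trans (lerD H1 (le_trans H3 (lerD S H2))) _.
have -> : e = eps * w by rewrite /eps divfK// gt_eqF.
have -> : eps * a + ((lam + eps) * (k%:R * Num.sqrt 2) / (n%:R - 1) + eps * b) =
  lam * c / (n%:R - 1) + (eps * w - eps) by rewrite /w /c; ring.
by rewrite lerD2l gerBl ltW.
Qed.

End lipschitz_case.

(** * Gram matrix and the general case *)

Section gram.
Variables (R : realType) (n k : nat) (B : 'I_k -> 'M[R]_n) (C : 'M[R]_k).
Hypotheses (n0 : (0 < n)%N) (CE : forall i j, n%:R * C i j = \tr (B i *m (B j)^T)).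

Lemma lin_comb_dotp a c : \tr (lin_comb B a *m (lin_comb B c)^T) = n%:R * dotp a (C *m c).
Proof.
rewrite mulmx_suml raddf_sum /dotp mulr_sumr; apply: eq_bigr => i _ /=.
rewrite linear_sum mulmx_sumr raddf_sum mxE !mulr_sumr; apply: eq_bigr => j _ /=.
rewrite linearZ/= -scalemxAl -scalemxAr !mxtraceZ -CE; ring.
Qed.

Lemma gram_sym : C^T = C.
Proof.
apply/matrixP => i j; rewrite mxE; apply: (@mulfI _ n%:R); first by rewrite pnatr_eq0 -lt0n.
by rewrite !CE -mxtrace_tr trmx_mul trmxK.
Qed.

(** Up to the factor [n], the form is the squared Frobenius norm of the combination of the [B i]
    with coefficients [v]. Linear independence thus makes the Cholesky factor invertible. *)
Lemma gram_pos : free [tuple B i | i < k] -> forall v, v != 0 -> 0 < dotp v (C *m v).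
Proof.
move=> freeB v v0; have N0 : 0 < n%:R :> R by rewrite ltr0n.
rewrite -(pmulr_rgt0 _ N0) -lin_comb_dotp lt_neqAle.
have -> : \tr (lin_comb B v *m (lin_comb B v)^T) = \sum_p \sum_q lin_comb B v p q ^+ 2.
  by apply: eq_bigr => p _; rewrite mxE; apply: eq_bigr => q _; rewrite mxE expr2.
have S0 p : 0 <= \sum_q lin_comb B v p q ^+ 2 by apply: sumr_ge0 => q _; exact: sqr_ge0.
rewrite sumr_ge0// andbT eq_sym; apply: contra_neqN v0 => /eqP H.
have A0 : lin_comb B v = 0.
  apply/matrixP => p q; rewrite mxE; apply/eqP; rewrite -sqrf_eq0; apply/eqP.
  have Hp : \sum_q lin_comb B v p q ^+ 2 = 0 by apply: (psumr_eq0P _ H).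
  by apply: (psumr_eq0P _ Hp) => // r _; exact: sqr_ge0.
apply/colP => i; rewrite mxE; move/freeP : freeB => /(_ (fun i => v i 0)); apply.
by rewrite -[RHS]A0; apply: eq_bigr => j _; rewrite -tnth_nth tnth_mktuple.
Qed.

End gram.

Theorem theorem11 (R : realType) (n k : nat) (hn : (2 <= n)%N)
  (B : 'I_k -> 'M[R]_n) (hB : free [tuple B i | i < k])
  (hBn : forall i, \tr (B i *m (B i)^T) = n%:R)
  (b : 'M[R]_k) (hb : b = \matrix_(i, j) \tr (B i *m (B j)^T))
  (C : 'M[R]_k) (hC : C = n%:R^-1 *: b)
  (d : measure_display) (T : measurableType d) (P : probability T R)
  (M : {RV P >-> borel 'M[R]_n})
  (hM : is_haar_orthogonal (distribution P M))
  (X : T -> 'cV[R]_k)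
  (hX : forall t, X t = \col_i \tr (B i *m (M t : 'M[R]_n)))
  (d' : measure_display) (T' : measurableType d') (P' : probability T' R)
  (Y : {RV P' >-> borel 'cV[R]_k})
  (hY : is_centered_gaussian P' C (Y : T' -> 'cV[R]_k)) :
  (wasserstein P X P' (Y : T' -> 'cV[R]_k) <=
     (k%:R * Num.sqrt (2 * opnorm C) / (n%:R - 1))%:E)%E.
Proof.
have n0 : (0 < n)%N by exact: leq_trans hn.
have nN0 : n%:R != 0 :> R by rewrite pnatr_eq0 -lt0n.
have CE i j : n%:R * C i j = \tr (B i *m (B j)^T).
  by rewrite hC hb !mxE mulrA divff// mul1r.
apply: ge_ereal_sup => _ [g /= glip <-].
(* For [k = 0] there is a single vector and [g] is constant; the AM-GM parameter [k sqrt 2] requires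
   [k > 0]. *)
have [k0|hk] := posnP k.
  have g0 x : g x = g 0 by congr g; apply/matrixP => i; have := ltn_ord i; rewrite {2}k0.
  rewrite (_ : g \o X = cst (g 0)); last by apply/funext => t; exact: g0.
  rewrite (_ : g \o (Y : T' -> 'cV[R]_k) = cst (g 0)); last by apply/funext => t; exact: g0.
  have -> : k%:R = 0 :> R by rewrite k0.
  by rewrite !expectation_cst subee// abse0 !mul0r.
have [L [LC Lu]] := cholesky (gram_sym n0 CE) (gram_pos n0 CE hB).
pose K := invmx L.
have LK : L *m K = 1%:M by exact: mulmxV.
have KL : K *m L = 1%:M by exact: mulVmx.
have KCK : K *m C *m K^T = 1%:M.
  by rewrite -LC mulmxA KL mul1mx -trmx_mul KL trmx1.
(* With coefficients from the inverse Cholesky factor the matrices become orthonormal up to the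
   factor [n], because [K C K^T = 1]; correspondingly [X] and [Y] are images under [L] of normalized
   vectors. *)
pose B' i := lin_comb B (row i K)^T.
have onB i j : \tr (B' i *m (B' j)^T) = n%:R * (i == j)%:R.
  rewrite (lin_comb_dotp CE) dotpE trmxK mulmxA -!row_mul; congr (_ * _).
  have -> : (i == j)%:R = (K *m C *m K^T) i j by rewrite KCK mxE.
  by rewrite !mxE; apply: eq_bigr => l _; rewrite !mxE.
have XE t : X t = L *m lin_stat B' (M t).
  rewrite -[LHS]mul1mx -LK -mulmxA; congr (_ *m _); apply/colP => i.
  rewrite hX [RHS]mxE mxtrace_mulC -dotp_lin_stat dotpE trmxK -row_mul [RHS]mxE.
  by [].
pose Z (t : T') : 'cV[R]_k := K *m (Y t : 'cV[R]_k).
have YE t : (Y t : 'cV[R]_k) = L *m Z t by rewrite mulmxA LK mul1mx.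
have dZ a : (fun t => dotp a (Z t)) = fun t => dotp (K^T *m a) (Y t).
  by apply/funext => t; rewrite dotp_mulmxr.
have mZ a : measurable_fun setT (fun t => dotp a (Z t)).
  by rewrite dZ; exact: measurable_dotp_gaussian.
have nZ a : is_normal P' (fun t => dotp a (Z t)).
  by rewrite dZ; case: hY => + _ _; exact.
have EZ a : E_on P' setT (fun t => dotp a (Z t)) = 0.
  by rewrite dZ; exact: gaussian_dotp_mean hY _.
have VZ a : E_on P' setT (fun t => dotp a (Z t) ^+ 2) = dotp a a.
  transitivity (E_on P' setT (fun t => dotp (K^T *m a) (Y t) ^+ 2)).
    by apply: eq_E_on => t _; rewrite dotp_mulmxr.
  by rewrite (gaussian_dotp_sqr hY) dotp_mulmxl trmxK !mulmxA KCK mul1mx.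
pose lam := Num.sqrt (opnorm C); pose g' x := g (L *m x).
have lam0 : 0 <= lam by exact: sqrtr_ge0.
have g'lip x y : `|g' x - g' y| <= lam * enorm (x - y).
  by rewrite (le_trans (glip _ _))// -mulmxBr enorm_le_opnorm.
have gY : (fun t => g' (Z t)) = fun t => g (Y t).
  by apply/funext => t; rewrite /g' -YE.
have mg' : measurable_fun setT (fun t => g' (Z t)).
  rewrite gY; apply: (@measurable_lipschitz_gaussian _ _ _ _ _ _ g 1) => // x y.
  by rewrite mul1r.
have -> : ('E_P[g \o X] = (E_on (distribution P M) (@orthogonal_group R n)
    (fun Q => g' (lin_stat B' Q)))%:E)%E.
  rewrite -haar_expectation//; last exact: mbounded_lipschitz_lin_stat lam0 g'lip.
  by rewrite unlock; apply: eq_integral => t _ /=; rewrite XE.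
have -> : ('E_P'[g \o (Y : T' -> 'cV[R]_k)] = (E_on P' setT (fun t => g' (Z t)))%:E)%E.
  rewrite -(E_onE measurableT (int_lipschitz_gaussian mZ nZ lam0 g'lip mg')).
  by rewrite unlock; apply: eq_integral => t _ /=; rewrite /g' -YE.
rewrite lee_fin (le_trans (lin_stat_lipschitz_bound hM hn hk onB mZ nZ EZ VZ lam0 g'lip mg'))//.
by rewrite sqrtrM// mulrCA [lam * _]mulrC.
Qed.
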